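(* Let $p$ be an odd prime and let $P$ be a noncyclic finite $p$-group. Let $\mathcal{E}(P)$ be the set of subgroups $X \leq P$ such that (i) $X$ is extraspecial of exponent $p$, and (ii) $\Omega_1(C_P(X)) = Z(X)$. Then there is a homotopy equivalence $$\Delta\mathcal{A}_{\geq 2}(P) \simeq \bigvee_{X \in \mathcal{E}(P)} \Delta\mathcal{A}_{\geq 2}(X).$$
   Context: For a finite $p$-group $Q$: $\mathcal{A}_{\geq 2}(Q)$ is the set of elementary abelian subgroups of $Q$ having order at least $p^2$, partially ordered by inclusion. For a poset $\mathcal{P}$, the order complex $\Delta\mathcal{P}$ is the abstract simplicial complex whose $k$-dimensional faces are the chains $x_0 < \cdots < x_k$ in $\mathcal{P}$; it is identified with its geometric realization. $\Omega_1(Q)$ is the subgroup generated by all elements of order $p$ in $Q$. $Q$ has exponent $p$ if $g^p=1$ for every $g \in Q$. $Q$ is extraspecial if its center $Z(Q)$ has order $p$ and $Q/Z(Q)$ is (nontrivial) elementary abelian. $C_P(X)$ is the centralizer of $X$ in $P$. The wedge of nonempty pairwise disjoint pointed spaces $(X_i,x_i)$ is the quotient of the disjoint union of the $X_i$ obtained by identifying all the $x_i$. When, for each $i$, the connected components of $X_i$ are pairwise homotopy equivalent (as is the case for each $\Delta\mathcal{A}_{\geq 2}(X)$ with $X$ extraspecial of exponent $p$), the homotopy type of the wedge does not depend on the base points, which are then omitted from the notation. By convention, the wedge of an empty collection of spaces is a point. *)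

(* Defs.v *)
From HB Require Import structures.
From mathcomp Require Import all_boot all_order all_algebra all_fingroup all_solvable.
From mathcomp Require Import all_classical all_reals topology normedtype homotopy.

Set Implicit Arguments.
Unset Strict Implicit.
Unset Printing Implicit Defensive.

Import Order.TTheory GRing.Theory Num.Theory.
Import numFieldNormedType.Exports.

Local Open Scope classical_set_scope.
Local Open Scope ring_scope.

(* The homotopy parameter ranges over the unit interval of R; what H does
   outside `[0, 1] is irrelevant, and only its restriction to
   [0, 1] x X is required to be continuous. *)
Definition homotopic (R : realType) (X Y : topologicalType) (f g : X -> Y) :=
  exists H : R * X -> Y,
    [/\ {within `[0, 1]%classic `*` [set: X], continuous H},
        forall x, H (0, x) = f x & forall x, H (1, x) = g x].

Definition homotopy_equivalent (R : realType) (X Y : topologicalType) :=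
  exists (f : X -> Y) (g : Y -> X),
    [/\ continuous f, continuous g,
        homotopic R (g \o f) id & homotopic R (f \o g) id].

(* The poset is a subset A of a finite type V, ordered by le. *)
Definition order_complex (V : finType) (le : rel V) (A : {set V}) :
    {set {set V}} :=
  [set c : {set V} | [&& c \subset A, c != finset.set0
    & [forall x in c, forall y in c, le x y || le y x]]]%SET.

(* Barycentric coordinates. As V is finite, the topology induced by the product
   topology of V -> R is the usual (coherent) one. *)
Definition geometric_realization (R : realType) (V : finType)
    (K : {set {set V}}) : set {ptws V -> R} :=
  [set w : {ptws V -> R} | [/\ forall v, 0 <= w v, \sum_v w v = 1
    & [set v | w v != 0]%SET \in K]].

Arguments geometric_realization R {V} K.

Definition realization (R : realType) (V : finType) (K : {set {set V}}) :
    topologicalType :=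
  set_type (geometric_realization R K).

(* The library's [wedge] of an empty family is the empty space; by convention
   it is a point here. *)
Definition wedge_sum (I : choiceType) (X : I -> topologicalType)
    (x0 : forall i, X i) : topologicalType :=
  if pselect (inhabited I) then (wedge x0 : topologicalType)
  else (discrete_topology unit : topologicalType).

Definition elem_abelian_ge2 (gT : finGroupType) (p : nat) (Q : {group gT}) :
    {set {group gT}} :=
  [set E in ('E_p(Q))%g | (p ^ 2 <= #|E|)%N]%SET.

Definition Delta_A2 (R : realType) (gT : finGroupType) (p : nat)
    (Q : {group gT}) : topologicalType :=
  realization R
    (order_complex (fun E F : {group gT} => E \subset F) (elem_abelian_ge2 p Q)).

Definition extraspecial_family (gT : finGroupType) (p : nat) (P : {group gT}) :
    set {group gT} :=
  [set X : {group gT} | [/\ X \subset P,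
     extraspecial X, (exponent X %| p)%N & ('Ohm_1('C_P(X)) = 'Z(X))%g]].

(* For p-groups, the library's [extraspecial] (Frattini subgroup, derived
   subgroup and center coincide and have prime order) amounts to the definition
   by the center and the central quotient. *)
Lemma extraspecialE (gT : finGroupType) (p : nat) (X : {group gT}) :
  prime p -> (p.-group X)%g ->
  extraspecial X <->
  [/\ #|'Z(X)%g| = p, (X / 'Z(X) != 1)%g & (p.-abelem (X / 'Z(X)))%g].
Proof.
move=> p_pr pX; split=> [esX | [oZ ntQ abQ]].
  have oZ := card_center_extraspecial pX esX.
  have [[Phi _] _] := esX.
  split=> //; last by rewrite -Phi; apply: Phi_quotient_abelem.
  rewrite -subG1 quotient_sub1 ?center_sub ?normal_norm ?center_normal //.
  apply: contra (extraspecial_nonabelian esX) => sXZ.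
  exact: abelianS sXZ (center_abelian X).
have nZ := normal_norm (center_normal X).
have sPhiZ : 'Phi(X)%g \subset 'Z(X)%g by rewrite (Phi_min pX nZ).
have sDPhi : (X^`(1))%g \subset 'Phi(X)%g.
  by rewrite (Phi_joing pX) joing_subl.
have ntD : (X^`(1))%g != 1%g.
  apply: contra ntQ => /eqP D1; have cXX : abelian X.
    by rewrite /abelian (sameP commG1P eqP) -derg1 D1.
  by rewrite -subG1 quotient_sub1 // finset.subsetI fintype.subxx.
have ZD : (X^`(1))%g = 'Z(X)%g.
  apply/eqP; rewrite finset.eqEsubset (fintype.subset_trans sDPhi sPhiZ) /=.
  apply: contraR ntD => nsZD; apply/eqP.
  rewrite -(finset.setIidPr (fintype.subset_trans sDPhi sPhiZ)).
  by apply: prime_TIg nsZD; rewrite oZ.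
split; last by rewrite oZ.
split=> //; apply/eqP; rewrite finset.eqEsubset sPhiZ /=.
by rewrite -ZD.
Qed.

(* Extraspecial groups are noncyclic, so every Delta_A2 R p X with X in
   extraspecial_family p P has a point when p is odd and P is a p-group. *)
Lemma Delta_A2_inhabited (R : realType) (gT : finGroupType) (p : nat)
    (Q : {group gT}) :
  odd p -> (p.-group Q)%g -> ~~ cyclic Q -> inhabited (Delta_A2 R p Q).
Proof.
move=> p_odd pQ ncQ.
have oddQ : odd #|Q|.
  have [n ->] : exists n, #|Q| = (p ^ n)%N by exists (logn p #|Q|); exact: card_pgroup.
  by rewrite oddX p_odd orbT.
rewrite (odd_pgroup_rank1_cyclic pQ oddQ) -ltnNge in ncQ.
have /p_rank_geP[E /pnElemPcard[sEQ abE oE]] := ncQ.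
pose w : {ptws {group gT} -> R} := fun F => (F == E)%:R.
suff Kw : w \in geometric_realization R (order_complex
    (fun E F : {group gT} => E \subset F) (elem_abelian_ge2 p Q)).
  by constructor; exact: (SigSub Kw).
apply/mem_set; split=> [v||]; first exact: ler0n.
  by rewrite (bigD1 E) //= big1 => [|i /negbTE]; rewrite /w ?eqxx ?addr0 // => ->.
have -> : ([set v | w v != 0]%SET = [set E]%SET).
  by apply/setP => F; rewrite !finset.inE /w pnatr_eq0; case: (F == E).
rewrite !finset.inE; apply/and3P; split.
- by rewrite finset.sub1set !finset.inE sEQ abE oE /=.
- by apply/set0Pn; exists E; rewrite finset.inE.
apply/forall_inP => x /set1P ->; apply/forall_inP => y /set1P ->.
by rewrite fintype.subxx.
Qed.

(* Main.v *)
(* Both sides are homotopy equivalent to wedges of spheres, and these have the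
   same number of spheres in each dimension.

   Fix Z of order p in Z(P) and a normal elementary abelian E > Z of order p^2.
   Replacing G by GZ, one may work with the poset of the elementary abelian
   subgroups G > Z.  Let F run over its members of order p^2 that do not
   centralize E.  The members other than these F form a contractible poset (move
   G to the intersection of G with C(E), and then to GE), no chain contains two
   of the F, and the link of F is isomorphic to the same complex for C_P(EF) via
   H |-> FH.  By induction the complex collapses to a point after the removal of
   facets that are counted recursively.  For n > 0 let E_n(P) be the set of the X
   in E(P) of order p^(2n+1), and let E_0(P) be {Z} if Z contains all elements of
   order p of P, and empty otherwise.  For n > 0 every X in E_n(P) contains E, and
   X |-> C_X(EF) sets up a double count giving
   p^(2n+1) |E_(n+1)(P)| = sum over F of |E_n(C_P(EF))|.  Hence p^(n^2) |E_n(P)|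
   facets with n vertices are removed.  For P = X in E_n(P), this number is
   p^(n^2), for that n only.

   For X in E(P), the subgroup E can be chosen inside GZ, where G is a vertex of
   the face that carries the base point; then no removed facet contains G, and
   the removed facets of the various X survive in the wedge. *)

Require Import Defs.
From mathcomp Require Import all_boot all_order all_algebra all_fingroup all_solvable.

Set Implicit Arguments.
Unset Strict Implicit.
Unset Printing Implicit Defensive.

(** * Collapses and flag complexes *)

(** Equal numbers of spheres must be turned into a homotopy equivalence. Let [C] be the removed
    facets of a complex [K]. Contracting the rest inside [K] would need a quotient; instead a cone
    with a new apex is put over [K :\: C]. The collapse of [K :\: C], joined with the apex, takes
    this cone away again, so the homotopy type is unchanged. On the coned complex there is an
    explicit flow: each cell of [C] is dilated about its barycenter, and the mass that leaves it
    runs to the apex. Its end depends only on the numbers of vertices of the cells, so it compares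
    any two such complexes through one model. The base points of the wedge are arbitrary points, not
    vertices. If a base point lies inside the face [s], the new base vertex is joined to the whole
    closed star of [s], which is a cone over any vertex of [s] and so does not disturb the collapse,
    provided that no removed facet lies in the star. That [p] is odd enters through the existence of
    the normal subgroup [E] and through the exponent of [EF]. *)

Section Collapse.
Variable V : finType.
Implicit Types (K L M N F : {set {set V}}) (a b c : {set V}) (x y : V).

(** The families need not be closed under subsets, and the free face [a] may be empty: the last
    vertex is then removed together with the empty face. For a nonempty complex, [collapses K set0]
    thus means collapsibility to a point. *)
Inductive collapses : {set {set V}} -> {set {set V}} -> Prop :=
| collapses_refl K : collapses K K
| collapses_step K L a x : a \in K -> x \notin a -> x |: a \in K ->
    (forall b, b \in K -> a \subset b -> b = a \/ b = x |: a) ->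
    collapses (K :\ a :\ (x |: a)) L -> collapses K L.

Definition down_closed K := forall a b, a \in K -> b \subset a -> b \in K.

Lemma collapses_trans K L M : collapses K L -> collapses L M -> collapses K M.
Proof.
move=> KL; elim: KL => // K1 L1 a x Ka xa Kxa fr _ IH /IH; exact: collapses_step fr.
Qed.

Lemma collapses_sub K L : collapses K L -> L \subset K.
Proof.
elim=> // K1 L1 a x _ _ _ _ _ /subset_trans; apply.
by rewrite (subset_trans (subsetDl _ _)) // subsetDl.
Qed.

(** The faces of [F] without [x] are paired with those containing [x]. A largest [a] without [x] is
    free: a face above it lies in [F], and deleting [x] from it gives [a] back by maximality. *)
Lemma toggle_collapses K F x :
    F \subset K -> (forall a, a \in F -> x |: a \in F /\ a :\ x \in F) ->
    (forall a b, a \in F -> b \in K -> a \subset b -> b \in F) ->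
  collapses K (K :\: F).
Proof.
have [n] := ubnP #|F|; elim: n K F => // n IHn K F leFn sFK tgl up.
have [->|[a0 Fa0]] := set_0Vmem F; first by rewrite setD0; exact: collapses_refl.
have [Fa1 xa1] : a0 :\ x \in F /\ x \notin a0 :\ x.
  by rewrite !inE eqxx; have [] := tgl _ Fa0.
pose p a := (a \in F) && (x \notin a).
have pa1 : p (a0 :\ x) by rewrite /p Fa1.
case: (arg_maxnP (fun a => #|a|) pa1) => a /andP[Fa xa] maxa.
have Fxa : x |: a \in F by have [] := tgl _ Fa.
have neq : x |: a != a by apply: contraNneq xa => <-; rewrite setU11.
apply: (collapses_step (subsetP sFK _ Fa) xa (subsetP sFK _ Fxa)).
  move=> b Kb sab; have Fb := up _ _ Fa Kb sab.
  have [xb|xb] := boolP (x \in b); last first.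
    left; apply/esym/eqP; rewrite eqEcard sab /=; apply: maxa.
    by rewrite /p Fb.
  right; suff <- : b :\ x = a by rewrite setD1K.
  apply/esym/eqP; rewrite eqEcard subsetD1 sab xa /=; apply: maxa.
  by rewrite /p !inE eqxx andbT; have [] := tgl _ Fb.
have -> : K :\: F = (K :\ a :\ (x |: a)) :\: (F :\ a :\ (x |: a)).
  apply/setP=> b; rewrite !inE; case: eqVneq => [->|_] /=; first by rewrite Fxa.
  by case: eqVneq => [->|_]; rewrite /= ?Fa.
apply: IHn.
- move: leFn; rewrite (cardsD1 a F) Fa (cardsD1 (x |: a) (F :\ a)) !inE Fxa neq /=.
  by move=> h; rewrite -ltnS (ltn_trans _ h).
- by apply/setDSS => //; apply: setDSS.
- move=> b; rewrite !inE => /and3P[b1 b2 Fb]; have [Fxb Fbx] := tgl _ Fb.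
  rewrite Fxb Fbx !andbT; split; apply/andP; split.
  + apply: contra b1 => /eqP e; case: (boolP (x \in b)) => xb.
      by rewrite -e (setUidPr _) ?sub1set.
    by case/negP: b2; rewrite -(setU1K xb) e setU1K.
  + by apply: contraNneq xa => <-; rewrite setU11.
  + by apply/eqP => e; move: (setU11 x a); rewrite -e !inE eqxx.
  + apply/eqP => e; case: (boolP (x \in b)) => xb.
      by case/negP: b1; rewrite -e setD1K.
    by case/negP: b2; rewrite -e; apply/eqP/setP => y; rewrite !inE; case: eqVneq => // ->; rewrite (negbTE xb).
- move=> b d; rewrite !inE => /and3P[b1 b2 Fb] /and3P[-> -> Kd] sbd.
  exact: up Fb Kd sbd.
Qed.

End Collapse.

(** Above the image of a removed face, [G] contains only images of faces of [N], so free faces stay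
    free. This moves collapses into stars, cones, links and summands of a wedge. *)
Lemma collapses_transport (V W : finType) (f : V -> W) (s : {set W})
    (Q : {set V}) (N M : {set {set V}}) (G : {set {set W}}) :
    {in Q &, injective f} -> (forall x, x \in Q -> f x \notin s) ->
    (forall a, a \in N -> a \subset Q) -> collapses N M ->
    (forall a, a \in N -> a \notin M -> s :|: f @: a \in G) ->
    (forall a b, a \in N -> a \notin M -> b \in G -> s :|: f @: a \subset b ->
       exists2 a', a' \in N & b = s :|: f @: a') ->
  collapses G (G :\: [set s :|: f @: (a : {set V}) | a in N :\: M]).
Proof.
move=> f_inj fs; pose phi (a : {set V}) := s :|: f @: a; rewrite -/phi.
have phiS (a b : {set V}) : a \subset Q -> b \subset Q -> phi a \subset phi b -> a \subset b.
  move=> aQ bQ /subsetP sab; apply/subsetP => y ya; have Qy := subsetP aQ y ya.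
  have: f y \in phi a by rewrite !inE imset_f ?orbT.
  move/sab; rewrite !inE (negbTE (fs y Qy)) => /imsetP[z zb fyz].
  by rewrite (f_inj _ _ Qy (subsetP bQ z zb) fyz).
move=> + NM; elim: NM G => [N0|N0 M0 a x Na xa Nxa fr NM IH] G NQ inG upG.
  rewrite setDv imset0 setD0; exact: collapses_refl.
set N1 := N0 :\ a :\ (x |: a) in NM IH.
have sN1 : N1 \subset N0 by rewrite (subset_trans (subsetDl _ _)) // subsetDl.
have sMN1 := collapses_sub NM.
have Ma : a \notin M0.
  by apply/negP => /(subsetP sMN1); rewrite !inE eqxx andbF.
have Mxa : x |: a \notin M0 by apply/negP => /(subsetP sMN1); rewrite !inE eqxx.
have phi_inj (b d : {set V}) : b \in N0 -> d \in N0 -> phi b = phi d -> b = d.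
  move=> /NQ bQ /NQ dQ e; apply/eqP.
  by rewrite eqEsubset; apply/andP; split; apply: phiS; rewrite // e.
have Qx : x \in Q by apply: (subsetP (NQ _ Nxa)); rewrite setU11.
have phixa : phi (x |: a) = f x |: phi a by rewrite /phi imsetU1 setUCA.
have fxa : f x \notin phi a.
  rewrite !inE negb_or fs //=; apply: contra xa => /imsetP[z za e].
  by rewrite (f_inj _ _ Qx _ e) ?(subsetP (NQ _ Na)).
apply: (collapses_step (inG _ Na Ma) fxa).
- by rewrite -phixa; apply: inG.
- move=> b Gb sab; have [a' Na' eb] := upG _ _ Na Ma Gb sab.
  have /(fr _ Na') : a \subset a' by apply: phiS; rewrite ?NQ // -[phi a']eb.
  by rewrite -phixa eb; case=> ->; [left|right].
rewrite -phixa.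
have -> : G :\: [set phi a0 | a0 in N0 :\: M0]
   = (G :\ phi a :\ phi (x |: a)) :\: [set phi a0 | a0 in N1 :\: M0].
  apply/setP => b; rewrite !inE.
  have [Gb|] := boolP (b \in G); rewrite ?andbF // !andbT.
  apply/idP/idP => [nb|/and3P[nb b2 b1]].
    apply/and3P; split; first by apply: contra nb; apply/subsetP/imsetS/setSD.
    - by apply: contraNneq nb => ->; rewrite imset_f // inE Mxa.
    - by apply: contraNneq nb => ->; rewrite imset_f // inE Ma.
  apply: contra nb => /imsetP[d /setDP[Nd Md] e]; rewrite {}e in Gb b1 b2 *.
  rewrite imset_f // !inE Md Nd andbT /=.
  by apply/andP; split; [apply: contraNneq b2|apply: contraNneq b1] => ->.
apply: IH => [d|d|d b] N1d; have N0d := subsetP sN1 _ N1d.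
- exact: NQ.
- move=> Md; rewrite !inE inG // andbT.
  by apply/andP; split; apply: contraTneq N1d => /phi_inj -> //; rewrite !inE eqxx ?andbF.
move=> Md; rewrite !inE => /and3P[b2 b1 Gb] sdb.
have [a' Na' eb] := upG _ _ N0d Md Gb sdb; exists a' => //.
rewrite !inE Na' andbT.
by apply/andP; split; [apply: contraNneq b2|apply: contraNneq b1] => <-; rewrite eb.
Qed.

Section Flag.
Variable V : finType.
Implicit Types (N G : {set {set V}}) (a b c Q T : {set V}) (r : rel V).

Lemma collapses_within N M G : collapses N M ->
    (forall a, a \in N -> a \notin M -> a \in G) ->
    (forall a b, a \in N -> a \notin M -> b \in G -> a \subset b -> b \in N) ->
  collapses G (G :\: (N :\: M)).
Proof.
move=> NM sNG up; have e a : set0 :|: [eta id] @: a = a :> {set V}.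
  by rewrite set0U imset_id.
have := @collapses_transport V V [eta id] set0 setT N M G.
rewrite (eq_imset _ e) imset_id; apply=> //.
- by move=> x _; rewrite inE.
- by move=> a Na Ma; rewrite e sNG.
- by move=> a b Na Ma Gb; rewrite e => sab; exists b; [apply: (up a) | rewrite e].
Qed.

Lemma down_closed_step N a x : down_closed N ->
    (forall b, b \in N -> a \subset b -> b = a \/ b = x |: a) ->
  down_closed (N :\ a :\ (x |: a)).
Proof.
move=> dN fr b d; rewrite !inE => /and3P[b2 b1 Nb] sdb; rewrite (dN _ _ Nb sdb) andbT.
have nab : ~~ (a \subset b).
  by apply/negP => /(fr _ Nb)[] /eqP; apply/negP.
apply/andP; split; apply: contraNneq nab => e; last by rewrite -e.
by rewrite (subset_trans _ sdb) // e subsetUr.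
Qed.

(* A collapse to the void family matches the empty face with some vertex; shifting
   the pairing along a path of edges matches it with any prescribed one. *)
Lemma collapses_vertex N v : down_closed N -> collapses N set0 ->
  [set v] \in N -> collapses N [set set0; [set v]].
Proof.
move=> + N0; have [M eM] : exists M : {set {set V}}, M = set0 by exists set0.
rewrite -eM in N0; elim: N0 eM v => [K -> v _|K L a x Ka xa Kxa fr KL IH L0 v dK Kv].
  by rewrite inE.
have dK1 := down_closed_step dK fr; have {}IH := IH L0 _ dK1.
have [a0|[y ya]] := set_0Vmem a.
  rewrite a0 setU0 in Ka Kxa fr *.
  have v0 : [set v] != set0 by apply/set0Pn; exists v; rewrite inE.
  have [|ev] := fr _ Kv (sub0set _); first by move/eqP; rewrite (negbTE v0).
  suff -> : K = [set set0; [set v]] by apply: collapses_refl.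
  apply/setP => b; rewrite ev !inE; apply/idP/orP => [Kb|[] /eqP -> //].
  by have [] := fr _ Kb (sub0set _) => ->; [left|right].
have xy : x != y by apply: contraNneq xa => ->.
have xav : [set v] != x |: a.
  apply: contraNneq xy => e.
  have : x \in [set v] by rewrite e setU11.
  have : y \in [set v] by rewrite e !inE ya orbT.
  by rewrite !inE => /eqP -> /eqP ->.
have [ev|nev] := eqVneq a [set v]; last first.
  by apply: (collapses_step Ka xa Kxa fr); apply: IH; rewrite !inE xav eq_sym nev.
subst a; move: ya xa xy; rewrite inE => /eqP-> /[!inE] xv _.
(* Here the first pair is [{v}], [{x, v}]. The induction hypothesis, applied to [x] in the rest,
   leaves the empty face, [{x}], [{v}] and [{x, v}] once the pair is put back; pairing [{x}] with
   [{x, v}] then spares [{v}]. *)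
pose K1 := K :\ [set v] :\ [set x; v].
have x1 z w : [set z] != [set z; w] :> {set V} -> w != z.
  by apply: contraNneq => ->; rewrite setUid.
have K1x : [set x] \in K1.
  rewrite !inE (dK _ [set x] Kxa) ?subsetUl // andbT; apply/andP; split.
    by apply: contraNneq xv => e; have := set22 x v; rewrite -e inE eq_sym.
  by apply: contraNneq xv => e; have := set11 x; rewrite e inE.
have xvE b : b \in K -> b \notin K1 -> b = [set v] \/ b = [set x; v].
  move=> Kb; rewrite !inE Kb andbT negb_and !negbK => /orP[] /eqP; by [right|left].
apply: (collapses_trans (@collapses_within _ _ K (IH _ K1x) _ _)).
- by move=> a K1a _; move: K1a; rewrite !inE => /and3P[].
- move=> a b K1a Ma Kb sab; apply: contraNT Ma => /(xvE _ Kb) eb.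
  have sax : a \subset [set x; v].
    by case: eb sab => -> // /subset_trans; apply; rewrite subsetUr.
  have va : v \notin a.
    apply/negP => va; have Ka' : a \in K by move: K1a; rewrite !inE => /and3P[].
    have := fr _ Ka'; rewrite sub1set => /(_ va) ea.
    by move: K1a; rewrite !inE; case: ea => ->; rewrite eqxx ?andbF.
  have sax1 : a \subset [set x].
    apply/subsetP => z za; have := subsetP sax z za; rewrite !inE => /orP[//|/eqP zv].
    by rewrite -zv za in va.
  by move: sax1; rewrite subset1 !inE orbC.
have K0 : set0 \in K by apply: dK Kv (sub0set _).
have K10 : set0 \in K1 by apply: dK1 K1x (sub0set _).
have mem b : b \in K :\: (K1 :\: [set set0; [set x]]) =
   [|| b == set0, b == [set x], b == [set v] | b == [set x; v]].
  rewrite inE [b \in _ :\: _]inE negb_and negbK !in_set2.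
  have [->|b0] := eqVneq b set0; first by rewrite K0.
  have [->|bx] /= := eqVneq b [set x].
    by apply: dK Kxa _; rewrite subsetUl.
  apply/idP/idP => [/andP[n1 Kb]|].
    by have [] := xvE _ Kb n1 => ->; rewrite eqxx ?orbT.
  by case/orP => /eqP ->; rewrite ?Kv ?Kxa andbT !inE eqxx ?andbF.
apply: (@collapses_step _ _ _ [set x] v); rewrite ?mem ?eqxx ?orbT //.
- by rewrite inE eq_sym.
- by rewrite [v |: _]setUC eqxx !orbT.
- move=> b; rewrite mem => /or4P[] /eqP ->.
  + by rewrite sub1set inE.
  + by left.
  + by rewrite sub1set inE (negbTE xv).
  + by right; rewrite setUC.
rewrite [v |: _]setUC.
suff -> : K :\: (K1 :\: [set set0; [set x]]) :\ [set x] :\ [set x; v]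
    = [set set0; [set v]] by apply: collapses_refl.
apply/setP => b; rewrite 2!in_setD1 mem in_set2.
have v0 : [set v] != set0 by apply/set0Pn; exists v; rewrite inE.
have x0 : [set x] != set0 by apply/set0Pn; exists x; rewrite inE.
have xv0 : [set x; v] != set0 by apply/set0Pn; exists x; rewrite !inE eqxx.
have vx : [set v] != [set x] by rewrite (inj_eq set1_inj) eq_sym.
have [->|_ /=] := eqVneq b [set x; v].
  by rewrite (negbTE xv0) [_ == [set v]]eq_sym (negbTE xav).
have [->|_ /=] := eqVneq b [set x]; last by rewrite orbF.
by rewrite (negbTE x0) [_ == [set v]]eq_sym (negbTE vx).
Qed.

Definition flag r Q : {set {set V}} :=
  [set c : {set V} | (c \subset Q) && [forall x in c, forall y in c, r x y]].

Lemma flagP r Q c : reflect (c \subset Q /\ {in c &, forall x y, r x y}) (c \in flag r Q).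
Proof.
rewrite inE; apply: (iffP andP) => -[cQ h]; split=> //.
  by move=> x y cx cy; have /forall_inP/(_ x cx)/forall_inP/(_ y cy) := h.
by apply/forall_inP => x cx; apply/forall_inP => y cy; apply: h.
Qed.

Lemma flag_down_closed r Q : down_closed (flag r Q).
Proof.
move=> a b /flagP[aQ ra] ba; apply/flagP; split; first exact: subset_trans aQ.
by move=> x y /(subsetP ba) ax /(subsetP ba); apply: ra.
Qed.

Lemma flag0 r Q : set0 \in flag r Q.
Proof. by apply/flagP; split; [exact: sub0set | move=> x; rewrite inE]. Qed.

Lemma flagU1 r Q x c : symmetric r -> r x x -> x \in Q -> c \in flag r Q ->
  {in c, forall y, r x y} -> x |: c \in flag r Q.
Proof.
move=> rC rxx Qx /flagP[cQ rc] rxc; apply/flagP; split; first by rewrite subUset sub1set Qx.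
by move=> y z /setU1P[->|cy] /setU1P[->|cz] //; [exact: rxc|rewrite rC; exact: rxc|exact: rc].
Qed.

Lemma flag_cone r Q e : reflexive r -> symmetric r -> e \in Q ->
  {in Q, forall g, r e g} -> collapses (flag r Q) set0.
Proof.
move=> rR rC Qe re; rewrite -(setDv (flag r Q)); apply: (@toggle_collapses _ _ _ e) => // a Ka.
split; last exact: (flag_down_closed Ka (subsetDl _ _)).
have /flagP[aQ _] := Ka; apply: flagU1 => // y /(subsetP aQ); exact: re.
Qed.

(** The link of [g] is a cone with apex [h], so toggling [h] pairs off all faces through [g]. *)
Lemma flag_beat r Q g h : reflexive r -> symmetric r -> h \in Q -> h != g -> r g h ->
  {in Q, forall k, r k g -> r k h} -> collapses (flag r Q) (flag r (Q :\ g)).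
Proof.
move=> rR rC Qh hg rgh rk.
pose F := [set c in flag r Q | g \in (c : {set V})].
have FE c : (c \in F) = (c \in flag r Q) && (g \in c) by rewrite /F in_set.
have -> : flag r (Q :\ g) = flag r Q :\: F.
  apply/setP => c; rewrite in_setD FE negb_and.
  apply/flagP/andP => [[/subsetD1P[cQ gc] rc]|[]].
    by rewrite gc orbT; split=> //; apply/flagP.
  move=> + Kc; rewrite Kc /= => gc; have /flagP[cQ rc] := Kc.
  by split=> //; apply/subsetD1P.
apply: (@toggle_collapses _ _ _ h).
- by apply/subsetP => c; rewrite FE => /andP[].
- move=> a; rewrite !FE => /andP[Ka ga]; have /flagP[aQ ra] := Ka.
  rewrite in_setU in_setD1 ga orbT eq_sym hg !andbT; split.
    by apply: flagU1 => // y ya; rewrite rC; apply: rk; [apply: (subsetP aQ) | apply: ra].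
  exact: flag_down_closed Ka (subsetDl _ _).
- move=> a b; rewrite !FE => /andP[_ ga] Kb sab.
  by rewrite Kb (subsetP sab).
Qed.

(** The points moved by [f] are removed one at a time, by decreasing [m]. When [g] is reached, every
    remaining point is fixed by [f] or has value at most [m g], and [flag_beat] applies with
    [f g]. *)
Lemma flag_retract r Q (f : V -> V) (m : V -> nat) :
    reflexive r -> symmetric r -> {in Q, forall g, f g \in Q} ->
    {in Q, forall g, f (f g) = f g} -> {in Q, forall g, r g (f g)} ->
    {in Q &, forall g h, f g != g -> r h g -> f h = h \/ m h <= m g -> r h (f g)} ->
  collapses (flag r Q) (flag r [set g in Q | f g == g]).
Proof.
move=> rR rC; have [n] := ubnP #|[set g in Q | f g != g]|.
elim: n Q => // n IHn Q leQn fQ ff rf rff.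
have [Q0|[g0 Q0]] := set_0Vmem [set g in Q | f g != g].
  suff -> : [set g in Q | f g == g] = Q by apply: collapses_refl.
  apply/setP => g; rewrite inE; have [Qg|//] := boolP (g \in Q).
  by apply: contraTT isT => /= fg; have := in_set0 g; rewrite -Q0 inE Qg fg.
pose p g := (g \in Q) && (f g != g).
have pg0 : p g0 by move: Q0; rewrite inE.
case: (arg_maxnP m pg0) => g /andP[Qg fg] maxg.
apply: (collapses_trans (@flag_beat r Q g (f g) rR rC (fQ g Qg) fg (rf g Qg) _)).
  move=> h Qh rhg; apply: rff => //.
  by have [|/negbTE nfh] := boolP (f h == h); [left; apply/eqP | right; apply: maxg; rewrite /p Qh nfh].
have nf h : h \in Q -> f h != g by move=> Qh; apply: contraNneq fg => <-; rewrite ff.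
have -> : [set h in Q | f h == h] = [set h in Q :\ g | f h == h].
  by apply/setP => h; rewrite !inE; have [->|//] := eqVneq h g; rewrite (negbTE fg) andbF.
apply: IHn.
- move: leQn; rewrite (cardsD1 g) inE Qg fg add1n ltnS; apply: leq_ltn_trans.
  by apply/subset_leq_card/subsetP => h; rewrite !inE => /andP[/andP[-> ->] ->].
- by move=> h; rewrite !inE => /andP[_ Qh]; rewrite nf ?fQ.
- by move=> h; rewrite !inE => /andP[_ Qh]; apply: ff.
- by move=> h; rewrite !inE => /andP[_ Qh]; apply: rf.
- by move=> h k; rewrite !inE => /andP[_ Qh] /andP[_ Qk]; apply: rff.
Qed.

(** A collapse of the link of [t] to the void family, joined with [t], deletes all faces through
    [t]. No face has two vertices in [T], so the links of the other vertices are unaffected. *)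
Lemma collapses_stars G T :
    (forall c x y, c \in G -> x \in T -> y \in T -> x \in c -> y \in c -> x = y) ->
    (forall t, t \in T -> collapses [set a : {set V} | (t \notin a) && (t |: a \in G)] set0) ->
  collapses G [set c in G | [disjoint (c : {set V}) & T]].
Proof.
have [n] := ubnP #|T|; elim: n T G => // n IHn T G leTn anti lk.
have [->|[t Tt]] := set_0Vmem T.
  suff -> : [set c in G | [disjoint (c : {set V}) & (set0 : {set V})]] = G by apply: collapses_refl.
  by apply/setP => c; rewrite inE -setI_eq0 setI0 eqxx andbT.
have := lk t Tt; set L := [set a : {set V} | (t \notin a) && (t |: a \in G)] => Lt.
have G1E : G :\: [set [set t] :|: [eta id] @: (a : {set V}) | a in L :\: set0] = [set c in G | t \notin (c : {set V})].
  apply/setP => c; rewrite setD0 in_setD [RHS]in_set andbC.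
  have [Gc|//] := boolP (c \in G); congr (~~ _).
  apply/imsetP/idP => [[a _ ->]|tc]; first by rewrite !inE eqxx.
  by exists (c :\ t); rewrite ?imset_id ?setD1K // !inE eqxx setD1K.
have := @collapses_transport V V [eta id] [set t] (~: [set t]) L set0 G.
rewrite G1E; move/(_ _ _ _ Lt) => cG.
apply: (collapses_trans (cG _ _ _ _ _)).
- by [].
- by move=> x; rewrite !inE.
- by move=> a; rewrite inE => /andP[ta _]; rewrite subsetC sub1set inE.
- by move=> a; rewrite inE => /andP[_ ?] _; rewrite imset_id.
- move=> a b La _ Gb; rewrite imset_id => sab.
  have tb : t \in b by apply: (subsetP sab); rewrite !inE eqxx.
  by exists (b :\ t); rewrite ?imset_id ?setD1K // !inE eqxx setD1K.
have -> : [set c in G | [disjoint (c : {set V}) & T]]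
        = [set c in [set c in G | t \notin (c : {set V})] | [disjoint c & T :\ t]].
  apply/setP => c; rewrite !inE -andbA; congr (_ && _).
  by rewrite -{1}(setD1K Tt) -setI_eq0 setIUr setU_eq0 !setI_eq0 disjoint_sym disjoints1.
apply: IHn.
- by move: leTn; rewrite (cardsD1 t) Tt.
- move=> c x y; rewrite !inE => /andP[Gc _] /andP[_ Tx] /andP[_ Ty]; exact: anti.
- move=> u; rewrite !inE => /andP[ut Tu].
  suff -> : [set a : {set V} | (u \notin a) && (u |: a \in [set c in G | t \notin (c : {set V})])]
      = [set a : {set V} | (u \notin a) && (u |: a \in G)] by apply: lk.
  apply/setP => a; rewrite !inE; case ua: (u \in a) => //=.
  apply/andb_idr => Gua; rewrite negb_or eq_sym ut; apply: contra ut => ta.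
  by apply/eqP/(anti _ _ _ Gua); rewrite ?inE ?eqxx ?ta ?orbT.
Qed.
End Flag.

(** * Extraspecial subgroups *)

Section ExtraspecialSubgroups.
Local Open Scope group_scope.
Variables (gT : finGroupType) (p : nat).
Hypotheses (p_pr : prime p) (p_odd : odd p).
Implicit Types A B P X Y Z E F D G H : {group gT}.

(** Stated without [extraspecial] in order to include [n = 0], where [X = Z] and the last condition
    becomes ['Ohm_1(P) = Z]. *)
Definition es_family P Z n : {set {group gT}} :=
  [set X : {group gT} | [&& X \subset P, 'Z(X) == Z, X^`(1) \subset Z,
     exponent X %| p, #|X| == (p ^ n.*2.+1)%N & 'Ohm_1('C_P(X)) == Z]].

Definition elab_over P Z : {set {group gT}} := [set G in 'E_p(P) | Z \proper G].

Definition crossing P Z E : {set {group gT}} :=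
  [set F in elab_over P Z | (#|F| == p ^ 2)%N & ~~ (F \subset 'C(E))].

Lemma es_familyP P Z n X :
  reflect [/\ X \subset P, 'Z(X) = Z, X^`(1) \subset Z, exponent X %| p &
            #|X| = (p ^ n.*2.+1)%N /\ 'Ohm_1('C_P(X)) = Z] (X \in es_family P Z n).
Proof.
rewrite inE; apply: (iffP and5P) => [[-> /eqP-> -> -> /andP[/eqP-> /eqP->]] //|].
by case=> -> -> -> -> [-> ->]; rewrite !eqxx.
Qed.

Lemma mem_Ohm1 G x : p.-group G -> x \in G -> x ^+ p = 1 -> x \in 'Ohm_1(G).
Proof. by move=> pG Gx xp; rewrite (OhmE 1 pG) mem_gen // !inE Gx expn1 xp eqxx. Qed.

Lemma abelem_joing A B : p.-abelem A -> p.-abelem B -> B \subset 'C(A) -> p.-abelem (A <*> B).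
Proof. by move=> abA abB cAB; rewrite (cprod_abelem _ (cprodEY cAB)) abA. Qed.

Lemma abelem_sub_Ohm1 G E : p.-group G -> E \subset G -> p.-abelem E -> E \subset 'Ohm_1(G).
Proof. by move=> pG sEG abE; rewrite -(Ohm1_id abE) OhmS. Qed.

Section Fixed.
Variables (P Z : {group gT}).
Hypotheses (pP : p.-group P) (sZ : Z \subset 'Z(P)) (oZ : #|Z| = p).

Let sZP : Z \subset P. Proof. exact: subset_trans sZ (center_sub P). Qed.
Let cZ : Z \subset 'C(P). Proof. exact: subset_trans sZ (subsetIr _ _). Qed.
Let abZ : p.-abelem Z. Proof. by rewrite prime_abelem. Qed.

Lemma elab_overP G :
  reflect [/\ G \subset P, p.-abelem G & Z \proper G] (G \in elab_over P Z).
Proof. by rewrite !inE; apply: (iffP andP) => [[/andP[]]|[-> ->]]. Qed.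

(** As [p] is odd and [P] is not cyclic, some normal abelian subgroup [X] is not cyclic, and
    ['Ohm_1(X)] contains a normal subgroup [E0] of order [p ^ 2]. If [E0] does not contain [Z], an
    element [e] of order [p] in the intersection of [E0] with the center gives the central subgroup
    [Z <*> <[e]>] instead. *)
Lemma exists_normal_elab : 'Ohm_1(P) != Z ->
  exists E : {group gT}, [/\ E <| P, E \in elab_over P Z & #|E| = (p ^ 2)%N].
Proof.
move=> nOZ; have sZO := abelem_sub_Ohm1 pP sZP abZ.
have ncP : ~~ cyclic P.
  apply: contra nOZ => cP.
  have ntP : P :!=: 1 by apply: contraTneq sZP => ->; rewrite subG1 -cardG_gt1 oZ prime_gt1.
  by rewrite eq_sym eqEcard sZO /= (Ohm1_cyclic_pgroup_prime cP pP ntP) oZ.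
have [X nX [aX ncX]] : exists2 X : {group gT}, X <| P & abelian X /\ ~~ cyclic X.
  have [h|] := boolP [exists X : {group gT}, [&& X <| P, abelian X & ~~ cyclic X]].
    by have /existsP[X /and3P[? ? ?]] := h; exists X.
  rewrite negb_exists => /forallP h.
  have hX (X : {group gT}) : X <| P -> abelian X -> cyclic X.
    by move=> nX aX; have := h X; rewrite nX aX /= negbK.
  have [cP|/and3P[/eqP p2 _ _]] := normal_rank1_structure pP hX.
    by rewrite cP in ncP.
  by move: p_odd; rewrite p2.
have sXP := normal_sub nX; have pX := pgroupS sXP pP.
pose W := 'Ohm_1(X)%G; have abW : p.-abelem W by rewrite Ohm1_abelem.
have nW : W <| P by apply: char_normal_trans (Ohm_char 1 X) nX.
have W2 : 1 < logn p #|W|.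
  by rewrite -p_rank_abelian // -rank_pgroup // ltnNge -abelian_rank1_cyclic.
have [E0 [sE0W nE0 oE0]] := normal_pgroup pP nW W2.
have abE0 := abelemS sE0W abW; have p1 := prime_gt1 p_pr.
have [sZE|nsZE] := boolP (Z \subset E0).
  exists E0; split=> //; apply/elab_overP; split=> //; first exact: normal_sub.
  by rewrite properEcard sZE oZ oE0 -{1}(expn1 p) ltn_exp2l.
have ntE0 : E0 :!=: 1 by rewrite -cardG_gt1 oE0 (ltn_exp2l 0).
have ntI := meet_center_nil (pgroup_nil pP) nE0 ntE0.
have pI : p.-group (E0 :&: 'Z(P)) := pgroupS (subset_trans (subsetIl _ _) (normal_sub nE0)) pP.
have [_ dvI _] := pgroup_pdiv pI ntI.
have [e /setIP[E0e Ze] oe] := Cauchy p_pr dvI.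
have cZe : <[e]> \subset 'Z(P) by rewrite cycle_subG.
have cEZ : <[e]> \subset 'C(Z).
  by rewrite centsC (subset_trans cZ) // centS // cycle_subG (subsetP (normal_sub nE0)).
have abe : p.-abelem <[e]> by exact: prime_abelem p_pr oe.
have nZe : ~~ (Z \subset <[e]>).
  by apply: contra nsZE => /subset_trans; apply; rewrite cycle_subG.
have TI : Z :&: <[e]> = 1 by apply: prime_TIg; rewrite ?oZ.
have oE : #|Z <*> <[e]>| = (p ^ 2)%N.
  by rewrite cent_joinEr // TI_cardMg // oZ -orderE oe expnS expn1.
have sE : Z <*> <[e]> \subset 'Z(P) by rewrite join_subG sZ.
exists (Z <*> <[e]>)%G; split=> //; first exact: sub_center_normal.
apply/elab_overP; split; first exact: subset_trans sE (center_sub P).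
  exact: abelem_joing.
by rewrite properEcard joing_subl oZ oE -{1}(expn1 p) ltn_exp2l.
Qed.

Lemma line_eq G H : G \subset P -> #|G| = (p ^ 2)%N -> Z \proper H -> H \subset G -> H :=: G.
Proof.
move=> sGP oG ZH HG; apply/eqP; rewrite eqEcard HG oG /=.
have [m oH] : exists m, #|H| = (p ^ m)%N.
  by exists (logn p #|H|); apply: card_pgroup (pgroupS (subset_trans HG sGP) pP).
move: (proper_card ZH); rewrite oZ oH -{1}(expn1 p) (ltn_exp2l _ _ (prime_gt1 p_pr)) => m1.
by rewrite (leq_exp2l _ _ (prime_gt1 p_pr)).
Qed.

Section Pencil.
Variable E : {group gT}.
Hypotheses (nE : E <| P) (ZE : Z \subset E) (oE : #|E| = (p ^ 2)%N).

Let sEP : E \subset P := normal_sub nE.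

(** [E / Z] has order [p] and is normal in the [p]-group [P / Z], hence central. *)
Lemma pencil_comm : [~: E, P] \subset Z.
Proof.
have nZ : P \subset 'N(Z) by rewrite cents_norm // centsC.
have nZE := subset_trans sEP nZ.
rewrite -quotient_cents2 //.
have oEZ : #|E / Z| = p.
  by rewrite card_quotient // -divgS // oE oZ expnS expn1 mulnK ?prime_gt0.
have ntI := meet_center_nil (pgroup_nil (quotient_pgroup Z pP)) (quotient_normal Z nE).
have /ntI : E / Z != 1 by rewrite -cardG_gt1 oEZ prime_gt1.
apply: contraNT => nc; apply/eqP/prime_TIg; first by rewrite oEZ.
by apply: contra nc => /subset_trans; apply; apply: subsetIr.
Qed.

(** For [e] in [E] outside [Z], an element of [P] that centralizes [e] centralizes [E], and the
    conjugates of [e] lie in the coset of [Z] through [e]; so the index is at most [p]. A subgroup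
    of index [p] is maximal and does not contain [F]. *)
Lemma cent_pencil F : F \subset P -> ~~ (F \subset 'C(E)) ->
  F * 'C_P(E) = P /\ #|P : 'C_P(E)| = p.
Proof.
move=> sFP ncF; have nC : 'C_P(E) <| P.
  exact: normalGI (normal_norm nE) (cent_normal E).
have nsC : ~~ (F \subset 'C_P(E)) by rewrite subsetI sFP.
have [e Ee Ze] : exists2 e, e \in E & e \notin Z.
  by apply/subsetPn/negP => /subset_leq_card; rewrite oE oZ leqNgt -{1}(expn1 p) ltn_exp2l ?prime_gt1.
have Ecc : E \subset 'C('C_P[e]).
  rewrite -(@line_eq E (E :&: 'C('C_P[e]))%G) ?subsetIr ?subsetIl //=.
  apply/properP; split.
    by rewrite subsetI ZE (subset_trans cZ) // centS ?subsetIl.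
  by exists e; rewrite // inE Ee; apply/centP => x /setIP[_ /cent1P].
have leC : #|P : 'C_P(E)| <= p.
  have sCC : 'C_P[e] \subset 'C_P(E) by rewrite subsetI subsetIl centsC.
  apply: leq_trans (dvdn_leq _ (indexgS _ sCC)) _ => //.
  rewrite index_cent1 -oZ -(card_lcoset Z e); apply/subset_leq_card/subsetP => _ /imsetP[x Px ->].
  rewrite mem_lcoset -[_ * _]/[~ e, x]; apply: (subsetP pencil_comm); exact: mem_commg.
have [m oI] : exists m, #|P : 'C_P(E)| = (p ^ m)%N.
  exists (logn p #|P : 'C_P(E)|); rewrite -p_part part_pnat_id //.
  exact: pnat_dvd (dvdn_indexg P 'C_P(E)) pP.
have iC : #|P : 'C_P(E)| = p.
  move: leC; rewrite oI -{2}(expn1 p) (leq_exp2l _ _ (prime_gt1 p_pr)) leq_eqVlt => /orP[/eqP->//|].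
  rewrite ltnS leqn0 => /eqP m0; case/negP: nsC; apply: subset_trans sFP _.
  by rewrite -indexg_eq1 oI m0.
split=> //; have := mulg_normal_maximal nC _ sFP nsC.
rewrite (normC (subset_trans sFP (normal_norm nC))); apply.
by apply: (p_index_maximal (subsetIl _ _)); rewrite iC.
Qed.

End Pencil.

Lemma es_family0 X : X \in es_family P Z 0 -> X :=: Z /\ 'Ohm_1(P) = Z.
Proof.
case/es_familyP=> sXP ZX _ _ [oX OX]; have XZ : X :=: Z.
  by apply/esym/eqP; rewrite eqEcard oX oZ expn1 leqnn -ZX center_sub.
split=> //; rewrite -[RHS]OX XZ; congr 'Ohm_1(_).
by apply/esym/setIidPl; rewrite centsC.
Qed.

Lemma es_extraspecial X n : X \in es_family P Z n.+1 -> extraspecial X.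
Proof.
case/es_familyP=> sXP ZX dX eX [oX _].
apply/(extraspecialE p_pr (pgroupS sXP pP)); rewrite ZX oZ; split=> //.
  rewrite -subG1 quotient_sub1 -ZX ?normal_norm ?center_normal //.
  apply/negP => /subset_leq_card; rewrite oX ZX oZ -{2}(expn1 p).
  by rewrite (leq_exp2l _ _ (prime_gt1 p_pr)).
rewrite abelemE // (dvdn_trans (exponent_quotient _ _)) // andbT.
by rewrite sub_der1_abelian.
Qed.

Section Contains.
Variable E : {group gT}.
Hypotheses (nE : E <| P) (EP : E \in elab_over P Z) (oE : #|E| = (p ^ 2)%N).

Let sEP : E \subset P := normal_sub nE.
Let abE : p.-abelem E. Proof. by case/elab_overP: EP. Qed.
Let ZE : Z \subset E. Proof. by case/elab_overP: EP => _ _ /proper_sub. Qed.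
Let neZ : ~~ (E \subset Z).
Proof. by case/elab_overP: EP => _ _; rewrite properE ZE. Qed.

Lemma es_family0_pencil : es_family P Z 0 = set0.
Proof.
apply/setP => X; rewrite [RHS]inE; apply/negbTE/negP => /es_family0[_ OP].
by case/negP: neZ; rewrite -OP abelem_sub_Ohm1.
Qed.

(* On an extraspecial X, the automorphisms induced by E are trivial on X / Z,
   hence inner. *)
Lemma es_contains_pencil X n : X \in es_family P Z n -> E \subset X.
Proof.
case: n => [|n] Xes; first by rewrite es_family0_pencil inE in Xes.
have esX := es_extraspecial Xes; have [[_ dX] _] := esX.
have /es_familyP[sXP ZX _ eX [oX OX]] := Xes.
have sR : X <*> E \subset P by rewrite join_subG sXP.
have sXE : [~: X, E] \subset Z.
  by rewrite commGC (subset_trans (commgS E sXP)) // pencil_comm.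
have comm : [~: X, X <*> E] \subset X^`(1).
  rewrite commGC dX ZX; have nZR : X <*> E \subset 'N(Z).
    by rewrite cents_norm // centsC (subset_trans cZ) // centS.
  have nZX : X \subset 'N(Z) := subset_trans (joing_subl _ _) nZR.
  have nZE : E \subset 'N(Z) := subset_trans (joing_subr _ _) nZR.
  rewrite -quotient_cents2 // quotientY // join_subG !quotient_cents2 //.
  by rewrite -derg1 dX ZX subxx commGC.
have := critical_extraspecial (pgroupS sR pP) (joing_subl X E) esX comm.
case/cprodP => _ defR _; apply/subsetP => e Ee.
have : e \in X * 'C_(X <*> E)(X) by rewrite defR (subsetP (joing_subr _ _)).
(* Since [x] and [e = x * c] have [p]-th power 1 and [x] commutes with [c], also [c ^+ p = 1]; hence
   [c] lies in ['Ohm_1('C_P(X)) = Z]. *)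
case/mulsgP => x c Xx /setIP[Rc Cc] ec.
rewrite ec groupM //; suff : c \in Z by rewrite -ZX => /(subsetP (center_sub X)).
rewrite -OX; apply: mem_Ohm1; first exact: pgroupS (subsetIl _ _) pP.
  by rewrite inE (subsetP sR).
have ex : commute x c by apply/commute_sym; apply: (centP Cc).
have ce : c = x^-1 * e by rewrite ec mulKg.
have xp : x ^+ p = 1 := exponentP eX x Xx.
have ep : e ^+ p = 1 by have /abelemP[//|_ ->] := abE.
by have := expgMn p ex; rewrite -ec ep xp mul1g.
Qed.

Section Crossing.
Variable F : {group gT}.
Hypothesis FT : F \in crossing P Z E.

Let S := (E <*> F)%G.
Let D := 'C_P(S)%G.
Let FTP : [/\ F \subset P, p.-abelem F, Z \subset F, #|F| = (p ^ 2)%N & ~~ (F \subset 'C(E))].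
Proof.
by move: FT; rewrite inE => /and3P[/elab_overP[-> -> /proper_sub ->] /eqP -> ->].
Qed.

Lemma crossing_cent : F :&: 'C(E) = Z.
Proof.
case: FTP => sFP abF ZF oF nFE; apply/eqP; rewrite eq_sym eqEproper subsetI ZF /=.
rewrite (subset_trans cZ) ?centS //=; apply: contra nFE => h.
by rewrite -(@line_eq F (F :&: 'C(E))%G) ?subsetIr ?subsetIl.
Qed.

Lemma pencil_cent_crossing : E :&: 'C(F) = Z.
Proof.
case: FTP => sFP abF ZF oF; rewrite centsC => nEF.
apply/eqP; rewrite eq_sym eqEproper subsetI ZE /=.
rewrite (subset_trans cZ) ?centS //=; apply: contra nEF => h.
by rewrite -(@line_eq E (E :&: 'C(F))%G) ?subsetIr ?subsetIl.
Qed.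

Let sSP : S \subset P.
Proof. by case: FTP => sFP _ _ _ _; rewrite join_subG sEP. Qed.
Let pS : p.-group S := pgroupS sSP pP.
Let ES : E \subset S := joing_subl E F.
Let FS : F \subset S := joing_subr E F.
Let ZS : Z \subset S := subset_trans ZE ES.

Lemma join_crossing_der : S^`(1) \subset Z.
Proof.
case: FTP => sFP abF ZF oF nFE.
have nZ G : G \subset P -> G \subset 'N(Z).
  by move=> sGP; rewrite cents_norm // centsC (subset_trans cZ) ?centS.
apply: der1_min; rewrite ?nZ // quotientY ?nZ // abelianY.
rewrite !quotient_abelian ?(abelem_abelian abF) ?(abelem_abelian abE) //=.
rewrite centsC quotient_cents2 ?nZ //.
exact: subset_trans (commgS E sFP) (pencil_comm nE ZE oE).
Qed.

(** By Dedekind's law the centralizer of [E] in [EF] is [E] times the intersection of [F] with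
    ['C(E)], that is, [E]. So the center lies in [E], and it centralizes [F]. *)
Lemma join_crossing_center : 'Z(S) = Z.
Proof.
case: FTP => sFP abF ZF oF nFE; apply/eqP; rewrite eqEsubset andbC.
rewrite subsetI ZS (subset_trans cZ) ?centS //=.
have CE : S :&: 'C(E) = E.
  rewrite [X in X :&: _]/= norm_joinEr ?(subset_trans sFP (normal_norm nE)) //.
  rewrite -group_modl -?abelianE ?(abelem_abelian abE) //.
  by rewrite crossing_cent mulGSid.
have sZE : 'Z(S) \subset E by have := setIS S (centS ES); rewrite CE.
by rewrite -pencil_cent_crossing subsetI sZE subIset // centS ?orbT.
Qed.

Lemma join_crossing_card : #|S| = (p ^ 3)%N.
Proof.
case: FTP => sFP abF ZF oF nFE.
have EF : E :&: F = Z.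
  apply/eqP; rewrite eqEsubset [Z \subset _]subsetI ZE ZF andbT.
  rewrite -crossing_cent subsetI subsetIr (subset_trans (subsetIl _ _)) //.
  by rewrite -abelianE (abelem_abelian abE).
have := mul_cardG E F.
rewrite -(norm_joinEr (subset_trans sFP (normal_norm nE))) EF oE oF oZ => h.
by apply/eqP; rewrite -(eqn_pmul2r (prime_gt0 p_pr)) -h -expnD -expnSr.
Qed.

(** For odd [p], a [p]-group of class at most 2 generated by elements of order [p] has exponent
    [p]. *)
Lemma join_crossing_exponent : exponent S %| p.
Proof.
case: FTP => sFP abF ZF oF nFE.
have <- : 'Ohm_1(S) = S.
  apply/eqP; rewrite eqEsubset Ohm_sub join_subG.
  by rewrite !(abelem_sub_Ohm1 pS).
apply: exponent_Ohm1_class2 => //; rewrite nil_class2 join_crossing_center.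
exact: join_crossing_der.
Qed.

Lemma crossing_extraspecial : extraspecial S.
Proof.
apply/(extraspecialE p_pr pS); rewrite join_crossing_center oZ; split=> //.
  rewrite -subG1 quotient_sub1 -join_crossing_center ?normal_norm ?center_normal //.
  apply/negP => /subset_leq_card; rewrite join_crossing_card join_crossing_center oZ.
  by rewrite -{2}(expn1 p) (leq_exp2l _ _ (prime_gt1 p_pr)).
rewrite abelemE // (dvdn_trans (exponent_quotient _ _) join_crossing_exponent) // andbT.
by rewrite sub_der1_abelian // join_crossing_der.
Qed.

Lemma crossing_der : S^`(1) = Z.
Proof. by have [[_ ->] _] := crossing_extraspecial; rewrite join_crossing_center. Qed.

(** The inverse is [X |-> 'C_X(S)]: [S] is extraspecial and [[~: S, X]] lies in its derived subgroup
    [Z], so [X] is the central product of [S] and ['C_X(S)]. The condition on ['Ohm_1] carries over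
    because the centralizer of [S * Y] in [P] is ['C_D(Y)]. *)
Lemma es_crossing_bij n :
  [set X in es_family P Z n.+1 | F \subset X] = [set (S <*> (Y : {group gT}))%G | Y in es_family D Z n].
Proof.
apply/setP => X; apply/setIdP/imsetP => [[Xes FX]|[Y Yes ->]].
  have EX := es_contains_pencil Xes.
  have /es_familyP[sXP ZX dX eX [oX OX]] := Xes.
  have SX : S \subset X by rewrite join_subG EX.
  have := critical_extraspecial (pgroupS sXP pP) SX crossing_extraspecial.
  rewrite crossing_der => /(_ (subset_trans (commSg X SX) dX)) /cprodP[_ defX cSY].
  pose Y := ('C_X(S))%G; exists Y; last first.
    by apply: val_inj; rewrite -[LHS]defX -(cent_joinEr cSY).
  have YX : Y \subset X := subsetIl _ _.
  have SY : S :&: Y = Z by rewrite [X in _ :&: X]/= setIA (setIidPl SX) -/('Z(S)) join_crossing_center.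
  have ZsY : Z \subset Y by rewrite -SY subsetIr.
  apply/es_familyP; split.
  - exact: setSI.
  - apply/eqP; rewrite eqEsubset [Z \subset _]subsetI ZsY.
    rewrite (subset_trans cZ) ?centS ?(subset_trans YX) // andbT -ZX.
    rewrite subsetI (subset_trans (subsetIl _ _) YX) -defX centM.
    by rewrite subsetI subsetIr andbT subIset // subsetIr.
  - exact: subset_trans (dergS 1 YX) dX.
  - exact: dvdn_trans (exponentS YX) eX.
  - split; last first.
      have <- : 'C_P(S * Y) = 'C_D(Y) by rewrite centM setIA.
      by rewrite [S * Y]defX.
    have := mul_cardG S Y; rewrite defX SY oX oZ join_crossing_card => h.
    have p3 : 0 < p ^ 3 by rewrite expn_gt0 prime_gt0.
    apply/eqP; rewrite -(eqn_pmul2l p3) h -expnSr -expnD; apply/eqP; congr (_ ^ _)%N.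
have /es_familyP[sYD ZY dY eY [oY OY]] := Yes.
have cSY : Y \subset 'C(S) := subset_trans sYD (subsetIr _ _).
have YP : Y \subset P := subset_trans sYD (subsetIl _ _).
have ZsY : Z \subset Y by rewrite -ZY center_sub.
have defX : S \* Y = S <*> Y := cprodEY cSY.
have SY : S :&: Y = Z.
  apply/eqP; rewrite eqEsubset subsetI ZS ZsY !andbT -join_crossing_center.
  by rewrite setIS.
split; last exact: subset_trans FS (joing_subl _ _).
apply/es_familyP; split.
- by rewrite join_subG sSP.
- by rewrite -(center_cprod defX) /= join_crossing_center ZY cprodE ?mulGid // -abelianE (abelem_abelian abZ).
- have /cprodP[_ <- _] := der_cprod 1 defX.
  by apply: mul_subG dY; apply: join_crossing_der.
- apply/exponentP => x; rewrite -[x \in _]/(x \in S <*> Y) (cent_joinEr cSY) => /mulsgP[s y Ss Yy ->].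
  have csy : commute s y by apply/commute_sym; apply: (centP (subsetP cSY y Yy)).
  by rewrite expgMn // (exponentP join_crossing_exponent) // (exponentP eY) // mulg1.
split.
  have := mul_cardG S Y; rewrite -(cent_joinEr cSY) SY oZ oY join_crossing_card => h.
  apply/eqP; rewrite -(eqn_pmul2r (prime_gt0 p_pr)) -h -expnD -expnSr.
  by rewrite doubleS.
by rewrite /= centY setIA.
Qed.

Lemma card_es_crossing n :
  #|[set X in es_family P Z n.+1 | F \subset X]| = #|es_family D Z n|.
Proof.
rewrite es_crossing_bij; apply: card_in_imset => Y1 Y2.
suff cX Y : Y \in es_family D Z n -> (S <*> Y) :&: 'C(S) = Y.
  by move=> /cX e1 /cX e2 [eY]; apply: val_inj; rewrite /= -e1 -e2 eY.
case/es_familyP=> sYD ZY _ _ _; have cSY := subset_trans sYD (subsetIr _ _).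
rewrite cent_joinEr // setIC -group_modr // setIC -/('Z(S)) join_crossing_center.
by rewrite mulSGid // -ZY center_sub.
Qed.

End Crossing.

(** Each [F] is [Z <*> <[x]>] for the [p ^ 2 - p] elements [x] of [F] outside [Z], and these do not
    centralize [E]. The centralizer of [E] has index [p] in [X], of order [p ^ (2n+3)], so
    [p ^ (2n+2) * (p - 1)] elements [x] are shared out. *)
Lemma card_crossing_in X n : X \in es_family P Z n.+1 ->
  #|[set F in crossing P Z E | F \subset X]| = (p ^ n.*2.+1)%N.
Proof.
move=> Xes; have EX := es_contains_pencil Xes.
have /es_familyP[sXP ZX dX eX [oX OX]] := Xes.
have nXE : ~~ (X \subset 'C(E)).
  apply: contra neZ => cXE; rewrite -ZX subsetI EX centsC.
  exact: cXE.
have [defP iC] := cent_pencil nE ZE oE sXP nXE.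
have oC : #|X :\: 'C(E)| = (p ^ n.*2.+2 * (p - 1))%N.
  have := mul_cardG X 'C_P(E); rewrite defP setIA (setIidPl sXP).
  rewrite -(Lagrange (subsetIl P 'C(E))) iC oX mulnC -mulnA => /eqP.
  rewrite eqn_pmul2l ?cardG_gt0 // => /eqP oXp.
  have oXC : #|X :&: 'C(E)| = (p ^ n.*2.+2)%N.
    apply/eqP; rewrite -(eqn_pmul2l (prime_gt0 p_pr)) -oXp -expnS; apply/eqP; congr (_ ^ _)%N.
  by rewrite cardsD oXC oX mulnBr muln1 -expnSr.
pose U := X :\: 'C(E); pose f x := (Z <*> <[x]>)%G.
set T := [set F in _ | _].
have sZX : Z \subset X := subset_trans ZE EX.
have sZCE : Z \subset 'C(E) by rewrite (subset_trans cZ) ?centS.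
have TP F : F \in T -> [/\ F \in crossing P Z E, F \subset X, Z \subset F & #|F| = (p ^ 2)%N].
  rewrite inE => /andP[FT FX]; split=> //; move: FT; rewrite inE => /and3P[].
    by case/elab_overP => _ _ /proper_sub.
  by move=> _ /eqP.
have fU x : x \in U -> f x \in T.
  case/setDP=> Xx nCx; have xp : x ^+ p = 1 := exponentP eX x Xx.
  have nx1 : x != 1 by apply: contraNneq nCx => ->; rewrite group1.
  have ox : #[x] = p.
    by apply: (nt_prime_order p_pr xp).
  have nZx : ~~ (Z \subset <[x]>).
    apply: contra nCx => sZx; rewrite -cycle_subG (subset_trans _ sZCE) //.
    suff <- : Z :=: <[x]> by [].
    by apply/eqP; rewrite eqEcard sZx oZ -orderE ox /=.
  have cZx : <[x]> \subset 'C(Z).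
    by rewrite centsC (subset_trans cZ) // centS // cycle_subG (subsetP sXP).
  have of_ : #|f x| = (p ^ 2)%N.
    rewrite /= cent_joinEr // TI_cardMg; last by apply: prime_TIg; rewrite ?oZ.
    by rewrite oZ -orderE ox expnS expn1.
  have sfX : f x \subset X by rewrite join_subG sZX cycle_subG.
  rewrite inE sfX andbT inE of_ eqxx /=; apply/andP; split.
    apply/elab_overP; split; first exact: subset_trans sfX sXP.
      by apply: abelem_joing => //; apply: prime_abelem.
    by rewrite properEcard joing_subl oZ of_ -{1}(expn1 p) ltn_exp2l ?prime_gt1.
  by apply: contra nCx; rewrite join_subG cycle_subG => /andP[].
have fib F : F \in T -> [set x in U | f x == F] = F :\: Z.
  case/TP=> FT FX ZF oF; apply/setP => x; rewrite [LHS]inE !in_setD.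
  apply/andP/andP => [[/andP[nCx Xx] /eqP <-]|[nZx Fx]].
    split; first by apply: contra nCx; apply: (subsetP sZCE).
    by rewrite (subsetP (joing_subr _ _)) // cycle_id.
  have sfF : f x \subset F by rewrite join_subG ZF cycle_subG.
  rewrite (subsetP FX) // andbT; split.
    by apply: contra nZx => Cx; rewrite -(crossing_cent FT) inE Fx.
  apply/eqP/val_inj/(line_eq (subset_trans FX sXP) oF) => //.
  apply/properP; split; first exact: joing_subl.
  by exists x; rewrite // (subsetP (joing_subr _ _)) // cycle_id.
have : #|U| = (\sum_(F in T) #|F :\: Z|)%N.
  rewrite -sum1_card (partition_big f (mem T)) //=.
  apply: eq_bigr => F TF; rewrite -(fib F TF) sum1dep_card.
  by apply: eq_card => x; rewrite !inE.
rewrite oC (eq_bigr (fun _ => p * (p - 1))%N) => [|F /TP[_ _ ZF oF]]; last first.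
  by rewrite cardsD (setIidPr ZF) oF oZ mulnBr muln1 expnS expn1.
rewrite sum_nat_const mulnA => /eqP.
rewrite eqn_pmul2r ?subn_gt0 ?prime_gt1 // expnSr eqn_pmul2r ?prime_gt0 //.
by move/eqP.
Qed.

(* Count the pairs F \subset X; for a fixed F, X |-> C_X(EF) is a bijection. *)
Lemma card_es_family n :
  (p ^ n.*2.+1 * #|es_family P Z n.+1| =
     \sum_(F in crossing P Z E) #|es_family 'C_P(E <*> F)%G Z n|)%N.
Proof.
transitivity (\sum_(X in es_family P Z n.+1) \sum_(F in crossing P Z E | F \subset X) 1)%N.
  rewrite mulnC -sum_nat_const; apply: eq_bigr => X Xes.
  by rewrite -(card_crossing_in Xes) -sum1_card; apply: eq_bigl => F; rewrite [LHS]in_set.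
rewrite (exchange_big_dep (mem (crossing P Z E))) /=; last by move=> X F _ /andP[].
apply: eq_bigr => F FT; rewrite -(card_es_crossing FT) -sum1_card.
by apply: eq_bigl => X; rewrite [RHS]in_set FT.
Qed.

End Contains.
End Fixed.
End ExtraspecialSubgroups.

(** * Critical flags of elementary abelian subgroups *)

Section Decomposition.
Local Open Scope group_scope.
Variables (gT : finGroupType) (p : nat).
Hypotheses (p_pr : prime p) (p_odd : odd p).
Implicit Types P X Y Z E F D G H : {group gT}.
Implicit Types (C K N : {set {set {group gT}}}) (a b c d : {set {group gT}}).

Definition nested G H := (G \subset H) || (H \subset G).

Lemma nested_refl : reflexive nested. Proof. by move=> G; rewrite /nested subxx. Qed.
Lemma nested_sym : symmetric nested. Proof. by move=> G H; rewrite /nested orbC. Qed.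

Definition elab_flags P Z := flag nested (elab_over p P Z).

(* Up to homotopy, the chains form a wedge of spheres indexed by C.  For
   'Ohm_1(P) = Z, where only the empty chain remains, C consists of it. *)
Definition spherical P Z C :=
  [/\ C \subset elab_flags P Z,
      forall c d, c \in C -> d \in elab_flags P Z -> c \subset d -> d = c,
      collapses (elab_flags P Z :\: C) set0 &
      forall n, #|[set c in C | #|c| == n]| = (p ^ (n ^ 2) * #|es_family p P Z n|)%N].

Section Crossing.
Variables (P Z E : {group gT}).
Hypotheses (pP : p.-group P) (sZ : Z \subset 'Z(P)) (oZ : #|Z| = p).
Hypotheses (nE : E <| P) (EP : E \in elab_over p P Z) (oE : #|E| = (p ^ 2)%N).

Let A := elab_over p P Z.
Let T := crossing p P Z E.
Let sEP : E \subset P := normal_sub nE.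
Let sZP : Z \subset P. Proof. exact: subset_trans sZ (center_sub P). Qed.
Let cZ : Z \subset 'C(P). Proof. exact: subset_trans sZ (subsetIr _ _). Qed.
Let abE : p.-abelem E. Proof. by case/elab_overP: EP. Qed.
Let ZE : Z \subset E. Proof. by case/elab_overP: EP => _ _ /proper_sub. Qed.

Lemma crossing_uniq c F1 F2 : c \in elab_flags P Z -> F1 \in T -> F2 \in T ->
  F1 \in c -> F2 \in c -> F1 = F2.
Proof.
move=> /flagP[_ rc]; rewrite !inE => /and3P[_ /eqP o1 _] /and3P[_ /eqP o2 _] c1 c2.
apply/val_inj/eqP => /=; have /orP[s|s] := rc _ _ c1 c2.
  by rewrite eqEcard s o1 o2 /=.
by rewrite eq_sym eqEcard s o1 o2 /=.
Qed.

(** Intersecting with ['C(E)] stays strictly above [Z]: if [G] does not centralize [E], the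
    intersection has index [p] in [G] by [cent_pencil], so it could equal [Z] only if [G] had order
    [p ^ 2], and then [G] would be crossing. *)
Lemma noncrossing_collapse : collapses (flag nested (A :\: T)) set0.
Proof.
have sAP G : G \in A -> G \subset P by case/elab_overP.
pose f1 G := (G :&: 'C(E))%G; pose B := A :\: T.
have BA G : G \in B -> G \in A by case/setDP.
have inB G : G \in A -> G \subset 'C(E) -> G \in B.
  by move=> AG CG; rewrite in_setD AG inE CG !andbF.
have f1B G : G \in B -> f1 G \in B.
  case/setDP=> AG nTG; have [GP abG ZG] := elab_overP _ _ _ _ AG.
  apply: inB; last exact: subsetIr.
  apply/elab_overP; split; first by rewrite subIset // GP.
    exact: abelemS (subsetIl _ _) abG.
  rewrite properEneq subsetI (proper_sub ZG) (subset_trans cZ) ?centS // !andbT.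
  apply: contra nTG => /eqP Zf; rewrite inE AG /=.
  have nCG : ~~ (G \subset 'C(E)).
    by apply: contraTN ZG => /setIidPl e; rewrite Zf /= e properxx.
  rewrite nCG andbT.
  have [defP iC] := cent_pencil p_pr pP sZ oZ nE ZE oE GP nCG.
  have := mul_cardG G 'C_P(E); rewrite defP setIA (setIidPl GP) -[G :&: 'C(E)]/(gval (f1 G)) -Zf oZ.
  rewrite -(Lagrange (subsetIl P 'C(E))) iC [(#|G| * _)%N]mulnC -mulnA => /eqP.
  by rewrite eqn_pmul2l ?cardG_gt0 // expnS expn1.
have rfl := nested_refl; have rsym := nested_sym.
(* This map shrinks groups, so the smallest moved groups must go first, hence the complementary
   order in [m]; the enlarging map below starts with the largest. *)
apply: collapses_trans (@flag_retract _ nested B f1 (fun G => #|gT| - #|G|) rfl rsym f1B _ _ _) _.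
- by move=> G _; apply: val_inj; rewrite /= -setIA setIid.
- by move=> G _; rewrite /nested subsetIl orbT.
- move=> G H BG BH _ /orP[sHG|sGH] mHG; last first.
    by rewrite /nested (subset_trans _ sGH) ?orbT ?subsetIl.
  case: mHG => [<-|leGH]; first by rewrite /nested setSI.
  suff -> : H = G by rewrite /nested subsetIl orbT.
  apply/val_inj/eqP; rewrite /= eqEcard sHG /=.
  by rewrite leq_sub2lE ?max_card in leGH.
pose B1 := [set G in B | f1 G == G].
have B1P G : reflect (G \in A /\ G \subset 'C(E)) (G \in B1).
  rewrite [G \in B1]in_set; apply: (iffP andP) => [[BG /eqP <-]|[AG CG]].
    by split; [apply/BA/f1B | apply: subsetIr].
  by split; [apply: inB | apply/eqP/val_inj/setIidPl].
have cEE : E \subset 'C(E) by rewrite -abelianE (abelem_abelian abE).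
have f2B G : G \in B1 -> (E <*> G)%G \in B1.
  case/B1P=> AG CG; have [GP abG ZG] := elab_overP _ _ _ _ AG.
  apply/B1P; split; last by rewrite join_subG cEE.
  apply/elab_overP; split; first by rewrite join_subG sEP.
    exact: abelem_joing.
  exact: proper_sub_trans ZG (joing_subr _ _).
apply: collapses_trans (@flag_retract _ nested B1 (fun G => E <*> G)%G (fun G => #|G|) rfl rsym f2B _ _ _) _.
- by move=> G _; apply/val_inj/joing_idPr; apply: joing_subl.
- by move=> G _; rewrite /nested joing_subr.
- move=> G H BG BH _ /orP[sHG|sGH] mHG.
    by rewrite /nested (subset_trans sHG) ?joing_subr.
  case: mHG => [eH|leHG].
    apply/orP; right; rewrite -eH join_subG joing_subl.
    exact: subset_trans sGH (joing_subr _ _).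
  suff -> : H = G by rewrite /nested joing_subr.
  by apply/val_inj/eqP; rewrite /= eq_sym eqEcard sGH.
apply: (@flag_cone _ nested _ E) => //.
  rewrite in_set; apply/andP; split; last by apply/eqP/val_inj/joing_idPr.
  by apply/B1P.
by move=> G; rewrite in_set => /andP[_ /eqP <-]; rewrite /nested joing_subl.
Qed.

Section Link.
Variable F : {group gT}.
Hypothesis FT : F \in T.
Let D := 'C_P(E <*> F)%G.
Let ext H := (F <*> H)%G.

Let FTP : [/\ F \subset P, p.-abelem F, Z \subset F, #|F| = (p ^ 2)%N & ~~ (F \subset 'C(E))].
Proof.
by move: FT; rewrite inE => /and3P[/elab_overP[-> -> /proper_sub ->] /eqP -> ->].
Qed.

Lemma cap_crossing_cent : F :&: D = Z.
Proof.
case: FTP => sFP abF ZF oF nFE; rewrite /= centY setIA (setIidPl sFP).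
rewrite setIA (crossing_cent p_pr pP sZ oZ nE FT).
by apply/setIidPl; rewrite (subset_trans cZ) ?centS.
Qed.

Lemma ext_cap H : H \in elab_over p D Z -> ext H :&: D = H.
Proof.
case/elab_overP=> sHD abH ZH; have [sFP abF ZF oF nFE] := FTP.
have cFH : H \subset 'C(F).
  by rewrite (subset_trans sHD) //= subIset // centS ?joing_subr ?orbT.
by rewrite /= cent_joinEr // setIC -group_modr // setIC cap_crossing_cent mulSGid // proper_sub.
Qed.

Lemma ext_elab H : H \in elab_over p D Z -> ext H \in A.
Proof.
case/elab_overP=> sHD abH ZH; have [sFP abF ZF oF nFE] := FTP.
apply/elab_overP; split.
- by rewrite join_subG sFP (subset_trans sHD) ?subsetIl.
- apply: abelem_joing => //.
  by rewrite (subset_trans sHD) //= subIset // centS ?joing_subr ?orbT.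
- exact: proper_sub_trans ZH (joing_subr _ _).
Qed.

Lemma ext_neq H : H \in elab_over p D Z -> ext H != F.
Proof.
move=> DH; have /elab_overP[_ _ ZH] := DH; apply: contraTneq ZH => eF.
by rewrite -(ext_cap DH) eF cap_crossing_cent properxx.
Qed.

Lemma ext_inj : {in elab_over p D Z &, injective ext}.
Proof.
move=> H1 H2 D1 D2 e; apply: val_inj; rewrite /= -(ext_cap D1) e; exact: ext_cap.
Qed.

Lemma ext_nested : {in elab_over p D Z &, forall H1 H2, nested (ext H1) (ext H2) = nested H1 H2}.
Proof.
have s H1 H2 : H1 \in elab_over p D Z -> H2 \in elab_over p D Z ->
  (ext H1 \subset ext H2) = (H1 \subset H2).
  move=> D1 D2; apply/idP/idP => h.
    by rewrite -(ext_cap D1) -(ext_cap D2) setSI.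
  by rewrite join_subG joing_subl (subset_trans h) ?joing_subr.
by move=> H1 H2 D1 D2; rewrite /nested !s.
Qed.

(** [G] is abelian and so centralizes [F]; hence its intersections with [D] and with ['C(E)] agree.
    As [F * 'C_P(E) = P], Dedekind's law gives [G = F * (G :&: D)]. *)
Lemma over_crossing G : G \in A -> F \subset G -> G != F ->
  exists2 H, H \in elab_over p D Z & G = ext H.
Proof.
move=> /elab_overP[GP abG ZG] FG nGF; have [sFP abF ZF oF nFE] := FTP.
have GD : G :&: D = G :&: 'C(E).
  rewrite /= centY setIA (setIidPl GP) setIA; apply/setIidPl.
  rewrite subIset // (subset_trans _ (centS FG)) //.
  by rewrite -abelianE (abelem_abelian abG).
have [defP _] := cent_pencil p_pr pP sZ oZ nE ZE oE sFP nFE.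
have eG : F * (G :&: D) = G.
  rewrite GD -{1}(setIidPl GP) -setIA setIC group_modl // defP.
  by apply/setIidPr.
have cF : G :&: D \subset 'C(F).
  by rewrite subIset //= orbC subIset // centS ?joing_subr ?orbT.
have sZG : Z \subset G := subset_trans ZF FG.
exists (G :&: D)%G; last by apply: val_inj; rewrite -[LHS]eG -(cent_joinEr cF).
apply/elab_overP; split; first exact: subsetIr.
  exact: abelemS (subsetIl _ _) abG.
rewrite properEneq; apply/andP; split; last first.
  by rewrite /= GD subsetI sZG (subset_trans cZ) ?centS.
apply: contra nGF => /eqP e; rewrite -val_eqE /= -eG -e.
by rewrite mulGSid.
Qed.

(** A group strictly above [Z] inside [F] is [F] itself, so the link of [F] consists of chains of
    groups above [F], to which [over_crossing] applies. *)
Lemma link_crossing : [set a : {set {group gT}} | (F \notin a) && (F |: a \in elab_flags P Z)]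
  = [set ext @: (a : {set {group gT}}) | a in elab_flags D Z].
Proof.
have AF : F \in A by move: FT; rewrite inE => /andP[].
apply/setP => a; rewrite inE; apply/andP/imsetP => [[Fa /flagP[aQ ra]]|[b /flagP[bQ rb] ->]].
  have aF G : G \in a -> exists2 H, H \in elab_over p D Z & G = ext H.
    move=> Ga; have AG : G \in A by rewrite (subsetP aQ) // !inE Ga orbT.
    have nGF : G != F by apply: contraNneq Fa => <-.
    apply: over_crossing => //.
    have /orP[//|GF] : nested F G by rewrite ra // !inE ?eqxx ?Ga ?orbT.
    have [sFP _ _ oF _] := FTP; have /elab_overP[_ _ ZG] := AG.
    by rewrite (line_eq p_pr pP oZ sFP oF ZG GF).
  pose b := [set H in elab_over p D Z | ext H \in a].
  have bE H : (H \in b) = (H \in elab_over p D Z) && (ext H \in a) by rewrite [LHS]in_set.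
  exists b.
    apply/flagP; split; first by apply/subsetP => H; rewrite bE => /andP[].
    move=> H1 H2; rewrite !bE => /andP[D1 a1] /andP[D2 a2].
    by rewrite -ext_nested //; apply: ra; rewrite in_setU1 ?a1 ?a2 orbT.
  apply/setP => G; apply/idP/imsetP => [Ga|[H]].
    by have [H DH eG] := aF G Ga; exists H; rewrite // bE DH -eG.
  by rewrite bE => /andP[_ ?] ->.
have extb G : G \in ext @: b -> exists2 H, H \in elab_over p D Z & H \in b /\ G = ext H.
  by case/imsetP=> H bH ->; exists H => //; apply: (subsetP bQ).
split; first by apply/negP => /extb[H DH [_ e]]; have := ext_neq DH; rewrite -e eqxx.
apply: flagU1; [exact: nested_sym | exact: nested_refl | by [] | |].
- apply/flagP; split; first by apply/subsetP => G /extb[H DH [_ ->]]; apply: ext_elab.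
  move=> G1 G2 /extb[H1 D1 [b1 ->]] /extb[H2 D2 [b2 ->]].
  by rewrite ext_nested //; apply: rb.
- by move=> G /extb[H _ [_ ->]]; rewrite /nested joing_subl.
Qed.

End Link.

(** A removed facet consists of a crossing [F] and the image of a facet removed from the link of
    [F]. It determines [F], so the facets with [n.+1] vertices through [F] correspond to those with
    [n] vertices for ['C_P(E <*> F)]. *)
Lemma spherical_step :
    (forall F, F \in T -> exists C, spherical 'C_P(E <*> F)%G Z C) ->
  exists2 C, spherical P Z C & forall c, c \in C -> exists2 F, F \in c & F \in T.
Proof.
move=> IH; have {}IH F : exists C, F \in T -> spherical 'C_P(E <*> F)%G Z C.
  have [/IH[C sC]|_] := boolP (F \in T); first by exists C.
  by exists set0.
have [CF sCF] := fin_all_exists IH.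
pose ext F H := (F <*> H)%G; pose D F := 'C_P(E <*> F)%G.
pose face F (a : {set {group gT}}) := F |: ext F @: a.
have linkE F : F \in T -> forall a, (F \notin a) && (F |: a \in elab_flags P Z) =
    (a \in [set ext F @: (b : {set {group gT}}) | b in elab_flags (D F) Z]).
  by move=> FT a; rewrite -(link_crossing FT) [RHS]in_set.
have faceP F a : F \in T -> a \in elab_flags (D F) Z ->
    F \notin ext F @: a /\ face F a \in elab_flags P Z.
  by move=> FT Da; apply/andP; rewrite linkE // imset_f.
have faceI F c : F \in T -> c \in elab_flags P Z -> F \in c ->
    exists2 a, a \in elab_flags (D F) Z & c = face F a.
  move=> FT Kc Fc; have /imsetP[a Da e] : c :\ F \in
      [set ext F @: (b : {set {group gT}}) | b in elab_flags (D F) Z].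
    by rewrite -linkE // setD11 setD1K.
  by exists a; rewrite // /face -e setD1K.
have face_sub F a b : F \in T -> a \in elab_flags (D F) Z -> b \in elab_flags (D F) Z ->
    face F a \subset face F b -> a \subset b.
  move=> FT Da Db s; have [Fa _] := faceP F a FT Da; apply/subsetP => H aH.
  have /flagP[aQ _] := Da; have /flagP[bQ _] := Db.
  have : ext F H \in face F b by apply: (subsetP s); rewrite !inE imset_f ?orbT.
  rewrite in_setU1 => /orP[/eqP e|/imsetP[H' bH' e]].
    by case/negP: Fa; rewrite -[X in X \in _]e imset_f.
  suff -> : H = H' by [].
  by apply: (ext_inj FT); [apply: (subsetP aQ) | apply: (subsetP bQ) | apply: e].
pose C := \bigcup_(F in T) [set face F a | a in CF F].
have CP c : reflect (exists F a, [/\ F \in T, a \in CF F & c = face F a]) (c \in C).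
  apply: (iffP bigcupP) => [[F FT /imsetP[a Ca ->]]|[F [a [FT Ca ->]]]].
    by exists F, a.
  by exists F; rewrite ?imset_f.
have CFD F a : F \in T -> a \in CF F -> a \in elab_flags (D F) Z.
  by move=> FT; have [/subsetP s _ _ _] := sCF F FT; apply: s.
have Cin c F : c \in C -> F \in T -> F \in c -> exists2 a, a \in CF F & c = face F a.
  case/CP=> F' [a [FT' Ca ->]] FT Fc; exists a => //; have [_ K] := faceP F' a FT' (CFD _ _ FT' Ca).
    by rewrite (crossing_uniq K FT FT' Fc (setU11 _ _)).
  by rewrite (crossing_uniq K FT FT' Fc (setU11 _ _)).
have sCK : C \subset elab_flags P Z.
  by apply/subsetP => c /CP[F [a [FT Ca ->]]]; have [] := faceP F a FT (CFD _ _ FT Ca).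
exists C; last first.
  by move=> c /CP[F [a [FT _ ->]]]; exists F; rewrite ?setU11.
split=> //.
- move=> c d /CP[F [a [FT Ca ->]]] Kd sub.
  have Fd : F \in d by rewrite (subsetP sub) ?setU11.
  have [b Db ed] := faceI _ _ FT Kd Fd; rewrite ed in sub *.
  have [_ mx _ _] := sCF F FT.
  by rewrite (mx a b) //; apply: (face_sub F) => //; apply: CFD.
- set N := elab_flags P Z :\: C.
  apply: (collapses_trans (@collapses_stars _ N T _ _)).
  + move=> c F1 F2 /setDP[Kc _]; exact: crossing_uniq Kc.
  + move=> F FT; have [_ _ cl _] := sCF F FT.
    set L := [set a : {set {group gT}} | _].
    have LE a : (a \in L) = (a \in [set ext F @: (b : {set {group gT}}) | b in elab_flags (D F) Z :\: CF F]).
      rewrite in_set; apply/andP/imsetP => [[Fa /setDP[Ka nCa]]|[b /setDP[Db nCb] ->]].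
        have : a \in [set ext F @: (b : {set {group gT}}) | b in elab_flags (D F) Z].
          by rewrite -linkE // Fa.
        case/imsetP=> b Db ea; exists b; rewrite // in_setD Db andbT.
        by apply: contra nCa => Cb; apply/CP; exists F, b; rewrite /face -ea.
      have [nF Kf] := faceP F b FT Db; rewrite nF in_setD Kf andbT; split=> //.
      apply: contra nCb => /Cin/(_ FT (setU11 _ _))[a' Ca e].
      suff -> : b = a' by [].
      have Da := CFD _ _ FT Ca.
      by apply/eqP; rewrite eqEsubset; apply/andP; split; apply: (face_sub F) => //; rewrite -e.
    have := @collapses_transport _ _ (ext F) set0 (elab_over p (D F) Z) _ set0 L (ext_inj FT) _ _ cl.
    rewrite setD0; set I := [set _ | _ in _]; have -> : L :\: I = set0.
      apply/eqP; rewrite setD_eq0; apply/subsetP => a; rewrite LE => /imsetP[b Nb ->].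
      by apply/imsetP; exists b; rewrite // set0U.
    apply.
    * by move=> x _; rewrite inE.
    * by move=> a /setDP[/flagP[]].
    * by move=> a Na _; rewrite set0U LE imset_f.
    * by move=> a b Na _; rewrite LE => /imsetP[a' Na' ->] _; exists a'; rewrite // set0U.
  + suff -> : [set c in N | [disjoint (c : {set {group gT}}) & T]] = flag nested (A :\: T).
      exact: noncrossing_collapse.
    apply/setP => c; rewrite [LHS]in_set; apply/andP/flagP => [[/setDP[/flagP[cA rc] _] dT]|[]].
      by split=> //; rewrite subsetD cA.
    rewrite subsetD => /andP[cA dT] rc; split=> //; rewrite in_setD; apply/andP; split.
      by apply/CP => -[F [a [FT _ e]]]; have := disjointFl dT FT; rewrite e setU11.
    by apply/flagP.
case=> [|n].
  rewrite (es_family0_pencil pP sZ oZ nE EP) cards0 muln0.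
  apply/eqP; rewrite cards_eq0; apply/eqP/setP => c; rewrite [LHS]in_set [RHS]inE.
  apply/negbTE/negP => /andP[/CP[F [a [_ _ ->]]]]; rewrite cards_eq0 => /eqP e.
  by have := setU11 F (ext F @: a); rewrite -/(face F a) e inE.
(* The exponent [n ^ 2] arises as the sum of the odd numbers contributed by the factors [p ^ (2i+1)]
   of [card_es_family]. *)
have e1 : (n.+1 ^ 2 = n ^ 2 + n.*2.+1)%N by rewrite -addn1 sqrnD muln1 addnAC -addnA mul2n addn1.
rewrite e1 expnD -mulnA (card_es_family p_pr p_odd pP sZ oZ nE EP oE) big_distrr /=.
pose C' := [set c in C | #|c| == n.+1].
have CE c : (c \in C') = (c \in C) && (#|c| == n.+1) by rewrite in_set.
rewrite -/C'.
transitivity (\sum_(c in C') \sum_(F in T | F \in c) 1)%N.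
  rewrite -sum1_card; apply: eq_bigr => c; rewrite CE => /andP[Cc _].
  have Kc := subsetP sCK _ Cc; have /CP[F [a [FT _ e]]] := Cc.
  have Fc : F \in c by rewrite e setU11.
  rewrite (big_pred1 F) // => F' /=; apply/andP/eqP => [[T' c']|->//].
  exact: crossing_uniq Kc T' FT c' Fc.
rewrite (exchange_big_dep (mem T)) //=; last by move=> ? ? _ /andP[].
apply: eq_bigr => F FT; have [_ _ _ <-] := sCF F FT.
have face_inj : {in CF F &, injective (face F)}.
  move=> a b Ca Cb e; have Da := CFD _ _ FT Ca; have Db := CFD _ _ FT Cb.
  by apply/eqP; rewrite eqEsubset; apply/andP; split; apply: (face_sub F) => //; rewrite e.
have faceS a : a \in CF F -> #|face F a| = #|a|.+1.
  move=> Ca; have Da := CFD _ _ FT Ca; have [nF _] := faceP F a FT Da.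
  rewrite /face cardsU1 nF add1n card_in_imset // => H1 H2 a1 a2.
  by have /flagP[aQ _] := Da; apply: (ext_inj FT); apply: (subsetP aQ).
rewrite -(card_in_imset (f := face F)); last first.
  by move=> a b; rewrite !inE => /andP[Ca _] /andP[Cb _]; apply: face_inj.
rewrite -sum1_card; apply: eq_bigl => c; rewrite FT /= CE.
apply/andP/imsetP => [[/andP[Cc sc] Fc]|[a]].
  have [a Ca e] := Cin c F Cc FT Fc; exists a => //.
  by rewrite inE Ca -eqSS -faceS // -e.
rewrite inE => /andP[Ca /eqP sa] ->; rewrite faceS // sa eqxx setU11 andbT; split=> //.
by apply/CP; exists F, a.
Qed.

End Crossing.

(** Nothing elementary abelian lies strictly above [Z], so the empty chain is the only one. It is
    the removed facet with 0 vertices and accounts for [es_family p P Z 0], which is [{Z}]. For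
    [n > 0] the family is empty, because a subgroup of exponent [p] lies in ['Ohm_1(P) = Z]. *)
Lemma spherical_no_pencil P Z : p.-group P -> Z \subset 'Z(P) -> #|Z| = p ->
  'Ohm_1(P) = Z -> exists C, spherical P Z C.
Proof.
move=> pP sZ oZ OP; have sZP := subset_trans sZ (center_sub P).
have A0 : elab_over p P Z = set0.
  apply/setP => G; rewrite [RHS]inE; apply/negP => /elab_overP[GP abG].
  by rewrite properE -OP (abelem_sub_Ohm1 pP GP abG) andbF.
have K0 : elab_flags P Z = [set set0].
  apply/setP => c; rewrite /elab_flags A0 [RHS]in_set1; apply/flagP/eqP => [[]|->].
    by rewrite subset0 => /eqP.
  by split=> [|x]; rewrite ?sub0set // inE.
have es0 : es_family p P Z 0 = [set Z].
  apply/setP => X; rewrite [RHS]inE; apply/idP/eqP => [/(es_family0 sZ oZ)[e _]|->].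
    exact: val_inj.
  have abZ : abelian Z by apply: cyclic_abelian; apply: prime_cyclic; rewrite oZ.
  have cZ : Z \subset 'C(P) := subset_trans sZ (subsetIr _ _).
  apply/es_familyP; split=> //; first exact/center_idP.
  - by rewrite (derG1P abZ) sub1G.
  - by rewrite -oZ exponent_dvdn.
  - by rewrite expn1; split=> //; rewrite (setIidPl _) // centsC.
have esS n : es_family p P Z n.+1 = set0.
  apply/setP => X; rewrite [RHS]inE; apply/negP => /es_familyP[sXP _ _ eX [oX _]].
  have /subset_leq_card : X \subset Z.
    rewrite -OP; apply/subsetP => x Xx; apply: (mem_Ohm1 pP); first exact: (subsetP sXP).
    exact: (exponentP eX).
  by rewrite oX oZ -{2}(expn1 p) (leq_exp2l _ _ (prime_gt1 p_pr)).
exists [set set0]; split; rewrite ?K0 ?subxx // ?setDv.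
- by move=> c d /set1P -> /set1P ->.
- exact: collapses_refl.
case=> [|n].
  rewrite es0 cards1 muln1; apply/eqP/cards1P; exists set0.
  by apply/setP => c; rewrite !inE; apply/andb_idr => /eqP ->; rewrite cards0.
rewrite esS cards0 muln0; apply/eqP; rewrite cards_eq0; apply/eqP/setP => c.
by rewrite !inE; apply/negP => /andP[/eqP ->]; rewrite cards0.
Qed.

Lemma crossing_centralizer P Z E F : Z \subset 'Z(P) -> E \subset P -> F \in crossing p P Z E ->
  'C_P(E <*> F) \proper P /\ Z \subset 'Z('C_P(E <*> F)).
Proof.
move=> sZ sEP; rewrite inE => /and3P[/elab_overP[sFP _ _] _ nFE].
have sZP := subset_trans sZ (center_sub P).
have cZ : Z \subset 'C(P) := subset_trans sZ (subsetIr _ _).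
split.
  rewrite properEneq subsetIl andbT; apply: contra nFE => /eqP eP.
  by rewrite (subset_trans sFP) // -eP subIset // centS ?joing_subl ?orbT.
rewrite !subsetI sZP !(subset_trans cZ) // centS ?subsetIl //.
by rewrite join_subG sEP.
Qed.

Theorem spherical_exists P Z : p.-group P -> Z \subset 'Z(P) -> #|Z| = p ->
  exists C, spherical P Z C.
Proof.
have [n] := ubnP #|P|; elim: n P => // n IHn P leP pP sZ oZ.
have [OP|nOP] := eqVneq 'Ohm_1(P) Z; first exact: spherical_no_pencil.
have [E [nE EP oE]] := exists_normal_elab p_pr p_odd pP sZ oZ nOP.
have [F FT|C] := @spherical_step P Z E pP sZ oZ nE EP oE; last by exists C.
have [/proper_card ltD sZD] := crossing_centralizer sZ (normal_sub nE) FT.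
apply: IHn => //; first exact: leq_trans ltD leP.
exact: pgroupS (subsetIl _ _) pP.
Qed.

(** Here [E] is prescribed for the outermost step, so that it can be adapted to a base point; the
    centralizers in the recursion may use any choice. *)
Theorem spherical_pencil P Z E : p.-group P -> Z \subset 'Z(P) -> #|Z| = p ->
    E <| P -> E \in elab_over p P Z -> #|E| = (p ^ 2)%N ->
  exists2 C, spherical P Z C & forall c, c \in C -> exists2 F, F \in c & F \in crossing p P Z E.
Proof.
move=> pP sZ oZ nE EP oE; apply: spherical_step => // F FT.
have [_ sZD] := crossing_centralizer sZ (normal_sub nE) FT.
by apply: spherical_exists => //; apply: pgroupS (subsetIl _ _) pP.
Qed.

End Decomposition.

(** * All elementary abelian subgroups of order at least [p ^ 2] *)

Section Rank2.
Local Open Scope group_scope.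
Variables (gT : finGroupType) (p : nat).
Hypotheses (p_pr : prime p) (p_odd : odd p).
Implicit Types P X Y Z E F D G H : {group gT}.
Implicit Types (C K N : {set {set {group gT}}}) (a b c d : {set {group gT}}).

Definition ge2_flags P := flag (@nested gT) (elem_abelian_ge2 p P).

Lemma ge2P P G : reflect [/\ G \subset P, p.-abelem G & p ^ 2 <= #|G|] (G \in elem_abelian_ge2 p P).
Proof. by rewrite !inE; apply: (iffP andP) => [[/andP[]]|[-> ->]]. Qed.

Section Fixed.
Variables (P Z : {group gT}).
Hypotheses (pP : p.-group P) (sZ : Z \subset 'Z(P)) (oZ : #|Z| = p).

Let sZP : Z \subset P. Proof. exact: subset_trans sZ (center_sub P). Qed.
Let cZ : Z \subset 'C(P). Proof. exact: subset_trans sZ (subsetIr _ _). Qed.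
Let abZ : p.-abelem Z. Proof. by rewrite prime_abelem. Qed.

Lemma elab_over_ge2 G : (G \in elab_over p P Z) = (G \in elem_abelian_ge2 p P) && (Z \subset G).
Proof.
apply/elab_overP/andP => [[GP abG ZG]|[/ge2P[GP abG oG] ZG]].
  split; last exact: proper_sub.
  apply/ge2P; split=> //; have [m oG] := p_natP (abelem_pgroup abG).
  move: (proper_card ZG); rewrite oZ oG -{1}(expn1 p) (ltn_exp2l _ _ (prime_gt1 p_pr)) => m1.
  by rewrite (leq_exp2l _ _ (prime_gt1 p_pr)).
split=> //; rewrite properEcard ZG oZ (leq_trans _ oG) //.
by rewrite -{1}(expn1 p) (ltn_exp2l _ _ (prime_gt1 p_pr)).
Qed.

Lemma ge2_joing G : G \in elem_abelian_ge2 p P -> (G <*> Z)%G \in elab_over p P Z.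
Proof.
case/ge2P=> GP abG oG; rewrite elab_over_ge2 joing_subr andbT; apply/ge2P; split.
- by rewrite join_subG GP.
- by apply: abelem_joing => //; rewrite (subset_trans cZ) // centS.
- by rewrite (leq_trans oG) // subset_leq_card // joing_subl.
Qed.

Lemma ge2_collapse : collapses (ge2_flags P) (elab_flags p P Z).
Proof.
have inj2 G : G \in elab_over p P Z -> G \in elem_abelian_ge2 p P.
  by rewrite elab_over_ge2 => /andP[].
have fix_ G : Z \subset G -> (G <*> Z)%G = G by move=> ZG; apply/val_inj/joing_idPl.
have := @flag_retract _ (@nested gT) (elem_abelian_ge2 p P) (fun G => G <*> Z)%G (fun G => #|G|)
  (@nested_refl gT) (@nested_sym gT) (fun G AG => inj2 _ (ge2_joing AG)).
have -> : [set G in elem_abelian_ge2 p P | (G <*> Z)%G == G] = elab_over p P Z.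
  apply/setP => G; rewrite in_set elab_over_ge2; congr (_ && _).
  by apply/eqP/idP => [<-|/fix_ //]; apply: joing_subr.
apply.
- by move=> G _; apply: fix_; apply: joing_subr.
- by move=> G _; rewrite /nested joing_subl.
- move=> G H AG AH _ /orP[sHG|sGH] mHG.
    by rewrite /nested (subset_trans sHG) ?joing_subl.
  case: mHG => [eH|leHG].
    apply/orP; right; rewrite -eH join_subG joing_subr andbT.
    exact: subset_trans sGH (joing_subl _ _).
  suff -> : H = G by rewrite /nested joing_subl.
  by apply/val_inj/eqP; rewrite /= eq_sym eqEcard sGH.
Qed.

(** Everything comes from the crossing member [F] of a removed facet. A group of order at least
    [p ^ 2] nested with [F] contains [F], hence [Z], so the facet stays maximal among all chains. If
    it had a member [G] with [E] inside [G <*> Z = G], then [E] and [F] would both lie in the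
    abelian group [G], and [F] would centralize [E]. *)
Lemma ge2_spherical E : E <| P -> E \in elab_over p P Z -> #|E| = (p ^ 2)%N ->
  exists C, [/\ C \subset ge2_flags P /\ set0 \notin C,
    forall c d, c \in C -> d \in ge2_flags P -> c \subset d -> d = c,
    collapses (ge2_flags P :\: C) set0,
    forall n, #|[set c in C | #|c| == n]| = (p ^ (n ^ 2) * #|es_family p P Z n|)%N &
    forall c G, c \in C -> G \in elem_abelian_ge2 p P -> E \subset G <*> Z -> G \notin c].
Proof.
move=> nE EP oE; have [C [CK mx cl cnt] CT] := spherical_pencil p_pr p_odd pP sZ oZ nE EP oE.
have sub2 : elab_flags p P Z \subset ge2_flags P.
  apply/subsetP => c /flagP[cQ rc]; apply/flagP; split=> //.
  by apply: subset_trans cQ _; apply/subsetP => G; rewrite elab_over_ge2 => /andP[].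
exists C; split=> //.
- split; first exact: subset_trans CK sub2.
  by apply/negP => /CT[F]; rewrite inE.
- move=> c d Cc Kd scd; apply: mx => //; have [F Fc FT] := CT c Cc.
  have /flagP[dQ rd] := Kd; apply/flagP; split=> //; apply/subsetP => G Gd.
  have A2G := subsetP dQ G Gd; rewrite elab_over_ge2 A2G /=.
  move: FT; rewrite inE => /and3P[/elab_overP[_ _ /proper_sub ZF] /eqP oF _].
  have /orP[FG|GF] : nested F G by apply: rd; rewrite // (subsetP scd).
    exact: subset_trans ZF FG.
  have /ge2P[_ _ oG] := A2G; suff -> : G :=: F by [].
  by apply/eqP; rewrite eqEcard GF oF.
- apply: collapses_trans cl.
  have -> : elab_flags p P Z :\: C = (ge2_flags P :\: C) :\: (ge2_flags P :\: elab_flags p P Z).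
    apply/setP => c; rewrite !in_setD; case: (boolP (c \in elab_flags p P Z)) => Kc /=.
      by rewrite (subsetP sub2) // andbT.
    by rewrite andbF; case: (c \in ge2_flags P); rewrite ?andbF.
  apply: collapses_within ge2_collapse _ _.
    move=> c Kc nKc; rewrite in_setD Kc andbT; apply: contra nKc; exact: (subsetP CK).
  by move=> c d _ _ /setDP[].
- move=> c G Cc A2G EG; have [F Fc FT] := CT c Cc; apply/negP => Gc.
  have /flagP[cQ rc] := subsetP CK c Cc.
  have ZG : Z \subset G by have := subsetP cQ G Gc; rewrite elab_over_ge2 => /andP[].
  have {}EG : E \subset G by rewrite (subset_trans EG) // join_subG subxx.
  move: FT; rewrite inE => /and3P[_ /eqP oF /negP]; apply.
  have /ge2P[_ abG oG] := A2G.
  have FG : F \subset G.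
    have /orP[//|GF] := rc _ _ Fc Gc; suff -> : F :=: G by [].
    by apply/esym/eqP; rewrite eqEcard GF oF.
  rewrite (subset_trans FG) // (subset_trans _ (centS EG)) //.
  by rewrite -abelianE (abelem_abelian abG).
Qed.

(** Only [X] itself can belong to the family of [X]. An extraspecial member [Y] has [[~: Y, X]]
    inside [Z], its derived subgroup, so [X = Y * 'C_X(Y)]; as [X] has exponent [p], ['C_X(Y)] lies
    in its ['Ohm_1], which is [Z]. And [Y = Z] would force ['Ohm_1(X) = Z], whereas
    ['Ohm_1(X) = X]. *)
Lemma es_family_self X n m : X \in es_family p P Z n.+1 ->
  #|es_family p X Z m| = (X \in es_family p P Z m).
Proof.
move=> Xes; have /es_familyP[sXP ZX dX eX [oX OX]] := Xes.
have pX := pgroupS sXP pP.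
have OmX : 'Ohm_1(X) = X.
  apply/eqP; rewrite eqEsubset Ohm_sub; apply/subsetP => x Xx.
  by apply: (mem_Ohm1 pX Xx); apply: (exponentP eX).
have uniq Y k : Y \in es_family p X Z k -> Y = X.
  case: k => [|k] Yes.
    have [_ OXZ] : Y :=: Z /\ 'Ohm_1(X) = Z by apply: (es_family0 (p := p)); rewrite ?ZX.
    have : #|X| = p by rewrite -OmX OXZ.
    by move/eqP; rewrite oX -{2}(expn1 p) eqn_exp2l ?prime_gt1.
  have esY : extraspecial Y by apply: (es_extraspecial p_pr pX oZ Yes).
  have [[_ dY] _] := esY.
  have /es_familyP[sYX ZY _ _ [oY OY]] := Yes.
  have comm : [~: Y, X] \subset Y^`(1).
    by rewrite dY ZY (subset_trans (commSg X sYX)).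
  have /cprodP[_ defX _] := critical_extraspecial pX sYX esY comm.
  apply/val_inj/eqP; rewrite /= eqEsubset sYX -{1}defX mul_subG //.
  have : 'C_X(Y) \subset 'Ohm_1('C_X(Y)).
    apply/subsetP => x Cx; apply: (mem_Ohm1 (pgroupS (subsetIl _ _) pX) Cx).
    by apply: (exponentP eX); have /setIP[] := Cx.
  by rewrite OY => /subset_trans; apply; rewrite -ZY center_sub.
have self k : X \in es_family p P Z k -> X \in es_family p X Z k.
  case/es_familyP=> _ _ _ _ [oXk _]; apply/es_familyP; split=> //; split=> //.
  by rewrite -/('Z(X)) ZX (Ohm1_id abZ).
have [Xm|nXm] := boolP (X \in es_family p P Z m).
  apply/eqP/cards1P; exists X; apply/setP => Y; rewrite in_set1.
  by apply/idP/eqP => [/uniq //|->]; apply: self.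
apply/eqP; rewrite cards_eq0; apply/eqP/setP => Y; rewrite [RHS]inE; apply/negbTE.
apply: contra nXm => Ym; have eY := uniq Y m Ym; rewrite eY in Ym.
have /es_familyP[_ _ _ _ [oXm _]] := Ym.
by apply/es_familyP.
Qed.

(** Any [e] in [G <*> Z] outside [Z] gives such an [E], namely [Z <*> <[e]>], which is normal
    because it contains the derived subgroup. *)
Lemma ge2_pencil G : P^`(1) \subset Z -> G \in elem_abelian_ge2 p P -> exists E : {group gT},
  [/\ E <| P, E \in elab_over p P Z, #|E| = (p ^ 2)%N & E \subset G <*> Z].
Proof.
move=> dP AG; have /elab_overP[GZP abGZ ZGZ] := ge2_joing AG.
have /properP[_ [e GZe Ze]] := ZGZ.
have /abelemP[//|cGZ eGZ] := abGZ.
have ne1 : e != 1 by apply: contraNneq Ze => ->; rewrite group1.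
have oe : #[e] = p by apply: (nt_prime_order p_pr (eGZ e GZe)).
have TI : Z :&: <[e]> = 1.
  rewrite setIC; apply: prime_TIg; first by rewrite -orderE oe.
  by rewrite cycle_subG.
have sE : Z <*> <[e]> \subset G <*> Z by rewrite join_subG joing_subr cycle_subG.
have cZe : <[e]> \subset 'C(Z).
  rewrite cycle_subG; apply: (subsetP (centS (proper_sub ZGZ))).
  exact: (subsetP cGZ).
have oE : #|Z <*> <[e]>| = (p ^ 2)%N.
  by rewrite cent_joinEr // TI_cardMg // oZ -orderE oe expnS expn1.
exists (Z <*> <[e]>)%G; split=> //.
- apply: sub_der1_normal; last exact: subset_trans sE GZP.
  exact: subset_trans dP (joing_subl _ _).
- apply/elab_overP; split; [exact: subset_trans sE GZP | exact: abelemS sE abGZ |].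
  by rewrite properEcard joing_subl oZ oE -{1}(expn1 p) (ltn_exp2l _ _ (prime_gt1 p_pr)).
Qed.

(** All members share the center [Z]: it centralizes [X], so it lies in ['Ohm_1('C_P(X)) = 'Z(X)],
    which has the same order [p]. *)
Lemma extraspecial_familyE X :
  extraspecial_family p P X <-> exists n, X \in es_family p P Z n.+1.
Proof.
split=> [[sXP esX eX OX]|[n Xes]].
  have pX := pgroupS sXP pP; have oZX := card_center_extraspecial pX esX.
  have ZX : 'Z(X) = Z.
    apply/eqP; rewrite eq_sym eqEcard oZX oZ leqnn andbT -OX.
    apply: abelem_sub_Ohm1 abZ; first exact: pgroupS (subsetIl _ _) pP.
    by rewrite subsetI sZP (subset_trans cZ) ?centS.
  have [n n0 oX] := card_extraspecial pX esX; exists n.-1; rewrite prednK //.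
  have [[_ dX] _] := esX; apply/es_familyP; split=> //; first by rewrite dX ZX.
  by split=> //; rewrite OX ZX.
have /es_familyP[sXP ZX dX eX [oX OX]] := Xes; split=> //; last by rewrite OX ZX.
exact: (es_extraspecial p_pr pP oZ Xes).
Qed.

End Fixed.
End Rank2.

(** * The complex of a wedge *)

(* K is a bouquet of spheres, one for each maximal face in C; c is a vertex outside K. *)
Definition sphere_wedge (V : finType) (K C : {set {set V}}) (c : V) :=
  [/\ down_closed K /\ set0 \in K, C \subset K /\ set0 \notin C,
      forall a b, a \in C -> b \in K -> a \subset b -> b = a,
      collapses (K :\: C) set0 & forall a, a \in K -> c \notin a].

Section WedgeComplex.
Variables (W V : finType).
Implicit Types (I : {set W}) (a b : {set V}) (c d : {set option (W * V)}).
Implicit Types (N S K C : W -> {set {set V}}).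

Definition in_summand w a : {set option (W * V)} := [set Some (w, x) | x in a].

(* The vertex None is the base point; it is joined to the faces of S w. *)
Definition wedge_complex I N S : {set {set option (W * V)}} :=
  [set set0; [set None]]
    :|: \bigcup_(w in I) [set in_summand w a | a in N w]
    :|: \bigcup_(w in I) [set None |: in_summand w a | a in S w].

Variant wedge_face I N S c : Prop :=
| WedgeEmpty of c = set0
| WedgeBase of c = [set None]
| WedgeFace w a of w \in I & a \in N w & c = in_summand w a
| WedgeCone w a of w \in I & a \in S w & c = None |: in_summand w a.

Arguments WedgeFace {I N S c w a}.
Arguments WedgeCone {I N S c w a}.

Lemma wedge_complexP I N S c : reflect (wedge_face I N S c) (c \in wedge_complex I N S).
Proof.
apply: (iffP idP) => [/setUP[/setUP[/set2P[->|->]|/bigcupP[w Iw /imsetP[a Na ->]]]|/bigcupP[w Iw /imsetP[a Sa ->]]]|].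
- exact: WedgeEmpty.
- exact: WedgeBase.
- exact: WedgeFace Iw Na _.
- exact: WedgeCone Iw Sa _.
case=> [->|->|w a Iw Na ->|w a Iw Sa ->]; apply/setUP.
- by left; apply/setUP; left; apply: set21.
- by left; apply/setUP; left; apply: set22.
- by left; apply/setUP; right; apply/bigcupP; exists w; rewrite ?imset_f.
- by right; apply/bigcupP; exists w => //; apply/imsetP; exists a.
Qed.

Lemma mem_summand w w' x a : (Some (w', x) \in in_summand w a) = (w' == w) && (x \in a).
Proof.
apply/imsetP/andP => [[y ya [-> ->]]|[/eqP -> xa]]; first by rewrite eqxx.
by exists x.
Qed.

Lemma None_summand w a : None \in in_summand w a = false.
Proof. by apply/negP => /imsetP[]. Qed.

Lemma summandS w a b : (in_summand w a \subset in_summand w b) = (a \subset b).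
Proof.
apply/idP/idP => [/subsetP s|]; last exact: imsetS.
by apply/subsetP => x xa; have := s (Some (w, x)); rewrite !mem_summand xa eqxx => /(_ isT).
Qed.

Lemma summand_inj w : injective (in_summand w).
Proof. by move=> a b e; apply/eqP; rewrite eqEsubset -!(summandS w) e subxx. Qed.

Lemma summand0 w : in_summand w set0 = set0. Proof. exact: imset0. Qed.

Lemma summand_sub w w' x a b : x \in a -> in_summand w a \subset None |: in_summand w' b -> w = w'.
Proof.
move=> xa /subsetP/(_ (Some (w, x))); rewrite mem_summand eqxx xa => /(_ isT).
by rewrite in_setU1 mem_summand => /andP[/eqP].
Qed.

Lemma summandSN w a b : (in_summand w a \subset None |: in_summand w b) = (a \subset b).
Proof.
apply/idP/idP => [/subsetP s|ab]; last by rewrite (subset_trans _ (subsetUr _ _)) ?summandS.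
apply/subsetP => x xa; have := s (Some (w, x)).
by rewrite in_setU1 !mem_summand xa eqxx => /(_ isT).
Qed.

Lemma summandNS w a c : None |: in_summand w a \subset c -> in_summand w a \subset c.
Proof. exact: subset_trans (subsetUr _ _). Qed.

Lemma summandNN w a w' b : None |: in_summand w a \subset in_summand w' b = false.
Proof. by apply/negP => /subsetP/(_ None); rewrite setU11 None_summand => /(_ isT). Qed.

Lemma summandN_inj w a b : None |: in_summand w a = None |: in_summand w b -> a = b.
Proof.
by move=> e; apply/eqP; rewrite eqEsubset -!(summandSN w) -e subsetUr e subsetUr.
Qed.

Lemma summand_neq0 w x a : x \in a -> in_summand w a != set0.
Proof. by move=> xa; apply/set0Pn; exists (Some (w, x)); rewrite mem_summand eqxx. Qed.

Lemma summandN_neq0 w x a : x \in a -> None |: in_summand w a != [set None].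
Proof.
move=> xa; apply: contraNneq (summand_neq0 w xa) => e; apply/eqP/setP => -[[w' y]|].
  have : Some (w', y) \in [set None : option (W * V)] = false by rewrite inE.
  by rewrite -e in_setU1 /= inE.
by rewrite None_summand inE.
Qed.

(** Summands are removed one at a time. [S w] is a cone with apex [v w], so toggling [v w] deletes
    the faces through [None] except the vertex [None] and the edge from it to [v w]. Then [N w]
    collapses onto [v w], and finally [v w] goes with that edge. *)
Lemma wedge_complex_collapse I N S (v : W -> V) :
    (forall w, w \in I -> [/\ down_closed (N w), collapses (N w) set0, [set v w] \in N w,
      set0 \in S w & S w \subset N w]) ->
    (forall w a, w \in I -> a \in S w -> v w |: a \in S w /\ a :\ v w \in S w) ->
  collapses (wedge_complex I N S) set0.
Proof.
have [n] := ubnP #|I|; elim: n I => // n IHn I leI hN tgl.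
have [->|[w Iw]] := set_0Vmem I.
  suff -> : wedge_complex set0 N S = [set set0; [set None]].
    apply: (@collapses_step _ _ _ set0 None); rewrite ?inE ?setU0 ?eqxx ?orbT //.
      by move=> b /set2P[] ->; [left | right].
    suff -> : [set set0; [set None]] :\ set0 :\ [set None] = set0 :> {set {set option (W * V)}}.
      exact: collapses_refl.
    by apply/setP => c; rewrite !inE; do 2![case: eqP => //=].
  by rewrite /wedge_complex !big_set0 !setU0.
have [dN cN Nv S0 sSN] := hN w Iw; have {}tglw := tgl w _ Iw.
set M := wedge_complex I N S; set u := v w in Nv tglw.
have S1 : [set u] \in S w by have [] := tglw _ S0; rewrite setU0.
pose F := [set None |: in_summand w a | a in S w :\: [set set0; [set u]]].
pose M1 := M :\: F.
pose M2 := M1 :\: [set set0 :|: in_summand w a | a in N w :\: [set set0; [set u]]].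
have neF a : a \notin [set set0; [set u]] -> exists2 x, x \in a & ~~ (a \subset [set u]).
  rewrite in_set2 negb_or => /andP[/set0Pn[x xa] au]; exists x => //.
  by rewrite subset1 negb_or au; apply/set0Pn; exists x.
have c1 : collapses M M1.
  apply: (@toggle_collapses _ _ _ (Some (w, u))).
  - apply/subsetP => c /imsetP[a /setDP[Sa _] ->]; apply/wedge_complexP.
    exact: WedgeCone Iw Sa _.
  - move=> c /imsetP[a /setDP[Sa na] ->]; have [Sua Sau] := tglw _ Sa.
    have [x xa nau] := neF a na; split; apply/imsetP.
      exists (u |: a); last by rewrite /in_summand imsetU1 setUCA.
      rewrite in_setD Sua andbT; apply: contra nau => /set2P[] e.
        by have := setU11 u a; rewrite e inE.
      by rewrite -e subsetUr.
    exists (a :\ u).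
      rewrite in_setD Sau andbT; apply: contra nau => /set2P[] e.
        by rewrite -setD_eq0 e eqxx.
      by have := set11 u; rewrite -e !inE eqxx.
    apply/setP => -[[w' y]|]; rewrite in_setD1 !in_setU1 // !mem_summand in_setD1.
    by have [->|] := eqVneq w' w; rewrite ?andbF //= (inj_eq (@Some_inj _)) xpair_eqE eqxx.
  - move=> c d /imsetP[a /setDP[Sa na] ->] /wedge_complexP Md sad.
    have [x xa nau] := neF a na; have sa := summandNS sad.
    case: Md sad sa => [->|->|w' b Iw' Nb ->|w' b Iw' Sb ->].
    + by move=> _; rewrite subset0 (negbTE (summand_neq0 w xa)).
    + rewrite subset1 (negbTE (summandN_neq0 w xa)) /= => /eqP e.
      by have := setU11 None (in_summand w a); rewrite e inE.
    + by rewrite summandNN.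
    + move=> _ sab; have eww := summand_sub xa sab; subst w'.
      apply/imsetP; exists b => //; rewrite in_setD Sb andbT.
      rewrite summandSN in sab; apply: contra nau => /set2P[] e; move: sab; rewrite e //.
      by rewrite subset0 => /eqP ->; apply: sub0set.
apply: (collapses_trans c1).
have M1P c : c \in M1 ->
    wedge_face I N S c /\ (forall a, a \in S w -> a \notin [set set0; [set u]] -> c != None |: in_summand w a).
  case/setDP=> /wedge_complexP Mc nF; split=> // a Sa na.
  by apply: contraNneq nF => ->; apply/imsetP; exists a; rewrite // in_setD na.
have c2 : collapses M1 M2.
  apply: (@collapses_transport _ _ (fun x => Some (w, x)) set0 setT (N w) _ M1) (collapses_vertex dN cN Nv) _ _.
  - by move=> x y _ _ [].
  - by move=> x _; rewrite inE.
  - by move=> a _; apply: subsetT.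
  - move=> a Na na; rewrite set0U in_setD; apply/andP; split.
      apply/imsetP => -[b _ e]; have := None_summand w a.
      by rewrite /in_summand e setU11.
    by apply/wedge_complexP; apply: WedgeFace Iw Na _.
  - move=> a d Na na /M1P[Md nF]; rewrite set0U -/(in_summand w a).
    have [x xa nau] := neF a na; case: Md nF => [->|->|w' b Iw' Nb ->|w' b Iw' Sb ->] nF sad.
    + by move: sad; rewrite subset0 (negbTE (summand_neq0 w xa)).
    + by have := subsetP sad (Some (w, x)); rewrite mem_summand eqxx xa inE => /(_ isT).
    + have eww : w = w' by apply: (@summand_sub w w' x a b xa); apply: subset_trans sad (subsetUr _ _).
      by subst w'; exists b; rewrite // set0U.
    + have eww := summand_sub xa sad; subst w'; rewrite summandSN in sad.
      suff /(nF b Sb) : b \notin [set set0; [set u]] by rewrite eqxx.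
      apply: contra nau => /set2P[] e; move: sad; rewrite e //.
      by rewrite subset0 => /eqP ->; apply: sub0set.
apply: (collapses_trans c2).
set s1 := in_summand w [set u]; pose s2 := None |: s1.
have Mw J c x : c \in wedge_complex J N S -> Some (w, x) \in c -> w \in J.
  case/wedge_complexP => [->|->|w' a Jw' Na ->|w' a Jw' Sa ->].
  - by rewrite inE.
  - by rewrite inE.
  - by rewrite mem_summand => /andP[/eqP ->].
  - by rewrite in_setU1 /= mem_summand => /andP[/eqP ->].
have s1u : Some (w, u) \in s1 by rewrite mem_summand eqxx set11.
have nMw c : Some (w, u) \in c -> c \notin wedge_complex (I :\ w) N S.
  by move=> uc; apply/negP => /(@Mw _ _ u)/(_ uc); rewrite setD11.
have sM c : c \in wedge_complex (I :\ w) N S -> c \in M.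
  case/wedge_complexP => [->|->|w' a /setD1P[_ Iw'] Na ->|w' a /setD1P[_ Iw'] Sa ->].
  - by apply/wedge_complexP; apply: WedgeEmpty.
  - by apply/wedge_complexP; apply: WedgeBase.
  - apply/wedge_complexP; exact: (WedgeFace Iw' Na erefl).
  - apply/wedge_complexP; exact: (WedgeCone Iw' Sa erefl).
have inM2 c : c \in M -> (forall a x, x \in a -> a != [set u] -> c != None |: in_summand w a) ->
    (forall a x, x \in a -> a != [set u] -> c != in_summand w a) -> c \in M2.
  move=> Mc h1 h2; rewrite in_setD [c \in M1]in_setD Mc andbT; apply/andP; split.
    apply/imsetP => -[a /setDP[_ na] e]; have [x xa _] := neF a na.
    have /(h2 a x xa) : a != [set u] by move: na; rewrite in_set2 negb_or => /andP[].
    by rewrite e set0U eqxx.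
  apply/imsetP => -[a /setDP[_ na] e]; have [x xa _] := neF a na.
  have /(h1 a x xa) : a != [set u] by move: na; rewrite in_set2 negb_or => /andP[].
  by rewrite e eqxx.
have M2E c : (c \in M2) = [|| c \in wedge_complex (I :\ w) N S, c == s1 | c == s2].
  apply/idP/or3P => [/setDP[/M1P[Mc nF] nR]|].
    case: Mc nF nR => [->|->|w' a Iw' Na ->|w' a Iw' Sa ->] nF nR.
    - by constructor 1; apply/wedge_complexP; apply: WedgeEmpty.
    - by constructor 1; apply/wedge_complexP; apply: WedgeBase.
    - have [ew|nw] := eqVneq w' w; last first.
        by constructor 1; apply/wedge_complexP; apply: WedgeFace (_ : w' \in _) Na erefl; rewrite // in_setD1 nw.
      subst w'; have [/set2P[] ->|na] := boolP (a \in [set set0; [set u]]).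
      + by constructor 1; apply/wedge_complexP; apply: WedgeEmpty; rewrite summand0.
      + by constructor 2.
      by case/negP: nR; apply/imsetP; exists a; rewrite ?set0U // in_setD na.
    - have [ew|nw] := eqVneq w' w; last first.
        by constructor 1; apply/wedge_complexP; apply: WedgeCone (_ : w' \in _) Sa erefl; rewrite // in_setD1 nw.
      subst w'; have [/set2P[] ->|na] := boolP (a \in [set set0; [set u]]).
      + by constructor 1; apply/wedge_complexP; apply: WedgeBase; rewrite summand0 setU0.
      + by constructor 3.
      by have := nF a Sa na; rewrite eqxx.
  case=> [Mc|/eqP->|/eqP->]; apply: inM2.
  - exact: sM.
  - move=> a x xa _; apply: contraTneq Mc => ->; apply/negP => /(@Mw _ _ x).
    by rewrite in_setU1 mem_summand eqxx xa setD11 => /(_ isT).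
  - move=> a x xa _; apply: contraTneq Mc => ->; apply/negP => /(@Mw _ _ x).
    by rewrite mem_summand eqxx xa setD11 => /(_ isT).
  - apply/wedge_complexP; exact: (WedgeFace Iw Nv erefl).
  - by move=> a x _ _; apply/eqP => e; have := None_summand w [set u]; rewrite -/s1 e setU11.
  - by move=> a x _; apply: contra_neq => /summand_inj.
  - apply/wedge_complexP; exact: (WedgeCone Iw S1 erefl).
  - by move=> a x _; apply: contra_neq => /summandN_inj.
  - by move=> a x _ _; apply/eqP => e; have := None_summand w a; rewrite -e setU11.
apply: (@collapses_step _ _ _ s1 None); rewrite ?M2E -/s2 ?eqxx ?orbT ?None_summand //.
  move=> c; rewrite M2E => /or3P[Mc|/eqP ->|/eqP ->] sub; [|by left|by right].
  by have := nMw c (subsetP sub _ s1u); rewrite Mc.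
have -> : M2 :\ s1 :\ s2 = wedge_complex (I :\ w) N S.
  apply/setP => c; rewrite 2!in_setD1 M2E.
  have [->|_] := eqVneq c s2; first by rewrite (negbTE (nMw _ _)) // in_setU1 s1u orbT.
  by have [->|_] := eqVneq c s1; rewrite ?orbF //= (negbTE (nMw _ _)).
apply: IHn => [|w'|w' a] /=.
- by move: leI; rewrite (cardsD1 w) Iw.
- by move=> /setD1P[_ Iw']; apply: hN.
- by move=> /setD1P[_ Iw']; apply: tgl.
Qed.

Lemma sub_summand w a c : c \subset in_summand w a ->
  exists2 b : {set V}, b \subset a & c = in_summand w b.
Proof.
move=> s; exists [set x | Some (w, x) \in c].
  by apply/subsetP => x; rewrite inE => /(subsetP s); rewrite mem_summand => /andP[].
apply/setP => y; apply/idP/imsetP => [yc|[x]]; last by rewrite inE => ? ->.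
have /imsetP[x _ ey] := subsetP s y yc.
by exists x; rewrite // inE -ey.
Qed.

Lemma wedge_down_closed I N S : (forall w, w \in I -> [/\ down_closed (N w), down_closed (S w) & S w \subset N w]) ->
  down_closed (wedge_complex I N S).
Proof.
move=> dd c d /wedge_complexP Mc sdc; apply/wedge_complexP; case: Mc sdc => [->|->|w a Iw Na ->|w a Iw Sa ->] sdc.
- by apply: WedgeEmpty; apply/eqP; rewrite -subset0.
- by move: sdc; rewrite subset1 => /orP[] /eqP ->; [apply: WedgeBase | apply: WedgeEmpty].
- have [b ba ->] := sub_summand sdc; have [dN _ _] := dd w Iw.
  exact: (WedgeFace Iw (dN _ _ Na ba) erefl).
have [dN dS /subsetP sSN] := dd w Iw.
have sd : d :\ None \subset in_summand w a by rewrite subDset.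
have [b ba eb] := sub_summand sd.
have [Nd|nNd] := boolP (None \in d).
  by apply: (WedgeCone Iw (dS _ _ Sa ba)); rewrite -eb setD1K.
apply: (WedgeFace Iw (dN _ _ (sSN _ Sa) ba)); rewrite -eb.
by apply/setP => y; rewrite in_setD1 andb_idl // => yd; apply: contraNneq nNd => <-.
Qed.

(** Since [S w] avoids [C w], no removed facet is joined to [None]; so these facets stay maximal,
    and the rest is treated by [wedge_complex_collapse]. *)
Lemma wedge_sphere I K S C (v : W -> V) (c : option (W * V)) :
    (forall w, w \in I -> [/\ down_closed (K w), C w \subset K w /\ set0 \notin C w,
       forall a b, a \in C w -> b \in K w -> a \subset b -> b = a & collapses (K w :\: C w) set0]) ->
    (forall w, w \in I -> [/\ down_closed (S w), set0 \in S w, S w \subset K w :\: C w &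
       forall a, a \in S w -> v w |: a \in S w]) ->
    (forall d, d \in wedge_complex I K S -> c \notin d) ->
  sphere_wedge (wedge_complex I K S) (\bigcup_(w in I) [set in_summand w (a : {set V}) | a in C w]) c.
Proof.
move=> hK hS hc.
have CP d : reflect (exists w a, [/\ w \in I, a \in C w & d = in_summand w a])
    (d \in \bigcup_(w in I) [set in_summand w (a : {set V}) | a in C w]).
  apply: (iffP bigcupP) => [[w Iw /imsetP[a Ca ->]]|[w [a [Iw Ca ->]]]]; first by exists w, a.
  by exists w; rewrite ?imset_f.
split=> //.
- split; last by apply/wedge_complexP; apply: WedgeEmpty.
  apply: wedge_down_closed => w Iw; have [dK _ _ _] := hK w Iw; have [dS _ sSN _] := hS w Iw.
  by split=> //; apply: subset_trans sSN (subsetDl _ _).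
- split.
    apply/subsetP => d /CP[w [a [Iw Ca ->]]]; apply/wedge_complexP.
    have [_ [/subsetP s _] _ _] := hK w Iw; exact: (WedgeFace Iw (s _ Ca) erefl).
  apply/CP => -[w [a [Iw Ca e]]]; have [_ [_ /negP C0] _ _] := hK w Iw; apply: C0.
  suff <- : a = set0 by [].
  by apply: (@summand_inj w); rewrite -e summand0.
- move=> d e /CP[w [a [Iw Ca ->]]] /wedge_complexP Me sub.
  have [dK [/subsetP sCK C0] fc _] := hK w Iw; have [dS S0 /subsetP sSN vS] := hS w Iw.
  have [x xa] : exists x, x \in a by apply/set0Pn; apply: contraNneq C0 => <-.
  case: Me sub => [->|->|w' b Iw' Kb ->|w' b Iw' Sb ->] sub.
  + by move: sub; rewrite subset0 (negbTE (summand_neq0 w xa)).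
  + by have := subsetP sub (Some (w, x)); rewrite mem_summand eqxx xa inE => /(_ isT).
  + have e' : w = w' by apply: (@summand_sub w w' x a b xa); apply: subset_trans sub (subsetUr _ _).
    by subst w'; rewrite summandS in sub; rewrite (fc a b).
  + have e' := summand_sub xa sub; subst w'; rewrite summandSN in sub.
    have /setDP[Kb nCb] := sSN _ Sb.
    by rewrite (fc a b) ?Ca in nCb.
- have -> : wedge_complex I K S :\: \bigcup_(w in I) [set in_summand w (a : {set V}) | a in C w]
      = wedge_complex I (fun w => K w :\: C w) S.
    apply/setP => d; apply/setDP/wedge_complexP => [[/wedge_complexP Md nC]|Md].
      case: Md nC => [->|->|w a Iw Ka ->|w a Iw Sa ->] nC.
      + exact: WedgeEmpty.
      + exact: WedgeBase.
      + apply: (WedgeFace Iw (_ : a \in K w :\: C w) erefl); rewrite in_setD Ka andbT.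
        by apply: contra nC => Ca; apply/CP; exists w, a.
      + exact: (WedgeCone Iw Sa erefl).
    split.
      apply/wedge_complexP; case: Md => [->|->|w a Iw /setDP[Ka _] ->|w a Iw Sa ->].
      + exact: WedgeEmpty.
      + exact: WedgeBase.
      + exact: (WedgeFace Iw Ka erefl).
      + exact: (WedgeCone Iw Sa erefl).
    apply/CP => -[w [a [Iw Ca ed]]]; have [_ [_ C0] _ _] := hK w Iw.
    have [x xa] : exists x, x \in a by apply/set0Pn; apply: contraNneq C0 => <-.
    case: Md => [e|e|w' b Iw' /setDP[Kb nCb] e|w' b Iw' Sb e]; rewrite ed in e.
    + by have := summand_neq0 w xa; rewrite e eqxx.
    + by have := None_summand w a; rewrite e inE.
    + have s : in_summand w a \subset None |: in_summand w' b by rewrite e subsetUr.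
      have ew := summand_sub xa s; subst w'; by rewrite -(summand_inj e) Ca in nCb.
    + by have := None_summand w a; rewrite e setU11.
  apply: (wedge_complex_collapse (v := v)) => [w Iw|w a Iw Sa].
    have [dK [_ C0] fc cl] := hK w Iw; have [dS S0 sSN vS] := hS w Iw; split=> //.
      move=> a b /setDP[Ka nCa] sba; rewrite in_setD (dK _ _ Ka sba) andbT.
      by apply: contra nCa => Cb; rewrite (fc b a Cb Ka sba).
    by apply: (subsetP sSN); have := vS _ S0; rewrite setU0.
  have [dS _ _ vS] := hS w Iw; split; first exact: vS.
  exact: dS Sa (subsetDl _ _).
Qed.

End WedgeComplex.

Arguments WedgeFace {W V I N S c w a}.
Arguments WedgeCone {W V I N S c w a}.

(** * Counting spheres on both sides *)

Section FamilyWedge.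
Local Open Scope group_scope.
Variables (gT : finGroupType) (p : nat).
Hypotheses (p_pr : prime p) (p_odd : odd p).
Implicit Types P X Y Z E F G : {group gT}.

Lemma Ohm1_noncyclic P Z : p.-group P -> ~~ cyclic P -> #|Z| = p -> 'Ohm_1(P) != Z.
Proof.
move=> pP ncP oZ.
have oddP : odd #|P| by have [n ->] := p_natP pP; rewrite oddX p_odd orbT.
rewrite (odd_pgroup_rank1_cyclic pP oddP) -ltnNge in ncP.
have /p_rank_geP[E /pnElemPcard[sEP abE oE]] := ncP.
have sEO : E \subset 'Ohm_1(P) by apply: abelem_sub_Ohm1 pP sEP abE.
apply: contraTneq (subset_leq_card sEO) => ->.
by rewrite oE oZ -ltnNge -{1}(expn1 p) ltn_exp2l ?prime_gt1.
Qed.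

Lemma exists_central_line P : p.-group P -> ~~ cyclic P -> exists2 Z : {group gT}, Z \subset 'Z(P) & #|Z| = p.
Proof.
move=> pP ncP.
have ntP : P :!=: 1 by apply: contraNneq ncP => ->; apply: cyclic1.
have ntZ : 'Z(P) != 1 by rewrite center_nil_eq1 ?(pgroup_nil pP).
have [_ pZ _] := pgroup_pdiv (pgroupS (center_sub P) pP) ntZ.
have [z Zz oz] := Cauchy p_pr pZ.
by exists <[z]>%G; rewrite ?cycle_subG.
Qed.

Lemma card_summand (W V : finType) (w : W) (a : {set V}) : #|in_summand w a| = #|a|.
Proof. by apply: card_imset => x y []. Qed.

(** The closed star of [s]; below, [s] is the face whose interior contains a base point. *)
Definition star_of P (s : {set {group gT}}) := [set a in ge2_flags p P | a :|: s \in ge2_flags p P].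

Lemma in_star P s a : (a \in star_of P s) = (a \in ge2_flags p P) && (a :|: s \in ge2_flags p P).
Proof. by rewrite [LHS]in_set. Qed.

(** By [es_family_self], a summand [X] has [p ^ (n ^ 2)] removed facets with [n] vertices if [X] is
    in [es_family p P Z n], and none otherwise; the sum over [X] is the number for [P]. The trivial
    group is never a vertex and supplies the spare vertices. *)
Lemma family_wedge P Z (I : {set {group gT}}) (s : {group gT} -> {set {group gT}}) :
    p.-group P -> ~~ cyclic P -> Z \subset 'Z(P) -> #|Z| = p ->
    (forall X, X \in I <-> exists n, X \in es_family p P Z n.+1) ->
    (forall X, X \in I -> s X \in ge2_flags p X /\ s X != set0) ->
  exists C1 C2, [/\ sphere_wedge (ge2_flags p P) C1 1%G,
    sphere_wedge (wedge_complex I (ge2_flags p) (fun X => star_of X (s X))) C2 (Some (1%G, 1%G)) &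
    forall n, #|[set a in C1 | #|a| == n]| = #|[set a in C2 | #|a| == n]|].
Proof.
move=> pP ncP sZ oZ IE sI.
have ge2_1 (Q : {group gT}) : 1%G \notin elem_abelian_ge2 p Q.
  by apply/ge2P => -[_ _]; rewrite cards1 leqNgt -{1}(expn0 p) ltn_exp2l ?prime_gt1.
have flag1N (Q : {group gT}) a : a \in ge2_flags p Q -> 1%G \notin a.
  by case/flagP=> /subsetP aQ _; apply: contra (ge2_1 Q) => /aQ.
have [E [nE EP oE]] := exists_normal_elab p_pr p_odd pP sZ oZ (Ohm1_noncyclic pP ncP oZ).
have [C1 [C1K C1mx C1c C1n _]] := ge2_spherical p_pr p_odd pP sZ oZ nE EP oE.
have hX X : exists vC : {group gT} * {set {set {group gT}}}, X \in I -> [/\ vC.1 \in s X,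
    vC.2 \subset ge2_flags p X /\ set0 \notin vC.2,
    forall c d, c \in vC.2 -> d \in ge2_flags p X -> c \subset d -> d = c,
    collapses (ge2_flags p X :\: vC.2) set0 &
    (forall n, #|[set c in vC.2 | #|c| == n]| = (p ^ (n ^ 2) * (X \in es_family p P Z n))%N) /\
    (forall c, c \in vC.2 -> vC.1 \notin c)].
  have [IX|] := boolP (X \in I); last by exists (1%G, set0).
  have [/flagP[/subsetP sXQ _] /set0Pn[v sv]] := sI X IX.
  have [m Xm] := (IE X).1 IX; have /es_familyP[XP ZX dX _ _] := Xm; have vX := sXQ v sv.
  have pX := pgroupS XP pP; have sZX : Z \subset 'Z(X) by rewrite ZX.
  have [F [nF FX oF sF]] := ge2_pencil p_pr sZX oZ dX vX.
  have [C [CK Cmx Cc Cn Cv]] := ge2_spherical p_pr p_odd pX sZX oZ nF FX oF.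
  exists (v, C) => _; split=> //=; split=> [n|c Cc']; last exact: Cv sF.
  by rewrite Cn (es_family_self p_pr pP oZ n Xm).
have {hX}[vC hvC] := fin_all_exists hX.
exists C1, (\bigcup_(X in I) [set in_summand X (a : {set {group gT}}) | a in (vC X).2]); split.
- split=> //; first by split; [exact: flag_down_closed | exact: flag0].
  exact: flag1N.
- apply: (@wedge_sphere _ _ _ _ _ _ (fun X => (vC X).1)) => [X IX|X IX|d].
  + by have [_ ? ? ? _] := hvC X IX; split=> //; apply: flag_down_closed.
  + have [sK s0] := sI X IX; have [vs _ Cmx _ [_ Cv]] := hvC X IX; split.
    * move=> a b; rewrite !in_star => /andP[Ka Kas] ba.
      by rewrite (flag_down_closed Ka ba) (flag_down_closed Kas (setSU _ ba)).
    * by rewrite in_star flag0 set0U.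
    (* By maximality, a removed facet in the star of [s X] would contain [s X]. But no removed facet
       contains the chosen member of [s X], since the pencil in [X] was taken inside its product
       with [Z]. *)
    * apply/subsetP => a; rewrite in_star => /andP[Ka Kas]; rewrite in_setD Ka andbT.
      apply/negP => Ca; have e := Cmx _ _ Ca Kas (subsetUl _ _).
      by have /negP[] := Cv _ Ca; rewrite -e in_setU vs orbT.
    * move=> a; rewrite !in_star => /andP[Ka Kas].
      have -> : ((vC X).1 |: a) :|: s X = a :|: s X.
        by rewrite -setUA [_ |: _]setUC -setUA; congr (_ :|: _); apply/setUidPl; rewrite sub1set.
      rewrite Kas andbT; apply: flag_down_closed Kas _.
      by rewrite subUset sub1set in_setU vs orbT subsetUl.
  + have nI : 1%G \notin I.
      apply/negP => /IE[n /(es_extraspecial p_pr pP oZ) es].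
      by have /negP[] := extraspecial_nonabelian es; apply: abelian1.
    case/wedge_complexP=> [->|->|X a IX _ ->|X a IX _ ->]; rewrite ?inE //.
      by rewrite mem_summand; apply: contra nI => /andP[/eqP->].
    by rewrite mem_summand; apply: contra nI => /andP[/eqP->].
move=> n; rewrite C1n -[RHS]/#|[set a in _ | _]|.
pose A := [set Xc : {group gT} * {set {group gT}} | [&& Xc.1 \in I, Xc.2 \in (vC Xc.1).2 & #|Xc.2| == n]].
have -> : [set a in \bigcup_(X in I) [set in_summand X (a : {set {group gT}}) | a in (vC X).2] | #|a| == n]
    = [set in_summand Xc.1 Xc.2 | Xc in A].
  apply/setP => a; rewrite in_set; apply/andP/imsetP => [[/bigcupP[X IX /imsetP[c Cc ->]]]|].
    by rewrite card_summand => cn; exists (X, c); rewrite // in_set /= IX Cc.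
  case=> -[X c]; rewrite in_set => /and3P[/= IX Cc cn] ->; rewrite card_summand; split=> //.
  by apply/bigcupP; exists X; rewrite ?imset_f.
rewrite card_in_imset => [|[X c] [Y d]]; last first.
  rewrite !in_set => /and3P[/= IX Cc _] /and3P[/= IY Cd _] /= e.
  have [_ [_ c0] _ _ _] := hvC X IX.
  have [x xc] : exists x, x \in c by apply/set0Pn; apply: contraNneq c0 => <-.
  have XY : X = Y by apply: (summand_sub (b := d) xc); rewrite e subsetUr.
  by rewrite XY in e *; rewrite (summand_inj e).
have -> : #|A| = (\sum_(X in I) \sum_(c in (vC X).2 | #|c| == n) 1)%N.
  by rewrite pair_big_dep -sum1_card; apply: eq_bigl => Xc; rewrite [LHS]in_set.
transitivity (\sum_(X in I) p ^ n ^ 2 * (X \in es_family p P Z n))%N; last first.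
  by apply: eq_bigr => X IX; rewrite sum1dep_card; have [_ _ _ _ [-> _]] := hvC X IX.
rewrite -big_distrr /= -big_mkcondr sum1_card; congr (_ * _)%N; clear A.
case: n => [|n].
  rewrite (es_family0_pencil pP sZ oZ nE EP) cards0; apply/esym/eq_card0 => X.
  by rewrite -topredE /= in_set0 andbF.
by apply: eq_card => X; rewrite -[RHS]topredE /= andb_idl // => Xn; apply/IE; exists n.
Qed.

End FamilyWedge.

From mathcomp Require Import all_classical all_reals topology normedtype homotopy.
From mathcomp Require Import lra.

Import Order.TTheory GRing.Theory Num.Theory.
Import numFieldNormedType.Exports.

Local Open Scope classical_set_scope.
Local Open Scope ring_scope.

(** * Realizations and homotopies *)

Section Homotopy.
Variable R : realType.
Implicit Types X Y Z : topologicalType.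

(** Here the parameter ranges over all of [R] and continuity holds everywhere, so that subspace
    topologies do not appear; [clamp] extends homotopies beyond the unit interval. *)
Definition deformable X Y (f g : X -> Y) :=
  exists H : R * X -> Y,
    [/\ continuous H, forall x, H (0, x) = f x & forall x, H (1, x) = g x].

Definition hequiv X Y := exists (f : X -> Y) (g : Y -> X),
  [/\ continuous f, continuous g, deformable (g \o f) id & deformable (f \o g) id].

Lemma continuous_pair (T X Y : topologicalType) (f : T -> X) (g : T -> Y) :
  continuous f -> continuous g -> continuous (fun t => (f t, g t)).
Proof. by move=> cf cg t; apply: cvg_pair; [apply: cf | apply: cg]. Qed.

Lemma continuous_fst X Y : continuous (@fst X Y). Proof. by move=> x; apply: cvg_fst. Qed.
Lemma continuous_snd X Y : continuous (@snd X Y). Proof. by move=> x; apply: cvg_snd. Qed.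

Lemma continuous_compose (T X Y : topologicalType) (f : T -> X) (g : X -> Y) :
  continuous f -> continuous g -> continuous (g \o f).
Proof. by move=> cf cg t; apply: continuous_comp; [apply: cf | apply: cg]. Qed.

Section RealValued.
Variable T : topologicalType.
Implicit Types f g : T -> R.

Lemma continuous_add f g : continuous f -> continuous g -> continuous (fun t => f t + g t).
Proof. by move=> cf cg t; apply: cvgD; [apply: cf | apply: cg]. Qed.

Lemma continuous_sub f g : continuous f -> continuous g -> continuous (fun t => f t - g t).
Proof. by move=> cf cg t; apply: cvgB; [apply: cf | apply: cg]. Qed.

Lemma continuous_mul f g : continuous f -> continuous g -> continuous (fun t => f t * g t).
Proof. by move=> cf cg t; apply: cvgM; [apply: cf | apply: cg]. Qed.

Lemma continuous_Max f g : continuous f -> continuous g -> continuous (fun t => Num.max (f t) (g t)).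
Proof. by move=> cf cg t; apply: continuous_max; [apply: cf | apply: cg]. Qed.

Lemma continuous_Min f g : continuous f -> continuous g -> continuous (fun t => Num.min (f t) (g t)).
Proof. by move=> cf cg t; apply: continuous_min; [apply: cf | apply: cg]. Qed.

Lemma continuous_sum (I : finType) (P : pred I) (F : I -> T -> R) :
  (forall i, P i -> continuous (F i)) -> continuous (fun t => \sum_(i | P i) F i t).
Proof.
move=> cF.
have cs s : continuous (fun t => \sum_(i <- s | P i) F i t).
  elim: s => [|i s IH].
    rewrite (_ : (fun t => _) = cst 0); first exact: cst_continuous.
    by apply: funext => t; rewrite big_nil.
  case Pi : (P i).
    rewrite (_ : (fun t => _) = (fun t => F i t + \sum_(j <- s | P j) F j t)).
      by apply: continuous_add => //; apply: cF.
    by apply: funext => t; rewrite big_cons Pi.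
  rewrite (_ : (fun t => _) = (fun t => \sum_(j <- s | P j) F j t)) //.
  by apply: funext => t; rewrite big_cons Pi.
exact: cs.
Qed.

End RealValued.

Lemma deformable_homotopic X Y (f g : X -> Y) : deformable f g -> homotopic R f g.
Proof. by case=> H [cH H0 H1]; exists H; split=> //; apply: continuous_subspaceT. Qed.

Lemma hequiv_homotopy_equivalent X Y : hequiv X Y -> homotopy_equivalent R X Y.
Proof.
by case=> f [g [cf cg h1 h2]]; exists f, g; split=> //; apply: deformable_homotopic.
Qed.

Lemma deformable_refl X Y (f : X -> Y) : continuous f -> deformable f f.
Proof.
move=> cf; exists (f \o snd); split=> //.
by apply: continuous_compose cf; apply: continuous_snd.
Qed.

Lemma deformable_sym X Y (f g : X -> Y) : deformable f g -> deformable g f.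
Proof.
case=> H [cH H0 H1]; exists (H \o (fun p => (1 - p.1, p.2))); split=> [|x|x] /=.
- apply: continuous_compose cH; apply: continuous_pair; last exact: continuous_snd.
  move=> p; apply: cvgB; [exact: cvg_cst | exact: cvg_fst].
- by rewrite subr0.
- by rewrite subrr.
Qed.

Lemma deformable_comp (X Y Z T : topologicalType) (f g : X -> Y) (h : Z -> X) (k : Y -> T) :
  continuous h -> continuous k -> deformable f g -> deformable (k \o f \o h) (k \o g \o h).
Proof.
move=> ch ck [H [cH H0 H1]]; exists (k \o H \o (fun p => (p.1, h p.2))).
split=> [|x|x] /=; last 2 first.
- by rewrite H0.
- by rewrite H1.
apply: (continuous_compose _ (continuous_compose cH ck)); apply: continuous_pair.
  exact: continuous_fst.
exact: continuous_compose (@continuous_snd _ _) ch.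
Qed.

Lemma deformable_trans X Y (f g h : X -> Y) :
  deformable f g -> deformable g h -> deformable f h.
Proof.
case=> H [cH H0 H1] [K [cK K0 K1]].
pose A := [set p : R * X | p.1 <= 1/2]; pose B := [set p : R * X | 1/2 <= p.1].
pose L (p : R * X) := if p.1 <= 1/2 then H (2 * p.1, p.2) else K (2 * p.1 - 1, p.2).
have cfst : continuous (fun p : R * X => p.1) by exact: continuous_fst.
exists L; split=> [|x|x]; last 2 first.
- by rewrite /L /= ifT ?mulr0 //; lra.
- rewrite /L /= ifF; last by apply/negP; lra.
  by rewrite (_ : 2 * 1 - 1 = 1) ?K1 //; lra.
have cfst' : continuous (fun p : R * X => 2 * p.1).
  by move=> p; apply: cvgM; [exact: cvg_cst | exact: cvg_fst].
have cA : closed A by apply: (continuous_closedP _).1 (@closed_le _ (1/2)); exact: cfst.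
have cB : closed B by apply: (continuous_closedP _).1 (@closed_ge _ (1/2)); exact: cfst.
have cL1 : continuous (fun p : R * X => H (2 * p.1, p.2)).
  apply: continuous_compose cH; apply: continuous_pair => //; exact: continuous_snd.
have cL2 : continuous (fun p : R * X => K (2 * p.1 - 1, p.2)).
  apply: continuous_compose cK; apply: continuous_pair; last exact: continuous_snd.
  by move=> p; apply: cvgB; [exact: cfst' | exact: cvg_cst].
apply/continuous_subspace_setT.
have -> : [set: R * X] = A `|` B.
  apply/esym; rewrite -subTset => p _; rewrite /A /B /=.
  by case: (lerP p.1 (1/2)) => [lep|/ltW gep]; [left | right].
apply: withinU_continuous => //.
- apply: (@subspace_eq_continuous _ _ _ (fun p : R * X => H (2 * p.1, p.2))).
    move=> p /set_mem; rewrite /A /= => lep.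
    by change (H (2 * p.1, p.2) = L p); rewrite /L lep.
  exact: continuous_subspaceT.
- apply: (@subspace_eq_continuous _ _ _ (fun p : R * X => K (2 * p.1 - 1, p.2))).
    move=> p /set_mem; rewrite /B /= => gep.
    change (K (2 * p.1 - 1, p.2) = L p); rewrite /L; case: ifP => // lep.
    have -> : p.1 = 1/2 by apply/eqP; rewrite eq_le lep gep.
    by rewrite (_ : 2 * (1/2) = 1) ?subrr ?H1 ?K0 //; lra.
  exact: continuous_subspaceT.
Qed.

Lemma hequiv_refl X : hequiv X X.
Proof.
have cid : continuous (@idfun X) by move=> x.
by exists id, id; split => //; apply: deformable_refl.
Qed.

Lemma hequiv_sym X Y : hequiv X Y -> hequiv Y X.
Proof. by case=> f [g [cf cg h1 h2]]; exists g, f. Qed.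

Lemma hequiv_trans X Y Z : hequiv X Y -> hequiv Y Z -> hequiv X Z.
Proof.
case=> f [g [cf cg fg gf]] [h [k [ch ck hk kh]]]; exists (h \o f), (g \o k); split.
- exact: continuous_compose cf ch.
- exact: continuous_compose ck cg.
- exact: deformable_trans (deformable_comp cf cg hk) fg.
- exact: deformable_trans (deformable_comp ck ch gf) kh.
Qed.

End Homotopy.

Section Realization.
Variables (R : realType) (V : finType).
Implicit Types (K L : {set {set V}}) (a b : {set V}).

Definition coord K (w : realization R K) (v : V) : R := (set_val w : {ptws V -> R}) v.
Definition support K (w : realization R K) : {set V} := [set v | coord w v != 0]%SET.

Lemma coord_ge0 K (w : realization R K) v : 0 <= coord w v.
Proof. have [h _ _] := set_valP w; exact: h. Qed.

Lemma coord_sum K (w : realization R K) : \sum_v coord w v = 1.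
Proof. have [_ h _] := set_valP w; exact: h. Qed.

Lemma support_face K (w : realization R K) : support w \in K.
Proof. have [_ _ h] := set_valP w; exact: h. Qed.

Lemma coord_supp K (w : realization R K) v : (v \in support w) = (coord w v != 0).
Proof. by rewrite !finset.inE. Qed.

Lemma coord_out K (w : realization R K) v : v \notin support w -> coord w v = 0.
Proof. by rewrite coord_supp negbK => /eqP. Qed.

Lemma coord_le1 K (w : realization R K) v : coord w v <= 1.
Proof.
rewrite -(coord_sum w) (bigD1 v) //= lerDl sumr_ge0 // => u _; exact: coord_ge0.
Qed.

Lemma support_neq0 K (w : realization R K) : support w != finset.set0.
Proof.
apply/eqP => s0; have := coord_sum w; rewrite big1 => [/eqP|v _].
  by rewrite eq_sym oner_eq0.
by apply: coord_out; rewrite s0 finset.inE.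
Qed.

Lemma coord_inj K (w w' : realization R K) : coord w =1 coord w' -> w = w'.
Proof. by move=> e; apply: val_inj; apply: funext. Qed.

Definition point_of K (F : V -> R) (h : geometric_realization R K F) : realization R K :=
  SigSub (mem_set h).

Lemma point_ofE K F (h : geometric_realization R K F) v : coord (point_of h) v = F v.
Proof. by []. Qed.

Lemma continuous_coord K v : continuous (fun w : realization R K => coord w v).
Proof.
move=> w; apply: (@continuous_comp _ {ptws V -> R} R set_val (fun f => f v)).
  exact: initial_continuous.
exact: proj_continuous.
Qed.

Lemma continuous_realization (T : topologicalType) K (f : T -> realization R K) :
  (forall v, continuous (fun t => coord (f t) v)) -> continuous f.
Proof.
move=> cf; apply/continuousP => _ [B oB <-].
rewrite -comp_preimage; move: B oB; apply/continuousP => t.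
apply/cvg_sup => v U [_ [[W oW <-] Wf WU]].
apply: (filterS WU); rewrite nbhs_simpl /=.
by apply: (cf v t); rewrite /= nbhsE; exists W.
Qed.

Definition clamp (t : R) : R := Num.max 0 (Num.min 1 t).

Lemma clamp_bounds t : 0 <= clamp t <= 1.
Proof. by rewrite /clamp; apply/andP; split; rewrite ?le_max ?lexx // ge_max ler01 ge_min lexx. Qed.

Lemma clamp0 : clamp 0 = 0. Proof. by rewrite /clamp (min_idPr _) ?ler01 // maxxx. Qed.
Lemma clamp1 : clamp 1 = 1. Proof. by rewrite /clamp minxx (max_idPr _) ?ler01. Qed.

Lemma continuous_clamp : continuous clamp.
Proof.
move=> t; apply: continuous_max; first exact: cvg_cst.
apply: continuous_min; [exact: cvg_cst | exact: cvg_id].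
Qed.

(** For each [x] the two values lie in a common closed simplex of [K], and the segment between them
    stays there. *)
Lemma straight_line (X : topologicalType) K (f g : X -> realization R K) :
    down_closed K -> continuous f -> continuous g ->
    (forall x, support (f x) :|: support (g x) \in K)%SET -> deformable R f g.
Proof.
move=> dK cf cg fgK.
pose F (p : R * X) v := (1 - clamp p.1) * coord (f p.2) v + clamp p.1 * coord (g p.2) v.
have hF p : geometric_realization R K (F p).
  have /andP[c0 c1] := clamp_bounds p.1; split=> [v||].
  - by rewrite addr_ge0 // mulr_ge0 ?coord_ge0 // subr_ge0.
  - by rewrite big_split /= -!mulr_sumr !coord_sum !mulr1 subrK.
  apply: dK (fgK p.2) _; apply/fintype.subsetP => v; rewrite finset.in_setU.
  apply: contraTT; rewrite negb_or => /andP[/coord_out fv /coord_out gv].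
  by rewrite finset.in_set negbK /F fv gv !mulr0 addr0.
exists (fun p => point_of (hF p)); split=> [|x|x].
- apply: continuous_realization => v; under eq_fun do rewrite point_ofE /F.
  have cc : continuous (fun p : R * X => clamp p.1).
    exact: continuous_compose (@continuous_fst _ _) continuous_clamp.
  have cF (h : X -> realization R K) : continuous h -> continuous (fun p : R * X => coord (h p.2) v).
    move=> ch; apply: continuous_compose (@continuous_coord K v).
    exact: continuous_compose (@continuous_snd _ _) ch.
  move=> p; apply: cvgD; apply: cvgM; try exact: cF; try exact: cc.
  by apply: cvgB; [exact: cvg_cst | exact: cc].
- by apply: coord_inj => v; rewrite point_ofE /F /= clamp0 subr0 mul1r mul0r addr0.
- by apply: coord_inj => v; rewrite point_ofE /F /= clamp1 subrr mul1r mul0r add0r.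
Qed.

End Realization.

Section Minimum.
Variables (R : realType) (V : finType).
Implicit Types (K L : {set {set V}}) (a b : {set V}).

(** Positive exactly when the support contains [a]. The initial value 1 does not affect a nonempty
    minimum, as coordinates are at most 1. *)
Definition mincoord K a (w : realization R K) : R := \big[Num.min/1]_(v in a) coord w v.

Lemma mincoord_ge0 K a (w : realization R K) : 0 <= mincoord a w.
Proof.
by apply: (big_ind (fun x => 0 <= x)) => [|x y x0 y0|v _]; rewrite ?ler01 ?coord_ge0 // le_min x0.
Qed.

Lemma mincoord_le K a (w : realization R K) v : v \in a -> mincoord a w <= coord w v.
Proof. by move=> va; rewrite /mincoord (bigD1 v) //= ge_min lexx. Qed.

Lemma mincoord_attained K a (w : realization R K) : a != finset.set0 ->
  exists2 v, v \in a & mincoord a w = coord w v.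
Proof.
case/set0Pn=> u ua; case: (@arg_minP _ _ _ u (mem a) (coord w) ua) => v va minv.
exists v => //; apply/eqP; rewrite eq_le mincoord_le //=.
apply: (big_ind (fun x => coord w v <= x)); first exact: coord_le1.
  by move=> x y hx hy; rewrite le_min hx.
by move=> t /minv.
Qed.

Lemma mincoord_gt0 K a (w : realization R K) :
  reflect (forall v, v \in a -> v \in support w) (0 < mincoord a w).
Proof.
apply: (iffP idP) => [h v va|h].
  by rewrite coord_supp gt_eqF // (lt_le_trans h) // mincoord_le.
apply: (big_ind (fun x => 0 < x)) => [|x y x0 y0|v /h]; rewrite ?ltr01 ?lt_min ?x0 //.
by rewrite coord_supp lt_neqAle coord_ge0 eq_sym andbT.
Qed.

Lemma continuous_mincoord K a : continuous (@mincoord K a).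
Proof.
have cs s : continuous (fun w : realization R K => \big[Num.min/1]_(v <- s | v \in a) coord w v).
  elim: s => [|v s IH].
    rewrite (_ : (fun w => _) = cst 1); first exact: cst_continuous.
    by apply: funext => w; rewrite big_nil.
  case va : (v \in a).
    rewrite (_ : (fun w => _) = (fun w => coord w v) \min
        (fun w => \big[Num.min/1]_(u <- s | u \in a) coord w u)).
      by move=> w; apply: continuous_min; [apply: continuous_coord | apply: IH].
    by apply: funext => w; rewrite big_cons va.
  rewrite (_ : (fun w => _) = (fun w => \big[Num.min/1]_(u <- s | u \in a) coord w u)) //.
  by apply: funext => w; rewrite big_cons va.
exact: cs.
Qed.

End Minimum.

Section Collapse.
Variables (R : realType) (V : finType).
Implicit Types (K L : {set {set V}}) (a b : {set V}).

(** No point has empty support; the empty face, kept in the families for the sake of collapses, is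
    invisible here. *)
Lemma realization_set0 K : realization R (K :\ finset.set0)%SET = realization R K.
Proof.
congr (set_type _ : topologicalType); apply: funext => w; apply: propext.
split=> -[w0 w1 Kw]; split=> //; first by move: Kw; rewrite finset.in_setD1 => /andP[].
rewrite finset.in_setD1 Kw andbT; apply/eqP => s0.
have := oner_eq0 R; rewrite -w1 big1 ?eqxx // => v _; apply/eqP.
by have := finset.in_set0 v; rewrite -s0 finset.in_set => /negbFE.
Qed.

(** The retraction takes the least coordinate from every vertex of [a] and gives the total to [x],
    so that some vertex of [a] drops to 0. Points of the smaller complex have least coordinate 0 on
    [a] and do not move; the others move inside the simplex [x |: a]. *)
Lemma elementary_collapse K a x : down_closed K -> a \in K -> x \notin a ->
    (x |: a)%SET \in K -> a != finset.set0 ->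
    (forall b, b \in K -> (a \subset b)%SET -> b = a \/ b = (x |: a)%SET) ->
  hequiv R (realization R K) (realization R (K :\ a :\ (x |: a))%SET).
Proof.
move=> dK Ka xa Kxa a0 fr; set L := (K :\ a :\ (x |: a))%SET.
have LK b : b \in L -> b \in K by rewrite !finset.in_setD1 => /and3P[].
have nL b : b \in L -> ~~ (a \subset b)%SET.
  rewrite !finset.in_setD1 => /and3P[b2 b1 Kb]; apply/negP => /(fr _ Kb)[] e.
    by rewrite e eqxx in b1.
  by rewrite e eqxx in b2.
have hi (w : realization R L) : geometric_realization R K (coord w).
  by split; [exact: coord_ge0 | exact: coord_sum | exact/LK/support_face].
pose m (w : realization R K) := mincoord a w.
pose F (w : realization R K) v : R := coord w v - m w * (v \in a)%:R + m w * #|a|%:R * (v == x)%:R.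
have F_ge0 w v : 0 <= F w v.
  have m0 : 0 <= m w := mincoord_ge0 a w.
  rewrite /F addr_ge0 ?mulr_ge0 ?ler0n // subr_ge0.
  by case: (boolP (v \in a)) => va; rewrite ?mulr1 ?mulr0 ?coord_ge0 ?mincoord_le.
have F_m0 w v : m w = 0 -> F w v = coord w v.
  by move=> e; rewrite /F e !mul0r subr0 addr0.
have sw w : m w != 0 -> support w = a \/ support w = (x |: a)%SET.
  move=> nz; have /mincoord_gt0 h : 0 < m w by rewrite lt_neqAle eq_sym nz mincoord_ge0.
  by apply: fr; [apply: support_face | apply/fintype.subsetP => v; apply: h].
have Fsup w : m w != 0 -> ([set v | F w v != 0] \subset x |: a)%SET.
  move=> /sw h; apply/fintype.subsetP => v; rewrite finset.in_set; apply: contraNT.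
  rewrite finset.in_setU1 negb_or => /andP[vx va].
  rewrite /F (negbTE vx) (negbTE va) !mulr0 subr0 addr0; apply/eqP/coord_out.
  by case: h => ->; rewrite ?finset.in_setU1 ?negb_or ?vx.
have hF w : geometric_realization R L (F w).
  split=> [v||]; first exact: F_ge0.
  - rewrite /F big_split sumrB /= coord_sum -!mulr_sumr -natr_sum.
    rewrite (_ : (\sum_i (i \in a))%N = #|a|); last first.
      by rewrite -sum1_card [RHS]big_mkcond; apply: eq_bigr => v _; case: (v \in a).
    rewrite [X in _ + _ * X](_ : _ = 1) ?mulr1 ?subrK //.
    rewrite (bigD1 x) //= eqxx big1 ?addr0 // => v /negbTE -> //.
  have [e|nz] := eqVneq (m w) 0.
    suff -> : [set v | F w v != 0]%SET = support w.
      have Kw := support_face w; rewrite !finset.in_setD1 Kw andbT.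
      have h b : (a \subset b)%SET -> support w != b.
        move=> sab; apply/eqP => eb; have : 0 < m w.
          by apply/mincoord_gt0 => v va; rewrite eb (fintype.subsetP sab).
        by rewrite e ltxx.
      by rewrite !h ?fintype.subxx ?finset.subsetUr.
    by apply/setP => v; rewrite finset.in_set F_m0 // -coord_supp.
  have [v va mv] := mincoord_attained w a0.
  have Fv : v \notin [set v | F w v != 0]%SET.
    rewrite finset.in_set negbK /F va mulr1 -/(m w) /m mv subrr add0r.
    suff -> : (v == x) = false by rewrite mulr0.
    by apply: contraNF xa => /eqP <-.
  rewrite !finset.in_setD1 (dK _ _ Kxa (Fsup w nz)) andbT.
  by apply/andP; split; apply: contraNneq Fv => ->; rewrite ?finset.in_setU1 va ?orbT.
pose r w : realization R L := point_of (hF w).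
pose i w : realization R K := point_of (hi w).
have ci : continuous i.
  by apply: continuous_realization => v; apply: continuous_coord.
have cr : continuous r.
  apply: continuous_realization => v; under eq_fun do rewrite point_ofE /F.
  have cm := @continuous_mincoord R V K a.
  apply: continuous_add; last first.
    by do 2![apply: continuous_mul; last exact: cst_continuous].
  apply: continuous_sub; first exact: continuous_coord.
  by apply: continuous_mul; last exact: cst_continuous.
exists r, i; split=> //.
- apply: straight_line => //; first exact: continuous_compose cr ci.
    by move=> w; apply: cvg_id.
  move=> w; change (support (i (r w)) :|: support w \in K)%SET.
  have [e|nz] := eqVneq (m w) 0.
    suff -> : support (i (r w)) = support w by rewrite finset.setUid support_face.
    by apply/setP => v; rewrite !coord_supp !point_ofE F_m0.
  apply: dK Kxa _; rewrite finset.subUset; apply/andP; split.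
    apply: fintype.subset_trans (Fsup w nz); apply/fintype.subsetP => v.
    by rewrite !coord_supp.
  by case: (sw w nz) => ->; rewrite ?finset.subsetUr.
- suff -> : r \o i = id by apply: deformable_refl => w.
  apply: funext => w; apply: coord_inj => v /=; rewrite point_ofE F_m0 //.
  have es : support (i w) = support w by apply/setP => u; rewrite !coord_supp.
  apply/eqP/negPn/negP => /sw; rewrite es => e.
  by case: e (nL _ (support_face w)) => ->; rewrite ?finset.subsetUr ?fintype.subxx.
Qed.

Lemma collapses_hequiv K L : collapses K L -> down_closed K -> finset.set0 \in L ->
  hequiv R (realization R K) (realization R L).
Proof.
elim=> [K1|K1 L1 a x Ka xa Kxa fr KL IH] dK L0; first exact: hequiv_refl.
(* Because the empty face survives in [L1], no step uses the empty free face, which has no geometric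
   counterpart. *)
have a0 : a != finset.set0.
  apply: contraTneq (fintype.subsetP (collapses_sub KL) _ L0) => ->.
  by rewrite !finset.in_setD1 eqxx andbF.
apply: hequiv_trans (elementary_collapse dK Ka xa Kxa a0 fr) (IH _ L0).
exact: down_closed_step.
Qed.

End Collapse.

(** * Bouquets of spheres *)

Section Profile.
Variable R : realType.
Implicit Types k n u x a : R.

(* The coordinate at time k in [1, 2] of a point of a cell with n vertices, where x
   is its coordinate at time 1 and u is the least of its coordinates at time 1.  The
   cell is dilated by the factor k about its barycenter; the points that leave it
   lose mass (to the cone point), so that at k = 2 the boundary u = 0 has none. *)
Definition profile k n u x : R :=
  Num.max 0 (1 - k + k * (n * u)) / n + k * Num.min 1 (Num.max 0 (2 - k * (1 - n * u))) * (x - u).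

Definition profile_mass k a : R :=
  Num.max 0 (1 - k + k * a) + k * Num.min 1 (Num.max 0 (2 - k * (1 - a))) * (1 - a).

(** On the boundary of a cell the factor [k * (2 - k)] does not involve the cell, so the motions of
    different cells fit together along common faces. *)
Lemma profile_u0 k n x : 1 <= k <= 2 -> profile k n 0 x = k * (2 - k) * x.
Proof.
move=> /andP[k1 k2]; rewrite /profile mulr0 !subr0 mulr0 addr0 mulr1.
have -> : Num.max 0 (1 - k) = 0 by apply: max_idPl; lra.
have -> : Num.max 0 (2 - k) = 2 - k by apply: max_idPr; lra.
have -> : Num.min 1 (2 - k) = 2 - k by apply: min_idPr; lra.
by rewrite mul0r add0r.
Qed.

Lemma profile_k1 n u x : 0 < n -> 0 <= u -> profile 1 n u x = x.
Proof.
move=> n0 u0; have nu0 : 0 <= n * u by rewrite mulr_ge0 // ltW.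
rewrite /profile !mul1r subrr add0r.
have -> : Num.max 0 (n * u) = n * u by apply: max_idPr.
have -> : Num.max 0 (2 - (1 - n * u)) = 1 + n * u.
  by rewrite (max_idPr _); lra.
have -> : Num.min 1 (1 + n * u) = 1 by apply: min_idPl; lra.
by rewrite mul1r mulrAC divff ?mul1r ?gt_eqF // addrC subrK.
Qed.

Lemma profile_ge0 k n u x : 0 <= k -> 0 < n -> u <= x -> 0 <= profile k n u x.
Proof.
move=> k0 n0 ux; rewrite addr_ge0 //.
  by apply: divr_ge0; [rewrite le_max lexx | exact: ltW].
by rewrite !mulr_ge0 ?subr_ge0 // le_min ler01 le_max lexx.
Qed.

(** The hypothesis says that the least coordinate of the dilated point, which is
    [(1 - k + k * a) / n], is still nonnegative; the dilation itself preserves the sum of the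
    coordinates. *)
Lemma profile_mass_inner k a : 1 <= k -> 0 <= 1 - k + k * a -> profile_mass k a = 1.
Proof.
move=> k1 h; rewrite /profile_mass (max_idPr h).
have -> : Num.max 0 (2 - k * (1 - a)) = 2 - k * (1 - a) by apply: max_idPr; lra.
have -> : Num.min 1 (2 - k * (1 - a)) = 1 by apply: min_idPl; lra.
by rewrite mulr1 mulrBr mulr1; lra.
Qed.

(** With [y = k * (1 - a)] the mass is [y * (2 - y) = 1 - (y - 1) ^ 2] as long as [y < 2], and 0
    afterwards. *)
Lemma profile_mass_outer k a : 1 <= k -> a <= 1 -> 1 - k + k * a < 0 -> profile_mass k a <= 1.
Proof.
move=> k1 a1 h; rewrite /profile_mass (max_idPl (ltW h)) add0r.
set y := k * (1 - a); have ey : y = k - k * a by rewrite /y mulrBr mulr1.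
have [y2|y2] := leP 2 y.
  have -> : Num.max 0 (2 - y) = 0 by apply: max_idPl; lra.
  have -> : Num.min 1 0 = 0 :> R by apply: min_idPr; rewrite ler01.
  by rewrite mulr0 mul0r ler01.
have -> : Num.max 0 (2 - y) = 2 - y by apply: max_idPr; lra.
have -> : Num.min 1 (2 - y) = 2 - y by apply: min_idPr; lra.
rewrite mulrAC -/y; have := sqr_ge0 (y - 1); rewrite expr2; lra.
Qed.

Lemma profile_uu k n u : 1 - k + k * (n * u) < 0 -> profile k n u u = 0.
Proof. by move=> h; rewrite /profile (max_idPl (ltW h)) subrr mulr0 mul0r addr0. Qed.

Lemma sum_profile (V : finType) (A : {set V}) (x : V -> R) k u : A != finset.set0 ->
  \sum_(v in A) x v = 1 ->
  \sum_(v in A) profile k #|A|%:R u (x v) = profile_mass k (#|A|%:R * u).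
Proof.
move=> A0 x1; rewrite /profile big_split /= sumr_const -mulr_sumr sumrB x1 sumr_const.
have n0 : #|A|%:R != 0 :> R by rewrite pnatr_eq0 cards_eq0.
by rewrite -[_ *+ #|A|]mulr_natr divfK // -[u *+ _]mulr_natl.
Qed.

Lemma continuous_profile (T : topologicalType) (k u x : T -> R) n :
  continuous k -> continuous u -> continuous x ->
  continuous (fun t => profile (k t) n (u t) (x t)).
Proof.
move=> ck cu cx; have cc (c : R) := @cst_continuous T R c.
have cnu : continuous (fun t => n * u t) by apply: continuous_mul.
apply: continuous_add.
  apply: continuous_mul => //; apply: continuous_Max => //.
  by apply: continuous_add; [apply: continuous_sub | apply: continuous_mul].
apply: continuous_mul; last exact: continuous_sub.
apply: continuous_mul => //; apply: continuous_Min => //; apply: continuous_Max => //.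
by apply: continuous_sub => //; apply: continuous_mul => //; apply: continuous_sub.
Qed.

End Profile.

Section Bouquet.
Variables (R : realType) (J : finType).

(* G is the union of the cells and of the cone with apex c over the faces that are
   not cells. *)
Definition bouquet (V : finType) (G : {set {set V}}) (c : V) (cell : J -> {set V}) :=
  [/\ down_closed G,
      forall a, a \in G -> (forall j, a != cell j) -> (c |: a)%SET \in G,
      forall j a, a \in G -> (cell j \subset a)%SET -> a = cell j,
      forall j, [/\ cell j \in G, c \notin cell j & cell j != finset.set0] &
      injective cell].

(* The mass missing from g is put on c. *)
Definition complete (V : finType) (c : V) (g : V -> R) (v : V) : R :=
  if v == c then 1 - \sum_(u | u != c) g u else g v.

Lemma sum_complete (V : finType) (c : V) (g : V -> R) : \sum_v complete c g v = 1.
Proof.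
rewrite (bigD1 c) //= {1}/complete eqxx [X in _ + X](eq_bigr g) ?subrK // => v.
by rewrite /complete => /negbTE ->.
Qed.

Lemma complete_sum (V : finType) (c : V) (g : V -> R) : \sum_v g v = 1 -> complete c g =1 g.
Proof.
move=> g1 v; rewrite /complete; case: eqVneq => // ->.
by rewrite -g1 (bigD1 c) //= addrK.
Qed.

Section Points.
Variables (V : finType) (G : {set {set V}}) (c : V) (cell : J -> {set V}).
Hypothesis hG : bouquet G c cell.

Lemma cone_point a (g : V -> R) : a \in G -> (forall j, a != cell j) ->
    (forall v, 0 <= g v) -> (forall v, v != c -> v \notin a -> g v = 0) ->
    \sum_(v | v != c) g v <= 1 ->
  geometric_realization R G (complete c g).
Proof.
have [dG cone _ _ _] := hG; move=> Ga na g0 ga g1; split=> [v||].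
- by rewrite /complete; case: ifP => _; rewrite ?g0 // subr_ge0.
- exact: sum_complete.
apply: dG (cone a Ga na) _; apply/fintype.subsetP => v; rewrite finset.in_set.
apply: contraNT; rewrite finset.in_setU1 negb_or /complete => /andP[vc va].
by rewrite (negbTE vc) ga.
Qed.

(** If the dilated point is still in the cell, nothing is left for [c]. Otherwise the vertex with
    the least coordinate has dropped to 0, so the support apart from [c] lies in a proper face of
    the cell, which may be joined with [c]. *)
Lemma profile_point j (x : V -> R) (u k : R) (g : V -> R) : 1 <= k <= 2 ->
    0 <= u -> (forall v, v \in cell j -> u <= x v) -> \sum_(v in cell j) x v = 1 ->
    (exists2 v, v \in cell j & x v = u) ->
    (forall v, v != c -> g v = if v \in cell j then profile k #|cell j|%:R u (x v) else 0) ->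
  geometric_realization R G (complete c g).
Proof.
have [dG cone mx hc inj] := hG; have [Gj cj j0] := hc j.
move=> /andP[k1 k2] u0 ux x1 [v0 jv0 xv0] gE.
pose n : R := #|cell j|%:R; have n0 : 0 < n by rewrite ltr0n card_gt0.
pose h v := if v \in cell j then profile k n u (x v) else 0.
have gh v : complete c g v = complete c h v.
  rewrite /complete; case: ifPn => [_|vc]; last exact: gE.
  by congr (1 - _); apply: eq_bigr => w wc; apply: gE.
rewrite (_ : complete c g = complete c h); last exact: funext.
have sh : \sum_v h v = profile_mass k (n * u).
  by rewrite -(@sum_profile _ _ (cell j) x k u j0 x1) /h -big_mkcond.
have h0 v : 0 <= h v.
  by rewrite /h; case: ifPn => // jv; apply: profile_ge0; [lra | | exact: ux].
have shc : \sum_(v | v != c) h v = profile_mass k (n * u).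
  have hc0 : h c = 0 by rewrite /h (negbTE cj).
  by rewrite -sh [RHS](bigD1 c) //= hc0 add0r.
have nu1 : n * u <= 1.
  rewrite -x1 /n mulr_natl -sumr_const; apply: ler_sum => v; exact: ux.
have [inner|outer] := leP 0 (1 - k + k * (n * u)).
  have hE : complete c h =1 h by apply: complete_sum; rewrite sh profile_mass_inner.
  split=> [v||]; [by rewrite hE | exact: sum_complete |].
  apply: dG Gj _; apply/fintype.subsetP => v; rewrite finset.in_set hE /h.
  by case: ifP => //; rewrite eqxx.
apply: (@cone_point (cell j :\ v0)%SET) => //.
- exact: dG Gj (finset.subD1set _ _).
- move=> i; apply/eqP => e; have s : (cell i \subset cell j)%SET by rewrite -e finset.subD1set.
  by move: jv0; rewrite (mx i _ Gj s) -e finset.in_setD1 eqxx.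
- move=> v vc; rewrite finset.in_setD1 negb_and negbK /h => /orP[/eqP ->|/negbTE -> //].
  by rewrite jv0 xv0 profile_uu.
- by rewrite shc profile_mass_outer.
Qed.

Lemma min_support j (w : realization R G) : 0 < mincoord (cell j) w -> support w = cell j.
Proof.
have [_ _ mx _ _] := hG; move/mincoord_gt0 => h; apply: mx (support_face w) _.
by apply/fintype.subsetP => v; apply: h.
Qed.

Lemma min_eq0 j (w : realization R G) : support w != cell j -> mincoord (cell j) w = 0.
Proof.
move=> nj; apply/eqP; rewrite eq_le mincoord_ge0 andbT leNgt.
by apply: contra nj => /min_support ->.
Qed.

Lemma sum_support j (w : realization R G) : support w = cell j ->
  \sum_(v in cell j) coord w v = 1.
Proof.
move=> e; rewrite -(coord_sum w) big_mkcond /=; apply: eq_bigr => v _.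
by case: ifPn => //; rewrite -e => /coord_out ->.
Qed.

(** One formula for all points makes continuity immediate. For [k] between 1 and 2 the summand of
    [j] vanishes unless the support is [cell j]; in that case it replaces the uniform scaling by
    [profile]. *)
Definition flow (k : R) (w : realization R G) (v : V) : R :=
  k * (2 - k) * coord w v + \sum_(j | v \in cell j)
    (profile k #|cell j|%:R (mincoord (cell j) w) (coord w v) - k * (2 - k) * coord w v).

Lemma flow_cell k j (w : realization R G) v : 1 <= k <= 2 -> support w = cell j ->
  flow k w v = if v \in cell j then profile k #|cell j|%:R (mincoord (cell j) w) (coord w v) else 0.
Proof.
have [_ _ _ _ inj] := hG; move=> k12 e; rewrite /flow.
have z i : i != j -> profile k #|cell i|%:R (mincoord (cell i) w) (coord w v) - k * (2 - k) * coord w v = 0.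
  by move=> ij; rewrite min_eq0 ?profile_u0 ?subrr // e (inj_eq inj) eq_sym.
case: ifPn => jv.
  by rewrite (bigD1 j) //= big1 => [|i /andP[_ /z] //]; rewrite addr0 addrC subrK.
rewrite coord_out ?e // mulr0 add0r big1 // => i iv.
rewrite min_eq0 ?profile_u0 ?mulr0 ?subrr // e (inj_eq inj) eq_sym.
by apply: contraNneq jv => <-.
Qed.

Lemma flow_nocell k (w : realization R G) v : 1 <= k <= 2 -> (forall j, support w != cell j) ->
  flow k w v = k * (2 - k) * coord w v.
Proof.
move=> k12 nj; rewrite /flow big1 ?addr0 // => j _.
by rewrite min_eq0 // profile_u0 // subrr.
Qed.

Lemma flow_point k (w : realization R G) : 1 <= k <= 2 ->
  geometric_realization R G (complete c (flow k w)).
Proof.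
move=> k12; have [j /eqP e|nj] := pickP (fun j => support w == cell j).
  apply: (@profile_point j (coord w) (mincoord (cell j) w) k) => //.
  - exact: mincoord_ge0.
  - by move=> v; apply: mincoord_le.
  - exact: sum_support.
  - have [_ _ _ hc _] := hG; have [_ _ j0] := hc j.
    by have [v jv ->] := mincoord_attained w j0; exists v.
  - by move=> v _; apply: flow_cell.
have {}nj j : support w != cell j by rewrite nj.
have /andP[k1 k2] := k12; have q0 : 0 <= k * (2 - k) by rewrite mulr_ge0 //; lra.
have q1 : k * (2 - k) <= 1.
  by have := sqr_ge0 (k - 1); rewrite expr2; lra.
apply: (@cone_point (support w)) => //; first exact: support_face.
- by move=> v; rewrite flow_nocell // mulr_ge0 ?coord_ge0.
- by move=> v _ /coord_out wv; rewrite flow_nocell // wv mulr0.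
- rewrite (eq_bigr (fun v => k * (2 - k) * coord w v)) => [|v _]; last exact: flow_nocell.
  rewrite -mulr_sumr (le_trans _ q1) // ler_piMr // -(coord_sum w) [leRHS](bigD1 c) //=.
  by rewrite lerDr coord_ge0.
Qed.

Let time (t : R) : R := 1 + clamp t.
Let time12 t : 1 <= time t <= 2.
Proof. by have /andP[] := clamp_bounds t; rewrite /time => ? ?; apply/andP; split; lra. Qed.

Definition flow_at (t : R) (w : realization R G) : realization R G :=
  point_of (flow_point w (time12 t)).

Lemma flow0 w : flow_at 0 w = w.
Proof.
apply: coord_inj => v; rewrite point_ofE /time clamp0 addr0.
have k12 : 1 <= (1 : R) <= 2 by apply/andP; split; lra.
have e x : flow 1 w x = coord w x.
  have [j /eqP e|nj] := pickP (fun j => support w == cell j).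
    rewrite (flow_cell x k12 e); case: ifPn => jx; last by rewrite coord_out ?e.
    rewrite profile_k1 ?mincoord_ge0 // ltr0n card_gt0.
    by have [_ _ _ hc _] := hG; have [] := hc j.
  rewrite flow_nocell // => [|j]; last by rewrite nj.
  by rewrite (_ : 1 * (2 - 1) = 1) ?mul1r //; lra.
by rewrite complete_sum ?e // (eq_bigr (coord w)) ?coord_sum // => x _; apply: e.
Qed.

Lemma flow1 w v : v != c ->
  coord (flow_at 1 w) v = \sum_(j | v \in cell j)
     profile 2 #|cell j|%:R (mincoord (cell j) w) (coord w v).
Proof.
move=> vc; rewrite point_ofE /complete (negbTE vc) /flow /time clamp1.
rewrite (_ : (1 + 1) * (2 - (1 + 1)) = 0 :> R); last by lra.
by rewrite mul0r add0r; apply: eq_bigr => j _; rewrite subr0.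
Qed.

Lemma flow_deformable : deformable R (flow_at 1) id.
Proof.
apply: deformable_sym; exists (fun p => flow_at p.1 p.2); split=> //; last exact: flow0.
have ct : continuous (fun p : R * realization R G => time p.1).
  apply: continuous_add; first exact: cst_continuous.
  exact: continuous_compose (@continuous_fst _ _) (@continuous_clamp R).
have cco v : continuous (fun p : R * realization R G => coord p.2 v).
  exact: continuous_compose (@continuous_snd _ _) (@continuous_coord R V G v).
have cq v : continuous (fun p : R * realization R G => time p.1 * (2 - time p.1) * coord p.2 v).
  apply: continuous_mul => //; apply: continuous_mul => //.
  by apply: continuous_sub => //; apply: cst_continuous.
have cF v : continuous (fun p : R * realization R G => flow (time p.1) p.2 v).
  apply: continuous_add => //; apply: continuous_sum => j _; apply: continuous_sub => //.
  apply: continuous_profile => //.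
  exact: continuous_compose (@continuous_snd _ _) (@continuous_mincoord R V G (cell j)).
apply: continuous_realization => v; rewrite /complete.
rewrite (_ : (fun p => _) = (fun p => complete c (flow (time p.1) p.2) v)) //.
rewrite /complete; case: (v == c) => //.
apply: continuous_sub; first exact: cst_continuous.
exact: continuous_sum.
Qed.

End Points.

Section Push.
Variables (V1 V2 : finType) (m : V1 -> V2) (K1 : {set {set V1}}) (K2 : {set {set V2}}).
Hypothesis hm : forall a, a \in K1 -> (m @: a)%SET \in K2.

Let pushf (w : realization R K1) (v : V2) : R := \sum_(y | m y == v) coord w y.

Let push_point (w : realization R K1) : geometric_realization R K2 (pushf w).
Proof.
split=> [v||]; first by apply: sumr_ge0 => y _; apply: coord_ge0.
  by rewrite -(coord_sum w) [RHS](partition_big m predT).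
suff -> : [set v | pushf w v != 0]%SET = (m @: support w)%SET by apply/hm/support_face.
apply/setP => v; rewrite finset.in_set; apply/idP/imsetP => [|[y wy ->]].
  apply: contraNP => nv; rewrite /pushf big1 // => y /eqP myv.
  by apply: coord_out; apply/negP => wy; apply: nv; exists y.
rewrite /pushf (bigD1 y) //= gt_eqF // ltr_wpDr //.
  by apply: sumr_ge0 => z _; apply: coord_ge0.
by rewrite lt_neqAle eq_sym -coord_supp wy coord_ge0.
Qed.

Definition push (w : realization R K1) : realization R K2 := point_of (push_point w).

Lemma pushE w v : coord (push w) v = \sum_(y | m y == v) coord w y.
Proof. by []. Qed.

Lemma support_push w : support (push w) = (m @: support w)%SET.
Proof.
apply/setP => v; rewrite coord_supp pushE; apply/idP/imsetP => [|[y wy ->]].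
  apply: contraNP => nv; rewrite big1 // => y /eqP myv.
  by apply: coord_out; apply/negP => wy; apply: nv; exists y.
rewrite (bigD1 y) //= gt_eqF // ltr_wpDr //.
  by apply: sumr_ge0 => z _; apply: coord_ge0.
by rewrite lt_neqAle eq_sym -coord_supp wy coord_ge0.
Qed.

Lemma continuous_push : continuous push.
Proof.
apply: continuous_realization => v; apply: continuous_sum => y _; exact: continuous_coord.
Qed.
End Push.

Section Model.
Variables (V0 : finType) (cell0 : J -> {set V0}).
Hypothesis cell0_neq0 : forall j, cell0 j != finset.set0.

Let cellS (j : J) : {set option (J * V0)} := in_summand j (cell0 j).

(* The cells are disjoint and only the cones over their boundaries are glued. *)
Definition model_complex : {set {set option (J * V0)}} :=
  [set a : {set option (J * V0)} | (a \subset [set None])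
    || [exists j, (a \subset None |: cellS j) && ((cellS j \subset a) ==> (None \notin a))]]%SET.

Lemma model_complexP (a : {set option (J * V0)}) : reflect ((a \subset [set None])%SET \/
    exists2 j, (a \subset None |: cellS j)%SET & (cellS j \subset a)%SET -> None \notin a)
  (a \in model_complex).
Proof.
rewrite finset.in_set; apply: (iffP orP) => -[h|]; try by left.
  by case/existsP=> j /andP[h1 /implyP h2]; right; exists j.
by case=> j h1 h2; right; apply/existsP; exists j; rewrite h1; apply/implyP.
Qed.

Lemma model_bouquet : bouquet model_complex None cellS.
Proof.
have ex j : exists x, x \in cell0 j by apply/set0Pn.
have subN j (a : {set option (J * V0)}) : (cellS j \subset None |: a)%SET = (cellS j \subset a)%SET.
  apply/idP/idP => [/fintype.subsetP s|s]; last exact: fintype.subset_trans s (finset.subsetUr _ _).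
  apply/fintype.subsetP => y ya; have := s y ya; rewrite finset.in_setU1 => /orP[/eqP e|//].
  by move: ya; rewrite e None_summand.
split.
- move=> a b /model_complexP[h|[j h1 h2]] sba; apply/model_complexP.
    by left; apply: fintype.subset_trans h.
  right; exists j; first exact: fintype.subset_trans h1.
  move=> /fintype.subset_trans/(_ sba)/h2; apply: contra; exact: (fintype.subsetP sba).
- move=> a /model_complexP[h|[j h1 h2]] nc; apply/model_complexP.
    by left; rewrite finset.subUset h fintype.subxx.
  right; exists j; first by rewrite finset.subUset h1 finset.subsetUl.
  rewrite subN => s; have nN := h2 s; case/negP: (nc j); rewrite finset.eqEsubset s andbT.
  apply/fintype.subsetP => y ya; have := fintype.subsetP h1 y ya.
  by rewrite finset.in_setU1 => /orP[/eqP e|//]; rewrite e in ya; rewrite ya in nN.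
- move=> j a; have [x jx] := ex j => /model_complexP[h|[i h1 h2]] s.
    have := fintype.subsetP (fintype.subset_trans s h) (Some (j, x)).
    by rewrite mem_summand eqxx jx finset.in_set1 => /(_ isT).
  have eij := summand_sub jx (fintype.subset_trans s h1); subst i.
  apply/eqP; rewrite finset.eqEsubset s andbT; apply/fintype.subsetP => y ya.
  have := fintype.subsetP h1 y ya; rewrite finset.in_setU1 => /orP[/eqP e|//].
  by have := h2 s; rewrite -e ya.
- move=> j; have [x jx] := ex j; split; last exact: summand_neq0 jx.
    apply/model_complexP; right; exists j; first exact: finset.subsetUr.
    by rewrite None_summand.
  by rewrite None_summand.
- move=> j i e; have [x jx] := ex j; apply: (@summand_sub _ _ j i x _ (cell0 i) jx).
  by rewrite -/(cellS i) -e finset.subsetUr.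
Qed.

Section Compare.
Variables (V : finType) (G : {set {set V}}) (c : V) (cell : J -> {set V}).
Hypotheses (hG : bouquet G c cell) (G0 : finset.set0 \in G).
Variable theta : J -> V0 -> V.
Hypotheses (theta_inj : forall j, {in cell0 j &, injective (theta j)})
  (theta_cell : forall j, (theta j @: cell0 j)%SET = cell j).

Let m (y : option (J * V0)) : V := if y is Some (j, x) then theta j x else c.

Lemma card_cell j : #|cell j| = #|cell0 j|.
Proof. by rewrite -theta_cell card_in_imset. Qed.

Lemma card_cellS j : #|cellS j| = #|cell0 j|.
Proof. by rewrite card_imset // => x y []. Qed.

Lemma m_cellS j : (m @: cellS j)%SET = cell j.
Proof. by rewrite -theta_cell /cellS /in_summand -imset_comp. Qed.

Lemma model_simplicial (a : {set option (J * V0)}) : a \in model_complex -> (m @: a)%SET \in G.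
Proof.
have [dG cone mx hc _] := hG; case/model_complexP=> [h|[j h1 h2]].
  apply: (dG (c |: finset.set0)%SET); first by apply: cone => // j; have [_ _] := hc j; rewrite eq_sym.
  rewrite finset.setU0 -[[set c]%SET](imset_set1 m None); exact: imsetS.
have [Na|nNa] := boolP (None \in a); last first.
  have [Gj _ _] := hc j; apply: dG Gj _; rewrite -m_cellS; apply: imsetS.
  apply/fintype.subsetP => y ya; have := fintype.subsetP h1 y ya.
  by rewrite finset.in_setU1 => /orP[/eqP e|//]; rewrite e in ya; rewrite ya in nNa.
have sb : (a :\ None \subset cellS j)%SET by rewrite finset.subDset.
have [Gj cj _] := hc j.
have sj : (m @: (a :\ None) \subset cell j)%SET by rewrite -m_cellS; apply: imsetS.
rewrite -(finset.setD1K Na) imsetU1; apply: cone; first exact: dG Gj sj.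
move=> i; apply/eqP => e; have : cell j = cell i by apply: mx => //; rewrite -e.
move=> eji; have := leq_imset_card m (a :\ None)%SET.
rewrite e -eji card_cell -card_cellS leqNgt => /negP; apply.
apply/proper_card; rewrite properE sb /=; apply/negP => s.
by have := h2 (fintype.subset_trans s (finset.subsetDl _ _)); rewrite Na.
Qed.

Let phi := push model_simplicial.

(** The end of the flow, read in the disjoint cells of the model. At [k = 2] only points interior to
    a cell keep mass off the apex, so it does not matter that the cells of [G] may share faces. *)
Let backf (w : realization R G) (y : option (J * V0)) : R :=
  if y is Some (j, x) then
    if x \in cell0 j then profile 2 #|cell0 j|%:R (mincoord (cell j) w) (coord w (theta j x))
    else 0
  else 0.

Lemma back_point w : geometric_realization R model_complex (complete None (backf w)).
Proof.
have k12 : 1 <= (2 : R) <= 2 by apply/andP; split; lra.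
have z i x : support w != cell i -> profile 2 #|cell0 i|%:R (mincoord (cell i) w) x = 0.
  by move=> ni; rewrite (min_eq0 hG ni) profile_u0 // subrr mulr0 mul0r.
have [j /eqP e|nj] := pickP (fun j => support w == cell j); last first.
  have b0 y : backf w y = 0.
    by case: y => [[j x]|//]; rewrite /= z ?nj ?if_same.
  apply: (cone_point model_bouquet (a := finset.set0)).
  - by apply/model_complexP; left; apply: finset.sub0set.
  - by move=> j; have [x jx] := set0Pn _ (cell0_neq0 j); rewrite eq_sym; apply: summand_neq0 jx.
  - by move=> y; rewrite b0.
  - by move=> y _ _; rewrite b0.
  - by rewrite big1.
have [_ _ _ hc inj] := hG; have [Gj cj j0] := hc j.
pose x (y : option (J * V0)) : R := if y is Some (_, x) then coord w (theta j x) else 0.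
have xin y : y \in cellS j -> exists2 x, x \in cell0 j & y = Some (j, x) by case/imsetP=> t ? ->; exists t.
apply: (@profile_point _ _ _ _ model_bouquet j x (mincoord (cell j) w) 2) => //.
- exact: mincoord_ge0.
- by move=> y /xin[t jt ->]; apply: mincoord_le; rewrite -theta_cell imset_f.
- rewrite /cellS /in_summand big_imset /=; last by move=> t s _ _ [].
  by rewrite -(sum_support e) -theta_cell [RHS]big_imset //; apply: theta_inj.
- have [v jv ev] := mincoord_attained w j0.
  have /imsetP[t jt et] : v \in (theta j @: cell0 j)%SET by rewrite theta_cell.
  by exists (Some (j, t)); [rewrite mem_summand eqxx | rewrite /= -et].
- case=> [[i t] _|//]; rewrite mem_summand /= card_cellS.
  have [->|ij] /= := eqVneq i j; first by [].
  by rewrite z ?if_same // e (inj_eq inj) eq_sym.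
Qed.

Let psi (w : realization R G) : realization R model_complex := point_of (back_point w).

Lemma continuous_back : continuous psi.
Proof.
have cb y : continuous (fun w => backf w y).
  case: y => [[j x]|]; last exact: cst_continuous.
  rewrite /backf; case: (x \in cell0 j); last exact: cst_continuous.
  apply: continuous_profile; [exact: cst_continuous | exact: continuous_mincoord | exact: continuous_coord].
apply: continuous_realization => y.
rewrite (_ : (fun w => _) = (fun w => complete None (backf w) y)) // /complete.
case: (y == None) => //.
apply: continuous_sub; [exact: cst_continuous | exact: continuous_sum].
Qed.

Lemma coord_inj_off (V' : finType) (K : {set {set V'}}) (c' : V') (w w' : realization R K) :
  (forall v, v != c' -> coord w v = coord w' v) -> w = w'.
Proof.
move=> e; apply: coord_inj => v; have [->|/e //] := eqVneq v c'.
have := coord_sum w'; rewrite -(coord_sum w) (bigD1 c') //= [in RHS](bigD1 c') //=.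
rewrite (eq_bigr (coord w)) => [/addIr/esym //|u uc]; exact/esym/e.
Qed.

Lemma phi_psi : phi \o psi = flow_at hG 1.
Proof.
apply: funext => w; apply: (@coord_inj_off _ _ c) => v vc.
rewrite (flow1 hG w vc) pushE.
transitivity (\sum_(y | m y == v) backf w y).
  apply: eq_bigr => y /eqP my; rewrite point_ofE /complete.
  by case: y my => [[j x]|] //= e; move: vc; rewrite -e eqxx.
transitivity (\sum_j \sum_(x | theta j x == v) backf w (Some (j, x))).
  rewrite pair_big_dep /= (reindex_omap Some id) /=.
    by apply: eq_big => [[j x]|[j x] _ //]; rewrite eqxx andbT.
  by case=> // /eqP e; move: vc; rewrite -e eqxx.
rewrite [RHS]big_mkcond; apply: eq_bigr => j _; case: ifPn => jv.
  have /imsetP[x jx ex] : v \in (theta j @: cell0 j)%SET by rewrite theta_cell.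
  rewrite (bigD1 x) ?ex //= jx big1 ?addr0 ?card_cell //.
  move=> y /andP[/eqP ey yx]; case: ifP => // jy.
  by rewrite (theta_inj jy jx ey) eqxx in yx.
apply: big1 => x /eqP ex; rewrite /=; case: ifP => // jx.
by rewrite -theta_cell -ex imset_f in jv.
Qed.

Lemma psi_phi : psi \o phi = flow_at model_bouquet 1.
Proof.
apply: funext => w; apply: (@coord_inj_off _ _ None) => -[[j x] _|//].
rewrite flow1 // point_ofE /complete /=.
rewrite [RHS](eq_bigl (fun i => (i == j) && (x \in cell0 j))); last first.
  by move=> i; rewrite mem_summand eq_sym; case: eqVneq => // ->.
case: ifP => jx; last by rewrite big1 // => i /andP[].
rewrite (big_pred1 j) => [|i]; last by rewrite andbT.
have [e|ne] := eqVneq (support w) (cellS j); last first.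
  have k12 : 1 <= (2 : R) <= 2 by apply/andP; split; lra.
  rewrite (min_eq0 model_bouquet ne) (min_eq0 hG) ?profile_u0 ?subrr ?mulr0 ?mul0r //.
  (* If the image of [w] is interior to [cell j], then the support of [w] avoids [None], lies in a
     single model cell, which is that of [j] by maximality, and fills it because its image has as
     many vertices. *)
  apply: contra ne => /eqP; rewrite support_push => e.
  have [_ _ mx hc inj] := hG; have [_ cj j0] := hc j.
  have sw := support_face w.
  have nN : None \notin support w.
    by apply: contra cj => h; rewrite -e; apply/imsetP; exists None.
  case/model_complexP: (sw) => [h|[i h1 _]].
    have /set0Pn[y] := support_neq0 w; move=> yw; have := fintype.subsetP h y yw.
    by rewrite finset.in_set1 => /eqP ey; rewrite ey in yw; rewrite yw in nN.
  have s : (support w \subset cellS i)%SET.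
    apply/fintype.subsetP => y yw; have := fintype.subsetP h1 y yw.
    by rewrite finset.in_setU1 => /orP[/eqP ey|//]; rewrite ey in yw; rewrite yw in nN.
  have eij : j = i.
    apply: inj; apply: esym; apply: mx; first by have [] := hc i.
    by rewrite -e -m_cellS; apply: imsetS.
  subst i; rewrite finset.eqEcard s card_cellS -card_cell -e; exact: leq_imset_card.
have cphi t : t \in cell0 j -> coord (phi w) (theta j t) = coord w (Some (j, t)).
  move=> jt; rewrite pushE (bigD1 (Some (j, t))) /= ?eqxx // big1 ?addr0 //.
  move=> y /andP[/eqP my ny]; apply: coord_out; apply: contra ny; rewrite e => /imsetP[s js ys].
  by rewrite ys in my *; rewrite (theta_inj js jt my).
have emin : mincoord (cell j) (phi w) = mincoord (cellS j) w.
  have [_ _ _ hc _] := hG; have [_ _ j0] := hc j.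
  have [_ _ _ hS _] := model_bouquet; have [_ _ jS0] := hS j.
  apply/eqP; rewrite eq_le; apply/andP; split.
    have [y /imsetP[t jt ->] ->] := mincoord_attained w jS0.
    by rewrite -cphi // mincoord_le // -theta_cell imset_f.
  have [v jv ->] := mincoord_attained (phi w) j0.
  have /imsetP[t jt ->] : v \in (theta j @: cell0 j)%SET by rewrite theta_cell.
  by rewrite cphi // mincoord_le // mem_summand eqxx.
by rewrite emin cphi // card_cellS.
Qed.

(** Both composites are ends of flows, one on [G] and one on the model, because [profile] treats the
    vertices of a cell alike and sees the cell only through its size. Hence any bijections [theta]
    will do. *)
Lemma bouquet_hequiv : hequiv R (realization R model_complex) (realization R G).
Proof.
exists phi, psi; split.
- exact: continuous_push.
- exact: continuous_back.
- by rewrite psi_phi; apply: flow_deformable.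
- by rewrite phi_psi; apply: flow_deformable.
Qed.

End Compare.
End Model.
End Bouquet.

(** * Size-preserving bijections between finite families *)

Section Matching.

Definition match_enum (T1 T2 : finType) (A : {set T1}) (B : {set T2}) (d : T2) (x : T1) : T2 :=
  nth d (enum B) (index x (enum A)).

Lemma match_enum_in (T1 T2 : finType) (A : {set T1}) (B : {set T2}) d x :
  #|A| = #|B| -> x \in A -> match_enum A B d x \in B.
Proof.
by move=> eAB xA; rewrite -mem_enum mem_nth // -cardE -eAB cardE index_mem mem_enum.
Qed.

Lemma match_enum_inj (T1 T2 : finType) (A : {set T1}) (B : {set T2}) d :
  #|A| = #|B| -> {in A &, injective (match_enum A B d)}.
Proof.
move=> eAB x y xA yA /eqP; have iA z : z \in A -> (index z (enum A) < size (enum B))%N.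
  by move=> zA; rewrite -cardE -eAB cardE index_mem mem_enum.
rewrite nth_uniq ?iA ?enum_uniq // => /eqP e.
by have := congr1 (nth x (enum A)) e; rewrite !nth_index ?mem_enum.
Qed.

Lemma match_enum_image (T1 T2 : finType) (A : {set T1}) (B : {set T2}) d :
  #|A| = #|B| -> (match_enum A B d @: A)%SET = B.
Proof.
move=> eAB; apply/eqP; rewrite finset.eqEcard card_in_imset ?eAB ?leqnn ?andbT.
  by apply/fintype.subsetP => _ /imsetP[x xA ->]; apply: match_enum_in.
by move=> x y; apply: match_enum_inj.
Qed.

Lemma graded_bijection (T1 T2 : finType) (A : {set T1}) (B : {set T2})
    (s1 : T1 -> nat) (s2 : T2 -> nat) (d : T2) :
    (forall n, #|[set x in A | s1 x == n]%SET| = #|[set y in B | s2 y == n]%SET|) ->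
  exists h : T1 -> T2, [/\ {in A &, injective h}, (h @: A)%SET = B &
    forall x, x \in A -> s2 (h x) = s1 x].
Proof.
move=> eAB; pose F1 n := [set x in A | s1 x == n]%SET; pose F2 n := [set y in B | s2 y == n]%SET.
pose h x := match_enum (F1 (s1 x)) (F2 (s1 x)) d x.
have F1x x : x \in A -> x \in F1 (s1 x) by move=> xA; rewrite finset.in_set xA eqxx.
have hx x : x \in A -> h x \in F2 (s1 x) by move=> xA; apply: match_enum_in; [exact: eAB | exact: F1x].
have hs x : x \in A -> s2 (h x) = s1 x by move/hx; rewrite finset.in_set => /andP[_ /eqP].
exists h; split=> //.
- move=> x y xA yA e; have sxy : s1 x = s1 y by rewrite -!hs // e.
  move: e; rewrite /h -sxy; apply: (match_enum_inj (eAB (s1 x)) (F1x x xA)).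
  by rewrite sxy; apply: (F1x y yA).
- apply/setP => y; apply/imsetP/idP => [[x xA ->]|yB].
    by have := hx x xA; rewrite finset.in_set => /andP[].
  have : y \in (match_enum (F1 (s2 y)) (F2 (s2 y)) d @: F1 (s2 y))%SET.
    by rewrite (match_enum_image d (eAB (s2 y))) finset.in_set yB eqxx.
  case/imsetP=> x; rewrite finset.in_set => /andP[xA /eqP sx] ->.
  by exists x; rewrite // /h sx.
Qed.

End Matching.

Section Spheres.
Variable R : realType.

Definition cone_off (V : finType) (K C : {set {set V}}) (c : V) : {set {set V}} :=
  (K :|: [set c |: a | a in K :\: C])%SET.

Lemma cone_off_down_closed (V : finType) (K C : {set {set V}}) (c : V) :
  sphere_wedge K C c -> down_closed (cone_off K C c).
Proof.
case=> -[dK K0] [CK C0] fc cl cK a b; rewrite finset.in_setU => /orP[Ka sba|].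
  by rewrite finset.in_setU (dK _ _ Ka sba).
case/imsetP=> d /finset.setDP[Kd nCd] -> sbd.
have sd : (b :\ c \subset d)%SET by rewrite finset.subDset.
have Kb := dK _ _ Kd sd.
have [cb|ncb] := boolP (c \in b); last first.
  suff <- : (b :\ c)%SET = b by rewrite finset.in_setU Kb.
  apply/setP => x; rewrite finset.in_setD1; apply: andb_idl => xb.
  by apply: contraNneq ncb => <-.
rewrite finset.in_setU -(finset.setD1K cb) imset_f ?orbT // finset.in_setD Kb andbT.
by apply: contra nCd => Cb; rewrite (fc _ _ Cb Kd sd).
Qed.

(** The collapse of [K :\: C] to the void family, carried over by adding [c] to each face, removes
    exactly the faces through [c], the vertex [c] being paired as the empty face was. *)
Lemma cone_off_hequiv (V : finType) (K C : {set {set V}}) (c : V) :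
  sphere_wedge K C c -> hequiv R (realization R (cone_off K C c)) (realization R K).
Proof.
move=> hK; have [[dK K0] [CK C0] fc cl cK] := hK.
have dG := cone_off_down_closed hK.
set G := cone_off K C c in dG *.
have idE (a : {set V}) : ([eta id] @: a)%SET = a by apply: imset_id.
have inG a : a \in (K :\: C)%SET -> (c |: a)%SET \in G.
  by move=> Na; rewrite finset.in_setU imset_f ?orbT.
have GK : (G :\: [set ([set c] :|: [eta id] @: (a : {set V})) | a in K :\: C :\: finset.set0] = K)%SET.
  apply/setP => b; rewrite finset.setD0 finset.in_setD finset.in_setU.
  rewrite (eq_imset _ (g := fun a => c |: a)%SET) => [|a]; last by rewrite idE.
  have [/imsetP[a Na ->]|nb] /= := boolP (b \in _); last by rewrite orbF.
  by apply/esym/negbTE/negP => /cK; rewrite finset.setU11.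
have col : collapses G K.
  rewrite -[X in collapses _ X]GK.
  apply: (@collapses_transport V V [eta id] [set c]%SET (~: [set c])%SET) cl _ _ => //.
  - by move=> x; rewrite !finset.inE.
  - move=> a /finset.setDP[/cK ca _]; apply/fintype.subsetP => x xa; rewrite !finset.inE.
    by apply: contraNneq ca => <-.
  - by move=> a Na _; rewrite idE; apply: inG.
  - move=> a b Na _; rewrite finset.in_setU idE => /orP[/cK cb|/imsetP[a' Na' ->] _].
      by rewrite finset.subUset finset.sub1set (negbTE cb).
    by exists a'; rewrite ?idE.
exact: collapses_hequiv col dG K0.
Qed.

Lemma cone_off_bouquet (V : finType) (K C : {set {set V}}) (c : V) (J : finType) (cell : J -> {set V}) :
    sphere_wedge K C c -> injective cell -> (forall a, reflect (exists j, a = cell j) (a \in C)) ->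
  bouquet (cone_off K C c) c cell.
Proof.
move=> hK inj cellP; have [[dK K0] [CK C0] fc cl cK] := hK.
have Cj j : cell j \in C by apply/cellP; exists j.
split=> //.
- exact: cone_off_down_closed hK.
- move=> a; rewrite finset.in_setU => /orP[Ka|/imsetP[b Nb ->]] nc.
    rewrite finset.in_setU imset_f ?orbT // finset.in_setD Ka andbT.
    by apply/cellP => -[j e]; have := nc j; rewrite e eqxx.
  by rewrite finset.setUA finset.setUid finset.in_setU imset_f ?orbT.
- move=> j a; rewrite finset.in_setU => /orP[Ka|/imsetP[b /finset.setDP[Kb nCb] ->]] sub.
    exact: fc (Cj j) Ka sub.
  have cj := cK _ (fintype.subsetP CK _ (Cj j)).
  have sb : (cell j \subset b)%SET.
    apply/fintype.subsetP => x jx; have := fintype.subsetP sub x jx.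
    by rewrite finset.in_setU1 => /orP[/eqP e|//]; rewrite e in jx; rewrite jx in cj.
  by rewrite (fc _ _ (Cj j) Kb sb) Cj in nCb.
- move=> j; have Kj := fintype.subsetP CK _ (Cj j); split; last 1 first.
  + by apply: contraNneq C0 => <-.
  + by rewrite finset.in_setU Kj.
  + exact: cK.
Qed.

(** Both coned complexes are compared with one model, built on the cells of [K1]: the vertex maps
    are the identity for [K1] and enumerations of cells of equal size for [K2]. *)
Lemma sphere_wedge_hequiv (V1 V2 : finType) (K1 C1 : {set {set V1}}) (K2 C2 : {set {set V2}}) c1 c2 :
    sphere_wedge K1 C1 c1 -> sphere_wedge K2 C2 c2 ->
    (forall n, #|[set a in C1 | #|(a : {set V1})| == n]%SET| = #|[set a in C2 | #|(a : {set V2})| == n]%SET|) ->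
  hequiv R (realization R K1) (realization R K2).
Proof.
move=> h1 h2 /(graded_bijection finset.set0)[h [h_inj hC hs]].
apply: hequiv_trans (hequiv_sym (cone_off_hequiv h1)) _.
apply: hequiv_trans _ (cone_off_hequiv h2).
pose J := {a : {set V1} | a \in C1}; pose cell1 (j : J) := val j; pose cell2 (j : J) := h (val j).
have b1 : bouquet (cone_off K1 C1 c1) c1 cell1.
  apply: (cone_off_bouquet h1) => [|a]; first exact: val_inj.
  by apply: (iffP idP) => [Ca|[j ->]]; [exists (exist _ a Ca) | apply: (valP j)].
have b2 : bouquet (cone_off K2 C2 c2) c2 cell2.
  apply: (cone_off_bouquet h2) => [i j /h_inj|a].
    by move=> e; apply: val_inj; apply: e; apply: valP.
  apply: (iffP idP) => [|[j ->]]; last by rewrite -hC; apply: imset_f; apply: (valP j).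
  by rewrite -hC => /imsetP[b Cb ->]; exists (exist _ b Cb).
have ne j : cell1 j != finset.set0 by case: b1 => _ _ _ hc _; have [_ _] := hc j.
have in0 (V : finType) (K C : {set {set V}}) c : sphere_wedge K C c -> finset.set0 \in cone_off K C c.
  by case=> -[_ K0] _ _ _ _; rewrite finset.in_setU K0.
have cE j : #|cell1 j| = #|cell2 j| by rewrite /cell2 hs // (valP j).
have m1 := bouquet_hequiv R ne b1 (in0 _ _ _ _ h1) (theta := fun=> id).
have m2 := bouquet_hequiv R ne b2 (in0 _ _ _ _ h2) (theta := fun j => match_enum (cell1 j) (cell2 j) c2).
apply: hequiv_trans (hequiv_sym (m1 _ _)) (m2 _ _) => j.
- by move=> x y _ _.
- exact: imset_id.
- exact: match_enum_inj.
- exact: match_enum_image.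
Qed.

End Spheres.

(** * The realization of a wedge *)

Section Ratio.
Variables (R : realType) (V : finType) (K : {set {set V}}) (x : realization R K).
Implicit Type y : realization R K.

(* The largest u with u x <= y coordinatewise. *)
Definition ratio y : R := \big[Num.min/1]_(v in support x) (coord y v / coord x v).

Lemma ratio_ge0 y : 0 <= ratio y.
Proof.
apply: (big_ind (fun t : R => 0 <= t)) => [|s t s0 t0|v _]; rewrite ?ler01 ?le_min ?s0 //.
by rewrite divr_ge0 ?coord_ge0.
Qed.

Lemma ratio_le y v : ratio y * coord x v <= coord y v.
Proof.
have [xv|/coord_out ->] := boolP (v \in support x); last by rewrite mulr0 coord_ge0.
have x0 : 0 < coord x v by rewrite lt_neqAle eq_sym -coord_supp xv coord_ge0.
by rewrite -ler_pdivlMr // /ratio (bigD1 v) //= ge_min lexx.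
Qed.

Lemma ratio_self : ratio x = 1.
Proof.
rewrite /ratio; elim/big_rec: _ => // v t xv ->.
by rewrite divff ?minxx // -coord_supp.
Qed.

Lemma ratio_support y : 0 < ratio y -> (support x \subset support y)%SET.
Proof.
move=> r0; apply/fintype.subsetP => v xv; rewrite coord_supp gt_eqF //.
apply: lt_le_trans (ratio_le y v); rewrite mulr_gt0 //.
by rewrite lt_neqAle eq_sym -coord_supp xv coord_ge0.
Qed.

Lemma continuous_ratio : continuous ratio.
Proof.
have cs s : continuous (fun y => \big[Num.min/1]_(v <- s | v \in support x) (coord y v / coord x v)).
  elim: s => [|v s IH].
    rewrite (_ : (fun y => _) = cst 1); first exact: cst_continuous.
    by apply: funext => y; rewrite big_nil.
  case xv : (v \in support x).
    rewrite (_ : (fun y => _) = (fun y => Num.min (coord y v / coord x v)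
        (\big[Num.min/1]_(u <- s | u \in support x) (coord y u / coord x u)))).
      apply: continuous_Min => //; apply: continuous_mul; last exact: cst_continuous.
      exact: continuous_coord.
    by apply: funext => y; rewrite big_cons xv.
  rewrite (_ : (fun y => _) = (fun y => \big[Num.min/1]_(u <- s | u \in support x) (coord y u / coord x u))) //.
  by apply: funext => y; rewrite big_cons xv.
exact: cs.
Qed.

End Ratio.

Lemma sum_option_pair (R : realType) (W V : finType) (F : option (W * V) -> R) :
  \sum_t F t = F None + \sum_w \sum_v F (Some (w, v)).
Proof.
rewrite (bigD1 None) //=; congr (_ + _).
rewrite pair_big /= (reindex_omap Some id) /=; last by case.
by apply: eq_big => -[w v]; rewrite ?eqxx.
Qed.

Section WedgeRealization.
Variables (R : realType) (W V : finType) (I : choiceType) (idx : I -> W).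
Hypothesis idx_inj : injective idx.
Variables (K : W -> {set {set V}}) (x0 : forall i, realization R (K (idx i))).
Variables (Is : {set W}) (S : W -> {set {set V}}).
Hypotheses (dK : forall i, down_closed (K (idx i)))
  (IsP : forall w, reflect (exists i, idx i = w) (w \in Is))
  (SP : forall i, S (idx i) = [set a in K (idx i) | a :|: support (x0 i) \in K (idx i)]%SET).

Let X i : topologicalType := realization R (K (idx i)).
Let G := wedge_complex Is K S.

Let SI i a : (a \in S (idx i)) = (a \in K (idx i)) && ((a :|: support (x0 i))%SET \in K (idx i)).
Proof. by rewrite SP finset.in_set. Qed.

Let dS i : down_closed (S (idx i)).
Proof.
move=> a b; rewrite !SI => /andP[Ka Kax] sba; rewrite (dK Ka sba) /=.
by apply: dK Kax _; apply: finset.setSU.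
Qed.

Let dG : down_closed G.
Proof.
apply: wedge_down_closed => w /IsP[i <-]; split; [exact: dK | exact: dS |].
by apply/fintype.subsetP => a; rewrite SI => /andP[].
Qed.

Definition mass (i : I) (w : realization R G) : R := \sum_v coord w (Some (idx i, v)).

Definition part (i : I) (w : realization R G) : {set V} := [set v | Some (idx i, v) \in support w]%SET.

Lemma mass_None i w : (forall j, j != i -> mass j w = 0) -> mass i w + coord w None = 1.
Proof.
move=> h; rewrite -(coord_sum w) sum_option_pair addrC; congr (_ + _).
rewrite [RHS](bigD1 (idx i)) //= [X in _ = _ + X]big1 ?addr0 // => w' wi.
have [[j ej]|nj] := IsP w'.
  by rewrite -ej; apply: h; apply: contraNneq wi => e; rewrite -ej e.
apply: big1 => v _; apply: coord_out; apply/negP => sv; apply: nj.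
have /wedge_complexP[s0|sN|w2 a /IsP Iw _ sw|w2 a /IsP Iw _ sw] := support_face w.
- by rewrite s0 finset.in_set0 in sv.
- by rewrite sN finset.in_set1 in sv.
- by move: sv; rewrite sw mem_summand => /andP[/eqP ->].
- by move: sv; rewrite sw finset.in_setU1 mem_summand => /andP[/eqP ->].
Qed.

Variant face_in (w : realization R G) : Prop :=
| FaceBase of (forall j, mass j w = 0)
| FaceIn i of (forall j, j != i -> mass j w = 0) & part i w \in K (idx i) & coord w None = 0
    & support w = in_summand (idx i) (part i w)
| FaceCone i of (forall j, j != i -> mass j w = 0) & part i w \in S (idx i)
    & support w = (None |: in_summand (idx i) (part i w))%SET.

Lemma faceP w : face_in w.
Proof.
have z i j a : support w = in_summand (idx i) a \/ support w = (None |: in_summand (idx i) a)%SET ->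
   j != i -> mass j w = 0.
  move=> sw ji; apply: big1 => v _; apply: coord_out; case: sw => ->;
   by rewrite ?finset.in_setU1 mem_summand (inj_eq idx_inj) (negbTE ji).
have pE i a : support w = in_summand (idx i) a \/ support w = (None |: in_summand (idx i) a)%SET ->
   part i w = a.
  move=> sw; apply/setP => v; rewrite finset.in_set; case: sw => ->;
   by rewrite ?finset.in_setU1 mem_summand eqxx.
have /wedge_complexP[s0|sN|w' a /IsP[i <-] Ka sw|w' a /IsP[i <-] Sa sw] := support_face w.
- by have := support_neq0 w; rewrite s0 eqxx.
- by apply: FaceBase => j; apply: big1 => v _; apply: coord_out; rewrite sN finset.in_set1.
- apply: (@FaceIn w i); rewrite ?(pE i a) //; try by [left].
  + by move=> j; apply: z; left; apply: sw.
  + by apply: coord_out; rewrite sw None_summand.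
- apply: (@FaceCone w i); rewrite ?(pE i a) //; try by [right].
  by move=> j; apply: z; right; apply: sw.
Qed.

Lemma mass_le1 i w : mass i w <= 1.
Proof.
have [z|j z _ _ _|j z _ _] := faceP w; first by rewrite z ler01.
  by have [->|/z -> //] := eqVneq i j; rewrite -(mass_None z) lerDl coord_ge0.
by have [->|/z -> //] := eqVneq i j; rewrite -(mass_None z) lerDl coord_ge0.
Qed.

Lemma mass0_part i w : mass i w = 0 -> part i w = finset.set0.
Proof.
move=> m0; apply/setP => v; rewrite finset.in_set finset.in_set0 coord_supp; apply/negbTE.
rewrite negbK; apply/eqP; move: v (isT : true).
by apply: psumr_eq0P m0 => v _; apply: coord_ge0.
Qed.

Lemma part_out i w v : v \notin part i w -> coord w (Some (idx i, v)) = 0.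
Proof. by rewrite finset.in_set => /coord_out. Qed.

(** The retraction onto summand [i]: all mass elsewhere, including that at [None], is put at the
    base point. *)
Let retrf i (w : realization R G) v : R :=
  coord w (Some (idx i, v)) + (1 - mass i w) * coord (x0 i) v.

Let retr_point i w : geometric_realization R (K (idx i)) (retrf i w).
Proof.
have sub (a : {set V}) : (part i w \subset a)%SET -> (mass i w != 1 -> support (x0 i) \subset a)%SET ->
    ([set v | retrf i w v != 0] \subset a)%SET.
  move=> pa xa; apply/fintype.subsetP => v; rewrite finset.in_set; apply: contraNT => va.
  rewrite /retrf part_out ?add0r; last by apply: contra va; apply: (fintype.subsetP pa).
  have [->|/xa xa'] := eqVneq (mass i w) 1; first by rewrite subrr mul0r.
  by rewrite coord_out ?mulr0 //; apply: contra va; apply: (fintype.subsetP xa').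
split=> [v||].
- by rewrite addr_ge0 ?coord_ge0 // mulr_ge0 ?coord_ge0 // subr_ge0 mass_le1.
- by rewrite big_split /= -mulr_sumr coord_sum mulr1 addrC subrK.
have Kx : support (x0 i) \in K (idx i) := support_face (x0 i).
have out : mass i w = 0 -> [set v | retrf i w v != 0]%SET \in K (idx i).
  by move=> m0; apply: (dK Kx); apply: sub; rewrite ?mass0_part ?finset.sub0set.
have [z|j z Kp n0 _|j z Sp _] := faceP w; first exact: out.
  have [ij|/z/out //] := eqVneq i j; subst j.
  apply: (dK Kp); apply: sub => //.
  by rewrite -(mass_None z) n0 addr0 eqxx.
have [ij|/z/out //] := eqVneq i j; subst j.
move: Sp; rewrite SI => /andP[_ Kpx]; apply: (dK Kpx); apply: sub => [|_].
  exact: finset.subsetUl.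
exact: finset.subsetUr.
Qed.

Let retr i (w : realization R G) : X i := point_of (retr_point i w).

Lemma retr0 i w : mass i w = 0 -> retr i w = x0 i.
Proof.
move=> m0; apply: coord_inj => v; rewrite point_ofE /retrf m0 subr0 mul1r part_out ?add0r //.
by rewrite mass0_part ?finset.in_set0.
Qed.

Lemma continuous_retr i : continuous (retr i).
Proof.
have cm : continuous (mass i) by apply: continuous_sum => v _; apply: continuous_coord.
apply: continuous_realization => v; apply: continuous_add; first exact: continuous_coord.
by apply: continuous_mul; [apply: continuous_sub => //|]; apply: cst_continuous.
Qed.

Variable i0 : I.

(* f replaces the base point None by the points x0 i, and g splits off from a point
   of a summand the largest possible multiple of x0 i and moves it to None. *)
Let f (w : realization R G) : wedge x0 :=
  if pselect (exists i, mass i w != 0) is left h then wedge_lift x0 (retr (projT1 (cid h)) w)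
  else wedge_lift x0 (x0 i0).

Lemma fE i w : (forall j, j != i -> mass j w = 0) -> f w = wedge_lift x0 (retr i w).
Proof.
move=> z; rewrite /f; case: pselect => [h|nh].
  case: (cid h) => j /= mj; suff -> : j = i by [].
  by apply/eqP; apply: contraNT mj => /z ->.
rewrite (retr0 (i := i)); first exact: wedge_liftE.
by apply/eqP; apply/negPn/negP => mi; apply: nh; exists i.
Qed.

Lemma face_exists w : exists i, forall j, j != i -> mass j w = 0.
Proof.
have [z|i z _ _ _|i z _ _] := faceP w; [|by exists i|by exists i].
by exists i0 => j _; apply: z.
Qed.

Lemma mass_uniq i w : mass i w != 0 -> forall j, j != i -> mass j w = 0.
Proof.
move=> mi; have [k z] := face_exists w; suff -> : i = k by [].
by apply/eqP; apply: contraNT mi => /z ->.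
Qed.

Lemma continuous_mass i : continuous (mass i).
Proof. by apply: continuous_sum => v _; apply: continuous_coord. Qed.

(** Near a point with mass in summand [i], [f] is the retraction onto [i]. At [None] all retractions
    give the base point, and nearby [f] is always one of them; finiteness of [W] yields a common
    neighborhood. *)
Lemma continuous_f : continuous f.
Proof.
have cl i : continuous (@wedge_lift _ _ x0 i \o retr i).
  exact: continuous_compose (@continuous_retr i) (@wedge_lift_continuous _ _ x0 i).
move=> w; have [[i mi]|nm] := pselect (exists i, mass i w != 0).
  have fi : \forall z \near w, f z = wedge_lift x0 (retr i z).
    have : nbhs w (mass i @^-1` [set x | x != 0]).
      by apply: continuous_mass; apply: open_nbhs_nbhs; split => //; apply: open_neq.
    by apply: filterS => z mz; apply: fE; apply: mass_uniq.
  move=> U; rewrite (fE (mass_uniq mi)) => /(cl i w) cU.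
  by apply: filterS2 fi cU => z fz Uz; rewrite /= fz.
have z i : mass i w = 0 by apply/eqP/negPn/negP => mi; apply: nm; exists i.
move=> U fU.
have h w' : \forall y \near w, forall i, idx i = w' -> U (wedge_lift x0 (retr i y)).
  have [[i ei]|ni] := IsP w'; last first.
    apply: (@filterE _ (nbhs w) (nbhs_filter w)) => y i ei.
    by case: ni; exists i.
  have : nbhs (wedge_lift x0 (retr i w)) U by rewrite -fE // => j _; apply: z.
  move=> /(cl i w) hU; apply: (@filterS _ (nbhs w) (nbhs_filter w) _ _ _ hU) => y Uy j ej.
  by rewrite (idx_inj (etrans ej (esym ei))).
have := @filter_forall _ W (fun w' y => forall i, idx i = w' -> U (wedge_lift x0 (retr i y))) (nbhs w) (nbhs_filter w) h.
apply: (@filterS _ (nbhs w) (nbhs_filter w)) => y hy; have [i zi] := face_exists y; rewrite /= (fE zi).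
exact: (hy (idx i) i erefl).
Qed.

Let gf i (y : X i) (t : option (W * V)) : R :=
  if t is Some (w', v) then
    if w' == idx i then coord y v - ratio (x0 i) y * coord (x0 i) v else 0
  else ratio (x0 i) y.

Lemma gf_sub i (y : X i) : ([set t | gf y t != 0] \subset None |: in_summand (idx i) (support y))%SET.
Proof.
apply/fintype.subsetP => -[[w' v]|]; last by rewrite finset.setU11.
rewrite finset.in_set finset.in_setU1 mem_summand /=; have [_|_] := eqVneq w' (idx i); last by rewrite /= eqxx.
apply: contraNT => /coord_out yv; rewrite yv sub0r oppr_eq0.
have := ratio_le (x0 i) y v; rewrite yv => h.
by rewrite eq_le h mulr_ge0 ?ratio_ge0 ?coord_ge0.
Qed.

Lemma gf_sub0 i (y : X i) : ratio (x0 i) y = 0 ->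
  ([set t | gf y t != 0] \subset in_summand (idx i) (support y))%SET.
Proof.
move=> r0; apply/fintype.subsetP => t ht; have := fintype.subsetP (gf_sub y) t ht.
rewrite finset.in_setU1 => /orP[/eqP et|//].
by move: ht; rewrite et finset.in_set /= r0 eqxx.
Qed.

Lemma Sface i a : a \in S (idx i) -> (None |: in_summand (idx i) a)%SET \in G.
Proof.
have Ii : idx i \in Is by apply/IsP; exists i.
by move=> Sa; apply/wedge_complexP; exact: (WedgeCone Ii Sa erefl).
Qed.

Lemma Kface i a : a \in K (idx i) -> in_summand (idx i) a \in G.
Proof.
have Ii : idx i \in Is by apply/IsP; exists i.
by move=> Ka; apply/wedge_complexP; exact: (WedgeFace Ii Ka erefl).
Qed.

Let g_point i (y : X i) : geometric_realization R G (gf y).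
Proof.
split=> [[[w' v]|]||].
- by rewrite /=; case: ifP => // _; rewrite subr_ge0 ratio_le.
- exact: ratio_ge0.
- rewrite sum_option_pair /= (bigD1 (idx i)) //= eqxx.
  rewrite [X in _ + (_ + X)]big1 => [|w' /negbTE wi]; last by apply: big1 => v _; rewrite wi.
  by rewrite addr0 sumrB -mulr_sumr !coord_sum mulr1 addrC subrK.
(* If a positive multiple of [x0 i] splits off, the support of [y] contains that of [x0 i]; it then
   lies in the star, and its join with [None] is a face. *)
have [r0|rn] := eqVneq (ratio (x0 i) y) 0.
  by apply: dG (gf_sub0 r0); apply/Kface/support_face.
have r1 : 0 < ratio (x0 i) y by rewrite lt_neqAle eq_sym rn ratio_ge0.
apply: dG (gf_sub y); apply: Sface; rewrite SI support_face.
by rewrite (finset.setUidPl (ratio_support r1)) support_face.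
Qed.

Let gi i (y : X i) : realization R G := point_of (g_point y).

Lemma gi_base i j : gi (x0 i) = gi (x0 j).
Proof.
have e k t : coord (gi (x0 k)) t = (t == None)%:R.
  rewrite point_ofE; case: t => [[w' v]|] /=; last by rewrite ratio_self.
  by rewrite ratio_self mul1r subrr if_same.
by apply: coord_inj => t; rewrite !e.
Qed.

Let g : wedge x0 -> realization R G := wedge_fun gi.

Lemma gE i (y : X i) : g (wedge_lift x0 y) = gi y.
Proof. by rewrite /g wedge_lift_funE //; apply: gi_base. Qed.

Lemma continuous_g : continuous g.
Proof.
apply: wedge_fun_continuous => [i|]; last exact: gi_base.
apply: continuous_realization => -[[w' v]|]; last exact: continuous_ratio.
rewrite (_ : (fun y => _) = (fun y => gf y (Some (w', v)))) //= .
case: (w' == idx i); last exact: cst_continuous.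
apply: continuous_sub; first exact: continuous_coord.
apply: continuous_mul; [exact: continuous_ratio | exact: cst_continuous].
Qed.

(** The multiple of [x0 i] that [g] takes off is the mass at [None], which [f] turns back into the
    same multiple of [x0 i]. *)
Lemma fg_id : f \o g = id.
Proof.
apply: funext => z; have : [set: wedge x0] z by [].
rewrite -wedgeTE => -[i _ [y _ <-]]; rewrite /= gE.
have m j : j != i -> mass j (gi y) = 0.
  by move=> ji; apply: big1 => v _; rewrite point_ofE /= (inj_eq idx_inj) (negbTE ji).
rewrite (fE m); congr wedge_lift; apply: coord_inj => v.
rewrite point_ofE /retrf point_ofE /= eqxx.
have -> : mass i (gi y) = 1 - ratio (x0 i) y.
  by rewrite -(mass_None m) point_ofE /= addrK.
by rewrite subKr subrK.
Qed.

(** The composite only exchanges mass between [None] and multiples of a base point [x0 i], so a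
    point and its image lie in one face, and [straight_line] applies. *)
Lemma gf_support w : (support ((g \o f) w) :|: support w)%SET \in G.
Proof.
have supg i (y : X i) : support (gi y) = [set t | gf y t != 0]%SET.
  by [].
have inS i (a : {set V}) : (support (x0 i) \subset a)%SET -> a \in K (idx i) -> a \in S (idx i).
  by move=> xa Ka; rewrite SI Ka (finset.setUidPl xa).
have big i (a : {set V}) y : a \in S (idx i) -> (support y \subset a)%SET ->
    (support w \subset None |: in_summand (idx i) a)%SET ->
    (support (gi (i := i) y) :|: support w)%SET \in G.
  move=> Sa ya wa; apply: dG (Sface Sa) _; rewrite finset.subUset wa andbT supg.
  by apply: fintype.subset_trans (gf_sub y) _; apply: finset.setUS; rewrite summandS.
rewrite /=; have [z|i z Kp n0 sw|i z Sp sw] := faceP w.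
- rewrite (fE (i := i0)) => [|j _]; last exact: z.
  rewrite gE retr0 ?z //; apply: (big i0 (support (x0 i0))) => //.
    by apply: inS => //; apply: support_face.
  apply/fintype.subsetP => -[[w' v] hv|_]; last by rewrite finset.setU11.
  exfalso; have /wedge_complexP[s0|sN|w2 a /IsP[i ei] _ sa|w2 a /IsP[i ei] _ sa] := support_face w.
  + by rewrite s0 finset.in_set0 in hv.
  + by rewrite sN finset.in_set1 in hv.
  + have : v \in part i w.
      by rewrite finset.in_set; move: (hv); rewrite sa !mem_summand => /andP[_ ->]; rewrite ei eqxx.
    by rewrite mass0_part // finset.in_set0.
  + have : v \in part i w.
      by rewrite finset.in_set; move: (hv); rewrite sa !finset.in_setU1 !mem_summand => /andP[_ ->]; rewrite ei eqxx.
    by rewrite mass0_part // finset.in_set0.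
- rewrite (fE z) gE.
  have m1 : mass i w = 1 by rewrite -(mass_None z) n0 addr0.
  have sr : support (retr i w) = part i w.
    apply/setP => v; rewrite coord_supp point_ofE /retrf m1 subrr mul0r addr0.
    by rewrite finset.in_set coord_supp.
  have [r0|rn] := eqVneq (ratio (x0 i) (retr i w)) 0.
    suff /finset.setUidPr -> : (support (gi (retr i w)) \subset support w)%SET by apply: support_face.
    by rewrite supg sw -sr; apply: gf_sub0.
  have r1 : 0 < ratio (x0 i) (retr i w) by rewrite lt_neqAle eq_sym rn ratio_ge0.
  apply: (big i (part i w)); rewrite ?sr ?fintype.subxx //.
    by apply: inS => //; rewrite -sr; apply: ratio_support.
  by rewrite sw finset.subsetUr.
- rewrite (fE z) gE; move: (Sp); rewrite SI => /andP[Kp Kpx].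
  apply: (big i (part i w :|: support (x0 i))%SET).
  + by apply: inS => //; apply: finset.subsetUr.
  + apply/fintype.subsetP => v; apply: contraTT; rewrite finset.in_setU negb_or => /andP[vp vx].
    by rewrite coord_supp negbK point_ofE /retrf part_out // add0r coord_out ?mulr0.
  + by rewrite sw; apply: finset.setUS; rewrite summandS finset.subsetUl.
Qed.

Lemma wedge_hequiv : hequiv R (wedge x0 : topologicalType) (realization R G).
Proof.
exists g, f; split.
- exact: continuous_g.
- exact: continuous_f.
- by rewrite fg_id; apply: deformable_refl => z; apply: cvg_id.
- apply: straight_line dG _ _ gf_support; last by move=> z; apply: cvg_id.
  exact: continuous_compose continuous_f continuous_g.
Qed.

End WedgeRealization.

Lemma Delta_A2E (R : realType) (gT : finGroupType) (p : nat) (Q : {group gT}) :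
  Delta_A2 R p Q = realization R (ge2_flags p Q).
Proof.
rewrite -realization_set0 /Delta_A2; congr (realization R _).
apply/setP => c; rewrite finset.in_setD1 [LHS]finset.in_set andbCA; congr (_ && _).
apply/andP/flagP => [[cQ /forall_inP h]|[cQ h]].
  by split=> // G H Gc Hc; have /forall_inP := h G Gc; apply.
by split=> //; apply/forall_inP => G Gc; apply/forall_inP => H Hc; apply: h.
Qed.

Lemma wedge_complex_void (R : realType) (W V : finType) (N S : W -> {set {set V}}) :
  hequiv R (realization R (wedge_complex finset.set0 N S)) (discrete_topology unit : topologicalType).
Proof.
set M := wedge_complex _ _ _.
have dM : down_closed M by apply: wedge_down_closed => w; rewrite finset.in_set0.
have MN : [set None]%SET \in M by apply/wedge_complexP; apply: WedgeBase.
have supp (x : realization R M) : support x = [set None]%SET.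
  have := support_neq0 x; have /wedge_complexP[->|//|w a|w a] := support_face x.
  - by rewrite eqxx.
  - by rewrite finset.in_set0.
  - by rewrite finset.in_set0.
have [q _] : exists q : realization R M, True.
  have h : geometric_realization R M (fun v => (v == None)%:R).
    split=> [v||]; first exact: ler0n.
      by rewrite (bigD1 None) //= big1 ?addr0 // => v /negbTE ->.
    rewrite (_ : [set v | _]%SET = [set None]%SET) //.
    by apply/setP => v; rewrite !finset.inE pnatr_eq0; case: (v == None).
  by exists (point_of h).
exists (fun=> tt : discrete_topology unit), (fun=> q); split.
- exact: cst_continuous.
- exact: cst_continuous.
- apply: straight_line dM _ _ _ => [|z|x]; [exact: cst_continuous | exact: cvg_id |].
  by rewrite !supp finset.setUid.
- rewrite (_ : _ \o _ = id); last by apply: funext => -[].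
  by apply: deformable_refl => z; apply: cvg_id.
Qed.

(* The base points are arbitrary. *)
Theorem theorem1p4 (R : realType) (p : nat) (gT : finGroupType)
    (P : {group gT}) (p_prime : prime p) (p_odd : odd p)
    (pP : (p.-group P)%g) (ncP : ~~ cyclic P)
    (x0 : forall X : set_type (extraspecial_family p P),
            Delta_A2 R p (set_val X)) :
  homotopy_equivalent R (Delta_A2 R p P)
    (wedge_sum (X := fun X : set_type (extraspecial_family p P) =>
                       Delta_A2 R p (set_val X)) x0).
Proof.
have eX : (fun X : set_type (extraspecial_family p P) => Delta_A2 R p (set_val X)) =
    (fun X => realization R (ge2_flags p (set_val X))).
  by apply: funext => X; rewrite Delta_A2E.
rewrite Delta_A2E; apply: hequiv_homotopy_equivalent.
(* The type of [x0] depends on the family of spaces, so the equality [eX] is substituted in a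
   statement about all families of points. *)
have transport (I : choiceType) (A B : I -> topologicalType) (Q : topologicalType -> Prop) :
  A = B -> (forall y : forall i, B i, Q (wedge_sum y)) -> forall x : forall i, A i, Q (wedge_sum x) by move=> ->.
apply: (transport _ _ _ (hequiv R _) eX) x0 => x0.
have [Z sZ oZ] := exists_central_line p_prime pP ncP.
have famE X := extraspecial_familyE p_prime pP sZ oZ X.
have [s sE] : exists s : {group gT} -> {set {group gT}},
    forall i, s (set_val i) = support (x0 i).
  (* Base points are indexed by a subtype, but the complex requires [s] on the finite type of all
     groups; outside the family the default is the empty set. *)
  suff /fin_all_exists[s sE] : forall w, exists a, forall i, set_val i = w -> a = support (x0 i).
    by exists s => i; apply: sE.
  move=> w; have [[i <-]|none] := pselect (exists i : set_type (extraspecial_family p P), set_val i = w).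
    by exists (support (x0 i)) => j /val_inj ->.
  by exists finset.set0 => i iw; case: none; exists i.
pose Is := [set X : {group gT} | `[< extraspecial_family p P X >]]%SET.
have IsP w : reflect (exists i : set_type (extraspecial_family p P), set_val i = w) (w \in Is).
  rewrite finset.in_set; apply: (iffP (asboolP _)) => [fw|[i <-]]; last exact: set_valP.
  by exists (SigSub (mem_set fw)).
have IsE X : X \in Is <-> exists n, X \in es_family p P Z n.+1.
  by rewrite -famE finset.in_set asboolE.
have sI X : X \in Is -> s X \in ge2_flags p X /\ s X != finset.set0.
  by case/IsP => i <-; rewrite sE; split; [apply: support_face | apply: support_neq0].
have [C1 [C2 [h1 h2 cards]]] := family_wedge p_prime p_odd pP ncP sZ oZ IsE sI.
apply: hequiv_trans (sphere_wedge_hequiv R h1 h2 cards) _.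
rewrite /wedge_sum; case: pselect => [[i0]|none].
  apply: hequiv_sym; apply: (wedge_hequiv _ (x0 := x0) (Is := Is) _ _ _ i0) => //.
  - by move=> i; apply: flag_down_closed.
  - by move=> i; rewrite /star_of sE.
have -> : Is = finset.set0.
  by apply/setP => w; rewrite finset.in_set0; apply/negP => /IsP[i _]; apply: none.
exact: wedge_complex_void.
Qed.
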